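(* Let $1<p<2$, and let $\beta_p>0$ be the ($h$-independent) constant of the discrete divergence inf–sup condition recalled in the context. Then $$\|Q_hu-u_h\|_{L^2(\Omega)}\le\frac1{\alpha\beta_p}\|\boldsymbol{\sigma}-\boldsymbol{\sigma}_h\|_{L^p(\Omega)},$$ and hence $$\|u-u_h\|_{L^2(\Omega)}\le\inf_{v_h\in P_0(\mathcal T_h)}\|u-v_h\|_{L^2(\Omega)}+\frac1{\alpha\beta_p}\|\boldsymbol{\sigma}-\boldsymbol{\sigma}_h\|_{L^p(\Omega)}.$$
   Context: Continuous problem. $\Omega\subset\mathbb R^2$ is a bounded, simply connected Lipschitz domain, $x_0\in\Omega$, $1<p<2$, $p'=p/(p-1)$. The matrix field $A\in L^\infty(\Omega;\mathbb R^{2\times 2})$ is symmetric and uniformly elliptic: $\alpha|\xi|^2\le\xi^TA(x)\xi\le\beta|\xi|^2$ for all $\xi\in\mathbb R^2$ and a.e. $x\in\Omega$, with $0<\alpha\le\beta$. Data: $f_1\in L^2(\Omega)$, $g\in W^{1-1/p,p}(\partial\Omega)$. It is assumed that $-\nabla\cdot(A\nabla u)=f_1+\delta_{x_0}$ in $\Omega$, $u=g$ on $\partial\Omega$, has a unique solution $u\in W^{1,p}(\Omega)$ (which lies in $L^2(\Omega)$ by Sobolev embedding). Let $\mathbf f_2(x):=\frac1{2\pi}\frac{x-x_0}{|x-x_0|^2}$ (so $\nabla\cdot\mathbf f_2=\delta_{x_0}$ in the sense of distributions) and let $\boldsymbol{\sigma}:=-A\nabla u-\mathbf f_2\in L^p(\Omega)^2$;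 it satisfies $\nabla\cdot\boldsymbol{\sigma}=f_1$. Discrete problem. $\mathcal T_h$ is a shape-regular triangulation of $\Omega$. $\mathrm{RT}_0(\mathcal T_h)$ is the space of $\boldsymbol{\tau}_h\in H(\mathrm{div};\Omega)$ with $\boldsymbol{\tau}_h|_K(x)=\mathbf a+bx$, $\mathbf a\in\mathbb R^2$, $b\in\mathbb R$, on each $K\in\mathcal T_h$; $P_0(\mathcal T_h)$ is the space of piecewise constant functions; $(Q_hf)|_K:=|K|^{-1}\int_Kf\,dx$. $(\cdot,\cdot)$ denotes the integral over $\Omega$ of the product. The pair $(\boldsymbol{\sigma}_h,u_h)\in\mathrm{RT}_0(\mathcal T_h)\times P_0(\mathcal T_h)$ is the unique solution of $$(A^{-1}\boldsymbol{\sigma}_h,\boldsymbol{\tau}_h)-(\nabla\cdot\boldsymbol{\tau}_h,u_h)=-(A^{-1}\mathbf f_2,\boldsymbol{\tau}_h)-\langle\boldsymbol{\tau}_h\cdot\mathbf n,g\rangle_{\partial\Omega}\quad\forall\boldsymbol{\tau}_h\in\mathrm{RT}_0(\mathcal T_h),$$ $$(\nabla\cdot\boldsymbol{\sigma}_h,v_h)=(f_1,v_h)\quad\forall v_h\in P_0(\mathcal T_h).$$ Inf–sup constant. $\beta_p>0$ is a constant independent of $h$ (depending on $p$, $\Omega$ and shape regularity) such that, for all $v_h\in P_0(\mathcal T_h)$, $$\sup_{0\ne\boldsymbol{\tau}_h\in\mathrm{RT}_0(\mathcal T_h)}\frac{(\nabla\cdot\boldsymbol{\tau}_h,v_h)}{\|\boldsymbol{\tau}_h\|_{L^{p'}(\Omega)}+\|\nabla\cdot\boldsymbol{\tau}_h\|_{L^2(\Omega)}}\ge\beta_p\|v_h\|_{L^2(\Omega)}.$$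 *)

(* Defs.v *)
From HB Require Import structures.
From mathcomp Require Import all_boot all_order all_algebra.
From mathcomp Require Import all_classical all_reals all_analysis.
Set Implicit Arguments.
Unset Strict Implicit.
Unset Printing Implicit Defensive.
Import Order.TTheory GRing.Theory Num.Theory.
Import numFieldNormedType.Exports.
Local Open Scope classical_set_scope.
Local Open Scope ring_scope.

(* The Euclidean plane is R * R.  The library norm on a product is the max
   norm, so the Euclidean inner product and norm are written out. *)
Notation plane R := (R * R)%type.

Notation mplane R := (measurableTypeR R * measurableTypeR R)%type.

Definition leb2 (R : realType) : {measure set (mplane R) -> \bar R} :=
  ((@lebesgue_measure R) \x (@lebesgue_measure R))%E.

Definition dot (R : realType) (x y : plane R) : R := x.1 * y.1 + x.2 * y.2.

Definition enorm (R : realType) (x : plane R) : R := Num.sqrt (dot x x).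

(* det (x | y) *)
Definition cross (R : realType) (x y : plane R) : R := x.1 * y.2 - x.2 * y.1.

Definition mxv (R : realType) (M : 'M[R]_2) (x : plane R) : plane R :=
  (M ord0 ord0 * x.1 + M ord0 ord_max * x.2,
   M ord_max ord0 * x.1 + M ord_max ord_max * x.2).

(** * Planar domains *)

Definition boundary (R : realType) (O : set (plane R)) : set (plane R) :=
  closure O `\` O°.

(* Near each boundary point z, in orthonormal coordinates (s, t) with origin z
   and t-axis along the unit vector e, O is the part of a rectangle lying
   strictly above the graph of a Lipschitz function. *)
Definition lipschitz_boundary (R : realType) (O : set (plane R)) : Prop :=
  forall z, boundary O z ->
  exists (e : plane R) (r k L : R) (phi : R -> R),
    [/\ enorm e = 1, 0 < r, 0 < k,
        (forall a b, `|phi a - phi b| <= L * `|a - b|) &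
        forall s t, `|s| < r -> `|t| < k ->
          O (z.1 + s * e.2 + t * e.1, z.2 - s * e.1 + t * e.2) <-> phi s < t].

(* Every loop in O is homotopic, through loops in O, to a constant loop. *)
Definition loops_contractible (R : realType) (O : set (plane R)) : Prop :=
  forall gam : R -> plane R,
    {within `[0, 1], continuous gam} -> gam 0 = gam 1 ->
    (forall t, `[0, 1]%classic t -> O (gam t)) ->
  exists H : plane R -> plane R,
    [/\ {within `[0, 1]%classic `*` `[0, 1]%classic, continuous H},
        (forall x, (`[0, 1]%classic `*` `[0, 1]%classic) x -> O (H x)),
        (forall t, `[0, 1]%classic t -> H (0, t) = gam t),
        (forall a, `[0, 1]%classic a -> H (a, 0) = H (a, 1)) &
        (exists c, forall t, `[0, 1]%classic t -> H (1, t) = c)].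

Definition sc_lipschitz_domain (R : realType) (O : set (plane R)) : Prop :=
  [/\ open O, O !=set0, bounded_set O & connected O]
  /\ loops_contractible O /\ lipschitz_boundary O.

Definition segment (R : realType) (a b : plane R) : set (plane R) :=
  [set ((1 - t) * a.1 + t * b.1, (1 - t) * a.2 + t * b.2) | t in `[0, 1]%classic].

(* A triangulated domain is a polygon, so arc length on its boundary is the
   unique Borel measure which is carried by the boundary and restricts to
   one-dimensional Lebesgue measure on each segment of the boundary. *)
Definition is_arclength (R : realType) (O : set (plane R))
    (s : {measure set (mplane R) -> \bar R}) : Prop :=
  s (~` boundary O) = 0%E /\
  forall a b : plane R, segment a b `<=` boundary O ->
  forall B : set (mplane R), measurable B ->
    s (B `&` segment a b) =
    ((enorm (b - a)%R)%:E *
     lebesgue_measure (`[0%R, 1%R]%classic `&`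
       [set t : R | B ((1 - t) * a.1 + t * b.1, (1 - t) * a.2 + t * b.2)%R]))%E.

(** * Function spaces *)

Definition Lpnorm (R : realType)
    (m : {measure set (mplane R) -> \bar R})
    (D : set (plane R)) (p : \bar R) (f : plane R -> R) : \bar R :=
  Lnorm m p (EFin \o (f \_ D)).

Definition inLp (R : realType)
    (m : {measure set (mplane R) -> \bar R})
    (D : set (plane R)) (p : \bar R) (f : plane R -> R) : Prop :=
  measurable_fun (D : set (mplane R)) (f : mplane R -> R) /\ (Lpnorm m D p f < +oo)%E.

Definition inLpv (R : realType)
    (m : {measure set (mplane R) -> \bar R})
    (D : set (plane R)) (p : \bar R) (F : plane R -> plane R) : Prop :=
  inLp m D p (fun x => (F x).1) /\ inLp m D p (fun x => (F x).2).

Definition d1 (R : realType) (f : plane R -> R) (x : plane R) : R :=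
  'D_((1, 0) : plane R) f x.
Definition d2 (R : realType) (f : plane R -> R) (x : plane R) : R :=
  'D_((0, 1) : plane R) f x.
Definition grad (R : realType) (f : plane R -> R) (x : plane R) : plane R :=
  (d1 f x, d2 f x).

Fixpoint Ck (R : realType) (n : nat) (f : plane R -> R) : Prop :=
  continuous f /\
  if n is m.+1 then
    (forall x, derivable f x ((1, 0) : plane R)
               /\ derivable f x ((0, 1) : plane R))
    /\ Ck m (d1 f) /\ Ck m (d2 f)
  else True.

Definition smooth (R : realType) (f : plane R -> R) : Prop := forall n, Ck n f.

(* C_c^oo(O) *)
Definition test_fun (R : realType) (O : set (plane R)) (phi : plane R -> R) : Prop :=
  let supp := closure [set x | phi x != 0] in
  [/\ smooth phi, compact supp & supp `<=` O].

Definition weak_grad (R : realType) (O : set (plane R))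
    (u : plane R -> R) (du : plane R -> plane R) : Prop :=
  forall phi, test_fun O phi ->
    (\int[leb2 R]_(x in O) (u x * d1 phi x)) =
      - (\int[leb2 R]_(x in O) ((du x).1 * phi x)) /\
    (\int[leb2 R]_(x in O) (u x * d2 phi x)) =
      - (\int[leb2 R]_(x in O) ((du x).2 * phi x)).

Definition weak_div (R : realType) (O : set (plane R))
    (F : plane R -> plane R) (dF : plane R -> R) : Prop :=
  forall phi, test_fun O phi ->
    (\int[leb2 R]_(x in O) dot (F x) (grad phi x)) =
      - (\int[leb2 R]_(x in O) (dF x * phi x)).

(* u is in W^{1,p}(O), with gradient du (determined up to null sets) *)
Definition inW1p (R : realType) (O : set (plane R)) (p : R)
    (u : plane R -> R) (du : plane R -> plane R) : Prop :=
  [/\ inLp (leb2 R) O p%:E u, inLpv (leb2 R) O p%:E du & weak_grad O u du].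

(* F is in H(div; O), with divergence dF (determined up to null sets) *)
Definition inHdiv (R : realType) (O : set (plane R))
    (F : plane R -> plane R) (dF : plane R -> R) : Prop :=
  [/\ inLpv (leb2 R) O 2%:E F, inLp (leb2 R) O 2%:E dF & weak_div O F dF].

(* W^{1-1/p,p} of the boundary, with the Gagliardo-Slobodeckij seminorm: on a
   curve the exponent 1 + (1 - 1/p) p of the kernel is equal to p. *)
Definition in_trace_space (R : realType) (O : set (plane R))
    (s : {measure set (mplane R) -> \bar R})
    (p : R) (g : plane R -> R) : Prop :=
  inLp s (boundary O) p%:E g /\
  (\int[s]_(x in boundary O) \int[s]_(y in boundary O)
     ((`|g x - g y| `^ p / enorm (x - y)%R `^ p)%R%:E) < +oo)%E.

(* The trace is the continuous extension to W^{1,p}(O) of the restriction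
   w |-> w|_{boundary}, for w smooth up to the boundary. *)
Definition has_trace (R : realType) (O : set (plane R))
    (s : {measure set (mplane R) -> \bar R})
    (p : R) (u : plane R -> R) (du : plane R -> plane R) (g : plane R -> R) : Prop :=
  exists w : nat -> plane R -> R,
    [/\ forall n, smooth (w n),
        Lpnorm (leb2 R) O p%:E (fun x => w n x - u x) @[n --> \oo] --> 0%E,
        Lpnorm (leb2 R) O p%:E (fun x => enorm (grad (w n) x - du x))
          @[n --> \oo] --> 0%E &
        Lpnorm s (boundary O) p%:E (fun x => w n x - g x) @[n --> \oo] --> 0%E].

(** * The continuous problem *)

Definition sym_elliptic (R : realType) (O : set (plane R)) (alpha beta : R)
    (A : plane R -> 'M[R]_2) : Prop :=
  [/\ forall i j, inLp (leb2 R) O +oo%E (fun x => A x i j),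
      {ae leb2 R, forall x, O x -> (A x)^T = A x} &
      {ae leb2 R, forall x, O x -> forall xi : plane R,
         alpha * enorm xi ^+ 2 <= dot xi (mxv (A x) xi) <= beta * enorm xi ^+ 2}].

(* - div (A grad u) = f1 + delta_x0 in O and u = g on the boundary *)
Definition dirac_solution (R : realType) (O : set (plane R))
    (s : {measure set (mplane R) -> \bar R})
    (p : R) (x0 : plane R) (A : plane R -> 'M[R]_2) (f1 g : plane R -> R)
    (u : plane R -> R) (du : plane R -> plane R) : Prop :=
  [/\ inW1p O p u du, has_trace O s p u du g &
      forall phi, test_fun O phi ->
        (\int[leb2 R]_(x in O) dot (mxv (A x) (du x)) (grad phi x)) =
        (\int[leb2 R]_(x in O) (f1 x * phi x)) + phi x0].

Definition f2 (R : realType) (x0 x : plane R) : plane R :=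
  (2 * pi * enorm (x - x0) ^+ 2)^-1 *: (x - x0).

Definition flux (R : realType) (x0 : plane R) (A : plane R -> 'M[R]_2)
    (du : plane R -> plane R) (x : plane R) : plane R :=
  - mxv (A x) (du x) - f2 x0 x.

(** * Triangulations *)

Record mesh (R : realType) := Mesh {
  ncell : nat;
  vert : 'I_ncell -> 'I_3 -> plane R }.

(* The face of the i-th triangle spanned by its vertices with label in B:
   the closed triangle for B = setT, the edge opposite to vertex k for
   B = [set~ k], the empty set for B = set0. *)
Definition face (R : realType) (T : mesh R) (i : 'I_(ncell T)) (B : {set 'I_3}) :
    set (plane R) :=
  [set x | exists t : 'I_3 -> R,
    [/\ forall k, 0 <= t k, forall k, k \notin B -> t k = 0,
        \sum_k t k = 1 & x = \sum_k (t k *: vert i k)]].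

(* Piecewise functions are only specified on open triangles; the edges form a
   null set. *)
Definition cell (R : realType) (T : mesh R) (i : 'I_(ncell T)) : set (plane R) :=
  (face i [set: 'I_3]%SET)°.

Definition triangulation (R : realType) (O : set (plane R)) (T : mesh R) : Prop :=
  [/\ forall i : 'I_(ncell T),
        cross (vert i (inord 1) - vert i ord0) (vert i (inord 2) - vert i ord0) != 0,
      closure O = \bigcup_(i in [set: 'I_(ncell T)]) face i [set: 'I_3]%SET &
      forall i j : 'I_(ncell T), i != j ->
        exists B C : {set 'I_3},
          [/\ B != [set: 'I_3]%SET, C != [set: 'I_3]%SET,
              face i [set: 'I_3]%SET `&` face j [set: 'I_3]%SET = face i B &
              face i B = face j C]].

(* Each triangle contains a disc of radius r with diameter <= kappa r. *)
Definition shape_regular (R : realType) (kappa : R) (T : mesh R) : Prop :=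
  forall i : 'I_(ncell T), exists (c : plane R) (r : R),
    [/\ 0 < r, [set x | enorm (x - c) <= r] `<=` face i [set: 'I_3]%SET &
        forall j k, enorm (vert i j - vert i k) <= kappa * r].

(** * Discrete spaces *)

(* P_0 : one coefficient per triangle *)
Definition P0fun (R : realType) (T : mesh R) (v : {ffun 'I_(ncell T) -> R})
    (x : plane R) : R :=
  \sum_i v i * \1_(cell i) x.

Definition Qh (R : realType) (T : mesh R) (f : plane R -> R) :
    {ffun 'I_(ncell T) -> R} :=
  [ffun i => (fine (leb2 R (cell i)))^-1 * \int[leb2 R]_(x in cell i) f x].

(* A piecewise field a + b x is given by one pair (a, b) per triangle. *)
Definition rtpoly (R : realType) (c : plane R * R) (x : plane R) : plane R :=
  c.1 + c.2 *: x.

Definition RTfun (R : realType) (T : mesh R)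
    (c : {ffun 'I_(ncell T) -> plane R * R}) (x : plane R) : plane R :=
  \sum_i (\1_(cell i) x : R) *: rtpoly (c i) x.

(* The field with coefficients c is in RT_0(T), and has divergence dc. *)
Definition inRT0 (R : realType) (O : set (plane R)) (T : mesh R)
    (c : {ffun 'I_(ncell T) -> plane R * R}) (dc : plane R -> R) : Prop :=
  inHdiv O (RTfun c) dc.

(* Outward unit normal of the i-th triangle on the edge opposite to vertex k
   (the labels k + 1 and k + 2 are taken modulo 3); the sign accounts for the
   orientation of the vertices. *)
Definition outer_normal (R : realType) (T : mesh R) (i : 'I_(ncell T)) (k : 'I_3) :
    plane R :=
  let a := vert i (k + 1) in
  let t := vert i (k + 2%:R) - a in
  (Num.sg (cross t (vert i k - a)) / enorm t) *: (t.2, - t.1).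

(* <tau . n, g> on the boundary of O, for the RT_0 field tau with coefficients
   c: the sum of the integrals over the edges lying on the boundary. *)
Definition bdry_pairing (R : realType) (O : set (plane R))
    (s : {measure set (mplane R) -> \bar R})
    (T : mesh R) (c : {ffun 'I_(ncell T) -> plane R * R}) (g : plane R -> R) : R :=
  \sum_(i : 'I_(ncell T))
    \sum_(k : 'I_3 | `[< face i (~: [set k])%SET `<=` boundary O >])
      \int[s]_(x in face i (~: [set k])%SET)
        (dot (rtpoly (c i) x) (outer_normal i k) * g x).

Definition mixed_solution (R : realType) (O : set (plane R))
    (s : {measure set (mplane R) -> \bar R})
    (x0 : plane R) (A : plane R -> 'M[R]_2) (f1 g : plane R -> R) (T : mesh R)
    (sigma : {ffun 'I_(ncell T) -> plane R * R}) (u : {ffun 'I_(ncell T) -> R}) :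
    Prop :=
  exists dsigma, [/\ inRT0 O sigma dsigma,
    forall (tau : {ffun 'I_(ncell T) -> plane R * R}) dtau, inRT0 O tau dtau ->
      (\int[leb2 R]_(x in O) dot (mxv (invmx (A x)) (RTfun sigma x)) (RTfun tau x))
      - (\int[leb2 R]_(x in O) (dtau x * P0fun u x)) =
      - (\int[leb2 R]_(x in O) dot (mxv (invmx (A x)) (f2 x0 x)) (RTfun tau x))
      - bdry_pairing O s tau g &
    forall v : {ffun 'I_(ncell T) -> R},
      (\int[leb2 R]_(x in O) (dsigma x * P0fun v x)) =
      (\int[leb2 R]_(x in O) (f1 x * P0fun v x))].

Definition inf_sup_quotient (R : realType) (O : set (plane R)) (T : mesh R) (p : R)
    (tau : {ffun 'I_(ncell T) -> plane R * R}) (dtau : plane R -> R)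
    (v : {ffun 'I_(ncell T) -> R}) : R :=
  (\int[leb2 R]_(x in O) (dtau x * P0fun v x)) /
  (fine (Lpnorm (leb2 R) O (p / (p - 1))%:E (fun x => enorm (RTfun tau x)))
   + fine (Lpnorm (leb2 R) O 2%:E dtau)).

Definition inf_sup (R : realType) (O : set (plane R)) (T : mesh R) (p betap : R) :
    Prop :=
  forall v : {ffun 'I_(ncell T) -> R},
  (betap%:E * Lpnorm (leb2 R) O 2%:E (P0fun v) <=
   ereal_sup [set r | exists (tau : {ffun 'I_(ncell T) -> plane R * R}) dtau,
     [/\ inRT0 O tau dtau, tau != 0%R &
         r = (inf_sup_quotient O p tau dtau v)%:E]])%E.

(* Main.v *)
Require Import Defs.
From HB Require Import structures.
From mathcomp Require Import all_boot all_order all_algebra.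
From mathcomp Require Import all_classical all_reals all_analysis.
From mathcomp Require Import measurable_realfun unstable.
From mathcomp Require Import ring lra.
Import Order.TTheory GRing.Theory Num.Theory.
Import numFieldNormedType.Exports.
Set Implicit Arguments.
Unset Strict Implicit.
Unset Printing Implicit Defensive.
Local Open Scope classical_set_scope.
Local Open Scope ring_scope.

(** The first estimate is a duality argument.  Put e := Q_h u - u_h and
    eta := sigma - sigma_h.  For a Raviart-Thomas field tau, Green's formula
    reads

      int_O grad u . tau + int_O (Q_h u) div tau = < tau . n, g >,

    where Q_h u may stand for u because div tau is constant on each triangle.
    Since grad u = - A^-1 (eta + f2 + sigma_h) almost everywhere, subtracting
    the discrete equation leaves

      int_O e div tau = int_O (A^-1 eta) . tau

    ([error_identity]).  Ellipticity gives |A^-1 eta| <= |eta| / alpha, so by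
    Hoelder's inequality the right-hand side is at most
    |eta|_p |tau|_p' / alpha ([quotient_le]), and the inf-sup condition turns
    this bound, uniform in tau, into a bound for |e|_2 ([le_of_inf_sup]).  All
    this is done when |eta|_p is finite, in which case eta is integrable and
    the integrability of (A^-1 f2) . tau is inherited from the other terms;
    when |eta|_p is infinite, so is the right-hand side of the estimate.  The
    second estimate follows by the triangle inequality, as Q_h u is the best
    approximation of u in L^2 ([Qh_best]).

    The work lies in Green's formula ([green_RT]), because tau is only known
    piecewise together with a weak divergence, and u only through smooth
    approximations w_n up to the boundary.

    - On one triangle and for smooth functions the divergence theorem is
      obtained by integrating over horizontal, then vertical slices
      ([tri_int_d1], [tri_int_d2], [divergence_triangle]).

    - Every open set U carries test functions chi_n with values in [0, 1] that
      tend to 1 pointwise on U ([cutoff_test_fun], [cutoff_cvg]).  Testing the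
      weak divergence of tau with w chi_n for U a single triangle shows that
      div tau is the piecewise one, a + b x having divergence 2 b
      ([cell_div]).  With U = O, the boundary terms vanish and the limit says
      that the fluxes through all edges which do not lie in the boundary of O
      add up to zero ([interior_flux0]).  This replaces the matching of normal
      components across each edge.  The limit needs such edges to run inside O
      up to their end points; this holds because the mesh is conforming and a
      Lipschitz domain has no slits ([edge_interior]).

    - What remains is Green's formula for smooth w, with the boundary edges
      only ([green_smooth]).  Both sides are continuous in w, by Hoelder's
      inequality on the triangles and on the boundary edges, where the arc
      length measure is Lebesgue measure on a segment
      ([arclength_Rintegral]).  So it passes to the limit along w_n
      ([green_trace]). *)

(** * Measurability and integration in the plane *)

Definition qbox (R : realType) (q : rat * rat * rat) : set (plane R) :=
  [set x | `|x.1 - ratr q.1.1| < ratr q.2 /\ `|x.2 - ratr q.1.2| < ratr q.2].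
Definition cbox (R : realType) (q : rat * rat * rat) : set (plane R) :=
  [set x | `|x.1 - ratr q.1.1| <= ratr q.2 /\ `|x.2 - ratr q.1.2| <= ratr q.2].

(** Countably many boxes with rational data suffice to exhaust an open set;
    they give both the measurability of open sets and the cutoff functions
    below.  The closed box is kept inside U so that a function supported in it
    has compact support in U. *)
Lemma open_qbox (R : realType) (U : set (plane R)) x : open U -> U x ->
  exists q, @qbox R q x /\ @cbox R q `<=` U.
Proof.
move=> oU Ux.
have /nbhs_ballP[e /= e0 He] : nbhs x U by apply: open_nbhs_nbhs; split.
(* for r < e / 4, the ball of radius e around x contains the closed box of
   half-width r around any point whose coordinates are within r of those of x *)
have [r /andP[r1 r2]] : exists r : rat, e / 8 < ratr r < e / 4.
  have [|r] := @rat_in_itvoo R (e / 8) (e / 4); first by lra.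
  by rewrite in_itv /= => ?; exists r.
have [a Ha] : exists a : rat, x.1 - ratr r < ratr a < x.1.
  have [|a] := @rat_in_itvoo R (x.1 - ratr r) x.1; first by lra.
  by rewrite in_itv /= => ?; exists a.
have [b Hb] : exists b : rat, x.2 - ratr r < ratr b < x.2.
  have [|b] := @rat_in_itvoo R (x.2 - ratr r) x.2; first by lra.
  by rewrite in_itv /= => ?; exists b.
exists (a, b, r); split.
  by rewrite /qbox /=; split; rewrite ltr_norml; lra.
move=> y [/= y1 y2]; apply: He; move: y1 y2; rewrite !ler_norml => y1 y2.
by split; rewrite /ball /=; rewrite ltr_norml; lra.
Qed.

Lemma measurable_qbox (R : realType) q : measurable (@qbox R q : set (mplane R)).
Proof.
have -> : @qbox R q =
    [set t : measurableTypeR R | `|t - ratr q.1.1| < ratr q.2] `*`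
    [set t : measurableTypeR R | `|t - ratr q.1.2| < ratr q.2].
  by apply/seteqP; split => -[].
apply: measurableX.
  have -> : [set t : measurableTypeR R | `|t - ratr q.1.1| < ratr q.2] = ball (ratr q.1.1 : R) (ratr q.2).
    by apply/seteqP; split => t; rewrite /ball /= distrC.
  by apply: open_measurable; exact: ball_open.
have -> : [set t : measurableTypeR R | `|t - ratr q.1.2| < ratr q.2] = ball (ratr q.1.2 : R) (ratr q.2).
  by apply/seteqP; split => t; rewrite /ball /= distrC.
by apply: open_measurable; exact: ball_open.
Qed.

(** The measurable structure of the plane is the product one, whence the
    covering by countably many boxes. *)
Lemma plane_open_measurable (R : realType) (U : set (plane R)) :
  open U -> measurable (U : set (mplane R)).
Proof.
move=> oU.
have -> : U = \bigcup_(q in [set q | @cbox R q `<=` U]) @qbox R q.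
  apply/seteqP; split => x.
    by move=> Ux; have [q [qx qU]] := open_qbox oU Ux; exists q.
  move=> [q qU [q1 q2]]; apply: qU; split; exact: ltW.
rewrite bigcup_mkcond; apply: countable_bigcupT_measurable => [|q]; first exact: countableP.
by case: ifP => _ //; exact: measurable_qbox.
Qed.

Lemma plane_continuous_measurable (R : realType) (f : plane R -> R) :
  continuous f -> measurable_fun [set: mplane R] (f : mplane R -> R).
Proof.
move=> cf; apply: (measurability _ (RGenOpens.measurableE R)).
move=> _ [_ [a [b ->] <-]]; apply: measurableI => //.
apply: plane_open_measurable.
have /continuousP := cf.
by apply; exact: interval_open.
Qed.

Definition box (R : realType) (M : R) : set (plane R) := [set x | `|x.1| <= M /\ `|x.2| <= M].

Lemma boxE (R : realType) (M : R) : box M = `[- M, M]%classic `*` `[- M, M]%classic.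
Proof. by apply/seteqP; split => x; rewrite /box /= !in_itv /= !ler_norml. Qed.

Lemma bounded_sub_box (R : realType) (O : set (plane R)) :
  bounded_set O -> exists2 M : R, 0 < M & O `<=` box M.
Proof.
move=> [M [_ HM]]; exists (`|M| + 1) => [|x Ox]; first by rewrite ltr_wpDl.
have /HM /(_ _ Ox) : M < `|M| + 1 by rewrite (le_lt_trans (ler_norm _))// ltrDl.
rewrite /= => H; have : Num.max `|x.1| `|x.2| <= `|M| + 1 by exact: H.
by rewrite ge_max => /andP[].
Qed.

Lemma compact_box (R : realType) (M : R) : compact (box M).
Proof. by rewrite boxE; apply: compact_setX; exact: segment_compact. Qed.

Lemma measurable_box (R : realType) (M : R) : measurable (box M : set (mplane R)).
Proof. by rewrite boxE; apply: measurableX; exact: measurable_itv. Qed.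

Lemma leb2_box_fin (R : realType) (M : R) : (leb2 R (box M) < +oo)%E.
Proof.
rewrite boxE.
have -> : leb2 R (`[- M, M]%classic `*` `[- M, M]%classic) =
  ((@lebesgue_measure R `[(- M)%R, M]%classic) * (@lebesgue_measure R `[(- M)%R, M]%classic))%E.
  by apply: product_measure1E; exact: measurable_itv.
by rewrite !lebesgue_measure_itv /=; case: ifP => _; rewrite ?mul0e ?lte_pinfty // -EFinD -EFinM ltry.
Qed.

Lemma leb2_bounded_fin (R : realType) (O : set (plane R)) :
  bounded_set O -> measurable (O : set (mplane R)) -> (leb2 R O < +oo)%E.
Proof.
move=> /bounded_sub_box[M M0 OM] measurable_domain; apply: le_lt_trans (leb2_box_fin M).
by apply: le_measure => //; rewrite inE //; exact: measurable_box.
Qed.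

Lemma continuous_bounded_box (R : realType) (f : plane R -> R) (M : R) :
  continuous f -> exists2 C, 0 < C & forall x, box M x -> `|f x| <= C.
Proof.
move=> cf; have : compact (f @` box M).
  by apply: continuous_compact (@compact_box R M); exact: continuous_subspaceT.
move=> /compact_bounded[C [_ HC]]; exists (`|C| + 1) => [|x bx]; first by rewrite ltr_wpDl.
have /HC : C < `|C| + 1 by rewrite (le_lt_trans (ler_norm _))// ltrDl.
by apply; exists x.
Qed.


Section fubini_plane.
Context (R : realType).
Local Notation leb := (@lebesgue_measure R).
Implicit Types f : plane R -> \bar R.
Local Open Scope ereal_scope.

Lemma leb2_integral_xy f : (leb2 R).-integrable setT (f : mplane R -> \bar R) ->
  \int[leb2 R]_x f x = \int[leb]_x \int[leb]_y f (x, y).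
Proof.
by move=> fi; have := @integral12_prod_meas1 _ _ _ _ R leb leb _ fi.
Qed.

Lemma leb2_integral_yx f : (leb2 R).-integrable setT (f : mplane R -> \bar R) ->
  \int[leb2 R]_x f x = \int[leb]_y \int[leb]_x f (x, y).
Proof.
by move=> fi; have := @integral21_prod_meas1 _ _ _ _ R leb leb _ fi.
Qed.

Lemma leb2_integrable_swap f : (leb2 R).-integrable setT (f : mplane R -> \bar R) ->
  (leb2 R).-integrable setT (fun x : mplane R => f (x.2, x.1)).
Proof.
move=> fi; have mf := measurable_int _ fi.
apply/(@integrable12ltyP _ _ _ _ R leb leb).
  apply: (measurableT_comp mf); exact: measurable_swap.
exact: (@integrable21ltyP _ _ _ _ R leb leb _ mf).1.
Qed.

Lemma leb2_integral_swap f : (leb2 R).-integrable setT (f : mplane R -> \bar R) ->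
  \int[leb2 R]_x f x = \int[leb2 R]_x f (x.2, x.1).
Proof.
move=> fi; rewrite (leb2_integral_xy fi).
by rewrite (leb2_integral_yx (leb2_integrable_swap fi)).
Qed.
End fubini_plane.

(** * Smooth functions and flat exponentials *)

Lemma Ck_continuous (R : realType) n (f : plane R -> R) : Ck n f -> continuous f.
Proof. by case: n => [|n] []. Qed.

Lemma CkS (R : realType) n (f : plane R -> R) : Ck n.+1 f -> Ck n f.
Proof.
elim: n f => [f [cf _]//|n IH f [cf [df [d1f d2f]]]].
split; first exact: cf.
split; first exact: df.
split; [exact: (IH _ d1f)|exact: (IH _ d2f)].
Qed.

Lemma Ck_cst (R : realType) n (c : R) : Ck n (fun _ : plane R => c).
Proof.
elim: n c => [c|n IH c]; first by split => //; exact: cst_continuous.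
split; first exact: cst_continuous.
split; first by move=> x; split; exact: derivable_cst.
by split; [have -> : d1 (fun _ : plane R => c) = (fun _ => 0)|
  have -> : d2 (fun _ : plane R => c) = (fun _ => 0)] => //;
  apply/funext => x; exact: derive_cst.
Qed.

Lemma CkD (R : realType) n (f g : plane R -> R) :
  Ck n f -> Ck n g -> Ck n (fun x => f x + g x).
Proof.
elim: n f g => [f g [cf _] [cg _]|n IH f g [cf [df [d1f d2f]]] [cg [dg [d1g d2g]]]].
  by split=> // x; apply: cvgD; [exact: cf|exact: cg].
split; first by move=> x; apply: cvgD; [exact: cf|exact: cg].
split.
  move=> x; have [f1 f2] := df x; have [g1 g2] := dg x.
  by split; [exact: (derivableD f1 g1)|exact: (derivableD f2 g2)].
split.
  have -> : d1 (fun x => f x + g x) = (fun x => d1 f x + d1 g x).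
    by apply/funext => x; have [f1 f2] := df x; have [g1 g2] := dg x; exact: deriveD.
  exact: IH.
have -> : d2 (fun x => f x + g x) = (fun x => d2 f x + d2 g x).
  by apply/funext => x; have [f1 f2] := df x; have [g1 g2] := dg x; exact: deriveD.
exact: IH.
Qed.

Lemma d1M (R : realType) (f g : plane R -> R) x :
  derivable f x ((1, 0) : plane R) -> derivable g x ((1, 0) : plane R) ->
  d1 (fun x => f x * g x) x = f x * d1 g x + g x * d1 f x.
Proof. by move=> df dg; exact: (deriveM df dg). Qed.

Lemma d2M (R : realType) (f g : plane R -> R) x :
  derivable f x ((0, 1) : plane R) -> derivable g x ((0, 1) : plane R) ->
  d2 (fun x => f x * g x) x = f x * d2 g x + g x * d2 f x.
Proof. by move=> df dg; exact: (deriveM df dg). Qed.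

Lemma CkM (R : realType) n (f g : plane R -> R) :
  Ck n f -> Ck n g -> Ck n (fun x => f x * g x).
Proof.
elim: n f g => [f g [cf _] [cg _]|n IH f g Cf Cg].
  by split=> // x; apply: cvgM; [exact: cf|exact: cg].
have [cf [df [d1f d2f]]] := Cf; have [cg [dg [d1g d2g]]] := Cg.
split; first by move=> x; apply: cvgM; [exact: cf|exact: cg].
split.
  move=> x; have [f1 f2] := df x; have [g1 g2] := dg x.
  by split; [exact: (derivableM f1 g1)|exact: (derivableM f2 g2)].
split.
  have -> : d1 (fun x => f x * g x) = (fun x => f x * d1 g x + g x * d1 f x).
    by apply/funext => x; have [f1 f2] := df x; have [g1 g2] := dg x; exact: d1M.
  by apply: CkD; apply: IH => //; exact: CkS.
have -> : d2 (fun x => f x * g x) = (fun x => f x * d2 g x + g x * d2 f x).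
  by apply/funext => x; have [f1 f2] := df x; have [g1 g2] := dg x; exact: d2M.
by apply: CkD; apply: IH => //; exact: CkS.
Qed.

Lemma Ck_prod (R : realType) n (I : Type) (r : seq I) (f : I -> plane R -> R) :
  (forall i, Ck n (f i)) -> Ck n (fun x => \prod_(i <- r) f i x).
Proof.
move=> Cf; elim: r => [|i r IH].
  have -> : (fun x : plane R => \prod_(i <- [::]) f i x) = (fun=> 1).
    by apply/funext => x; rewrite big_nil.
  exact: Ck_cst.
have -> : (fun x : plane R => \prod_(i <- i :: r) f i x) =
          (fun x => f i x * \prod_(i <- r) f i x).
  by apply/funext => x; rewrite big_cons.
exact: CkM.
Qed.

(** Iterated differentiability of functions of one variable, the counterpart of
    [Ck]; the one-variable building blocks are lifted to the plane by [Ck_fst]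
    and [Ck_snd]. *)
Fixpoint Ck1 (R : realType) (n : nat) (h : R -> R) : Prop :=
  continuous h /\
  if n is m.+1 then (forall t, derivable h t 1) /\ Ck1 m (fun t => 'D_1 h t) else True.

Lemma derivable_fst2 (R : realType) (h : R -> R) (x : plane R) :
  derivable (fun x : plane R => h x.1) x ((0, 1) : plane R) /\
  d2 (fun x : plane R => h x.1) x = 0.
Proof.
suff H : is_derive x ((0, 1) : plane R) (fun x : plane R => h x.1) 0.
  by split; [exact: ex_derive|exact: derive_val].
have E : (fun t : R => t^-1 *: ((h ((t *: ((0, 1) : plane R) + x).1)) - h x.1)) = (fun=> 0).
  by apply/funext => t; rewrite /= scaler0 add0r subrr scaler0.
apply: DeriveDef.
  by rewrite /derivable /= E; exact: is_cvg_cst.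
by rewrite /derive /= E; exact: lim_cst.
Qed.

Lemma derivable_snd1 (R : realType) (h : R -> R) (x : plane R) :
  derivable (fun x : plane R => h x.2) x ((1, 0) : plane R) /\
  d1 (fun x : plane R => h x.2) x = 0.
Proof.
suff H : is_derive x ((1, 0) : plane R) (fun x : plane R => h x.2) 0.
  by split; [exact: ex_derive|exact: derive_val].
have E : (fun t : R => t^-1 *: ((h ((t *: ((1, 0) : plane R) + x).2)) - h x.2)) = (fun=> 0).
  by apply/funext => t; rewrite /= scaler0 add0r subrr scaler0.
apply: DeriveDef.
  by rewrite /derivable /= E; exact: is_cvg_cst.
by rewrite /derive /= E; exact: lim_cst.
Qed.

Lemma Ck_fst (R : realType) n (h : R -> R) : Ck1 n h -> Ck n (fun x : plane R => h x.1).
Proof.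
elim: n h => [h [ch _]|n IH h [ch [dh Ch]]].
  by split=> // x; apply: continuous_comp; [exact: cvg_fst|exact: ch].
split; first by move=> x; apply: continuous_comp; [exact: cvg_fst|exact: ch].
split; first by move=> x; split; [exact: (dh x.1)|case: (derivable_fst2 h x)].
split; first exact: (IH _ Ch).
have -> : d2 (fun x : plane R => h x.1) = (fun=> 0).
  by apply/funext => x; case: (derivable_fst2 h x).
exact: Ck_cst.
Qed.

Lemma Ck_snd (R : realType) n (h : R -> R) : Ck1 n h -> Ck n (fun x : plane R => h x.2).
Proof.
elim: n h => [h [ch _]|n IH h [ch [dh Ch]]].
  by split=> // x; apply: continuous_comp; [exact: cvg_snd|exact: ch].
split; first by move=> x; apply: continuous_comp; [exact: cvg_snd|exact: ch].
split; first by move=> x; split; [case: (derivable_snd1 h x)|exact: (dh x.2)].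
split; last exact: (IH _ Ch).
have -> : d1 (fun x : plane R => h x.2) = (fun=> 0).
  by apply/funext => x; case: (derivable_snd1 h x).
exact: Ck_cst.
Qed.

Lemma Ck1_cst (R : realType) n (c : R) : Ck1 n (fun _ : R => c).
Proof.
elim: n c => [c|n IH c]; first by split => //; exact: cst_continuous.
split; first exact: cst_continuous.
split; first by move=> x; exact: derivable_cst.
by have -> : (fun t => 'D_1 (fun _ : R => c) t) = (fun _ => 0) => //;
  apply/funext => x; exact: derive_cst.
Qed.

Lemma Ck1_id (R : realType) n : Ck1 n (fun t : R => t).
Proof.
case: n => [|n]; first by split => // x; exact: cvg_id.
split; first by move=> x; exact: cvg_id.
split; first by move=> x; exact: derivable_id.
have -> : (fun t => 'D_1 (fun t : R => t) t) = (fun _ => 1); last exact: Ck1_cst.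
by apply/funext => x; exact: derive_id.
Qed.

Lemma poly_expR_bound (R : realType) (P : {poly R}) (e : R) : 0 < e ->
  exists2 C, 0 <= C & forall s, 0 <= s -> `|P.[s]| <= C * expR (e * s).
Proof.
elim/poly_ind: P e => [|P c IH] e e0.
  by exists 0 => // s s0; rewrite horner0 normr0 mul0r.
have [|C C0 HC] := IH (e / 2); first by lra.
exists (C * (2 / e) + `|c|) => [|s s0].
  by rewrite addr_ge0// mulr_ge0// divr_ge0// ltW.
rewrite hornerMXaddC (le_trans (ler_normD _ _))// mulrDl lerD//.
  rewrite normrM (ger0_norm s0).
  have h1 := HC s s0.
  have h2 : s <= 2 / e * expR (e / 2 * s).
    have := expR_ge1Dx (e / 2 * s) => h.
    have Es : s = 2 / e * (e / 2 * s) by field; rewrite gt_eqF.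
    rewrite [leLHS]Es ler_wpM2l// ?divr_ge0// ?ltW//.
    by rewrite (lt_le_trans _ h)// ltrDr.
  have -> : C * (2 / e) * expR (e * s) = (C * expR (e / 2 * s)) * (2 / e * expR (e / 2 * s)).
    have -> : e * s = e / 2 * s + e / 2 * s by lra.
    by rewrite expRD; ring.
  by apply: ler_pM.
rewrite ler_peMr// -expR0 ler_expR mulr_ge0// ltW//.
Qed.

(** The functions P(1/t) exp(-1/t), extended by 0 to t <= 0.  Each is
    differentiable everywhere and its derivative is again of this form, for
    another polynomial P; that makes all of them smooth by a single
    induction. *)
Definition flat (R : realType) (P : {poly R}) (t : R) : R :=
  if 0 < t then P.[t^-1] * expR (- t^-1) else 0.

(** The quadratic bound gives the derivative 0 at the origin, the only point
    where the two formulas meet. *)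
Lemma flat_le_sqr (R : realType) (P : {poly R}) :
  exists2 C, 0 <= C & forall t, `|flat P t| <= C * t ^+ 2.
Proof.
have [|C C0 HC] := @poly_expR_bound R (P * 'X^2) 1; first by [].
exists C => // t; rewrite /flat; case: ifPn => [t0|_]; last first.
  by rewrite normr0 mulr_ge0// sqr_ge0.
have := HC t^-1; rewrite invr_ge0 (ltW t0) => /(_ isT).
rewrite hornerM hornerXn normrM mul1r [`|t^-1 ^+ 2|]ger0_norm ?sqr_ge0// => h.
rewrite normrM [`|expR _|]ger0_norm ?expR_ge0// expRN.
rewrite ler_pdivrMr ?expR_gt0//.
have t2 : 0 < t ^+ 2 by rewrite exprn_gt0.
have := ler_wpM2r (ltW t2) h.
rewrite -mulrA exprVn mulVf ?gt_eqF// mulr1 => h'.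
by rewrite (le_trans h')// mulrAC.
Qed.

Lemma flat_derive (R : realType) (P : {poly R}) (t : R) :
  is_derive t (1 : R) (flat P) (flat ('X^2 * (P - P^`())) t).
Proof.
have [t0|t0|t0] := ltgtP 0 t.
- have E : \forall s \near t, P.[s^-1] * expR (- s^-1) = flat P s.
    by near=> s; rewrite /flat ifT//; near: s; exact: lt_nbhsr.
  apply: (@near_eq_is_derive _ _ _ (fun s : R => P.[s^-1] * expR (- s^-1))); first exact: E.
  have dV : is_derive t (1 : R) (fun s : R => s^-1) (- (t ^- 2)).
    have := @is_deriveV _ (fun s : R => s) t 1 1.
    by rewrite /GRing.scale /= mulr1; apply; rewrite gt_eqF.
  have dP : is_derive t (1 : R) (fun s => P.[s^-1]) (P^`().[t^-1] * (- (t ^- 2))).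
    exact: (@is_derive1_comp _ (horner P) (fun s : R => s^-1)).
  have dN : is_derive t (1 : R) (fun s : R => - s^-1) (- - (t ^- 2)).
    exact: is_deriveN.
  have dE : is_derive t (1 : R) (fun s => expR (- s^-1)) (expR (- t^-1) * (- - (t ^- 2))).
    exact: (@is_derive1_comp _ (@expR R) (fun s : R => - s^-1)).
  apply: is_derive_eq.
  rewrite /flat t0 /GRing.scale /= hornerM hornerXn hornerD hornerN; field.
  by rewrite gt_eqF.
- have E : \forall s \near t, 0 = flat P s.
    near=> s; rewrite /flat ifF//; apply/negbTE; rewrite -leNgt ltW//; near: s; exact: lt_nbhsl.
  rewrite {2}/flat ltNge (ltW t0) /=.
  by apply: (@near_eq_is_derive _ _ _ (fun s : R => 0)); first exact: E.
- rewrite -t0 {2}/flat ltxx.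
  have [C C0 HC] := flat_le_sqr P.
  have L : (fun h : R => h^-1 *: (flat P (h *: (1:R) + 0) - flat P 0)) @ 0^' --> (0 : R).
    apply/cvgr0Pnorm_lt => e e0; near=> h.
    have h0 : h != 0 by near: h; exact: nbhs_dnbhs_neq.
    have hlt : `|h| < e / (C + 1).
      by near: h; apply: dnbhs0_lt; rewrite divr_gt0// ltr_wpDl.
    rewrite addr0 /GRing.scale /= mulr1 {2}/flat ltxx subr0 normrM normfV.
    rewrite ltr_pdivrMl ?normr_gt0//.
    apply: (le_lt_trans (HC h)).
    rewrite -(real_normK (num_real h)) expr2 mulrCA ltr_pM2l ?normr_gt0//.
    have : `|h| * (C + 1) < e by rewrite -ltr_pdivlMr// ltr_wpDl.
    by apply: le_lt_trans; rewrite mulrC ler_wpM2l// lerDl.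
  apply: DeriveDef.
    by apply/cvg_ex; exists 0.
  exact/cvg_lim.
Unshelve. all: by end_near. Qed.

Lemma Ck1_flat (R : realType) n (k a b : R) (P : {poly R}) :
  Ck1 n (fun t => k * flat P (a * t + b)).
Proof.
have D t k' P' : is_derive t (1 : R) (fun t => k' * flat P' (a * t + b))
    (k' * a * flat ('X^2 * (P' - P'^`())) (a * t + b)).
  have dA : is_derive t (1 : R) (fun t : R => a * t + b) a.
    by apply: is_derive_eq; rewrite /GRing.scale /= mulr1 addr0.
  have dF : is_derive t (1 : R) (flat P' \o (fun t => a * t + b))
      (flat ('X^2 * (P' - P'^`())) (a * t + b) * a).
    by apply: is_derive1_comp; exact: flat_derive.
  have := @is_deriveZ _ _ _ (flat P' \o (fun t => a * t + b)) k' _ _ _ dF.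
  by rewrite /GRing.scale /= [_ * a]mulrC mulrA.
have C k' P' : continuous (fun t => k' * flat P' (a * t + b)).
  by move=> t; apply/differentiable_continuous/derivable1_diffP; have [] := D t k' P'.
elim: n k P => [k P|n IH k P]; first by split.
split; first exact: C.
split; first by move=> t; have [] := D t k P.
have -> : (fun t => 'D_1 (fun t => k * flat P (a * t + b)) t) =
   (fun t => k * a * flat ('X^2 * (P - P^`())) (a * t + b)).
  by apply/funext => t; have [] := D t k P.
exact: IH.
Qed.

(** * Cutoff functions *)

Lemma smoothD (R : realType) (f g : plane R -> R) :
  smooth f -> smooth g -> smooth (fun x => f x + g x).
Proof. by move=> sf sg n; apply: CkD. Qed.

Lemma smoothM (R : realType) (f g : plane R -> R) :
  smooth f -> smooth g -> smooth (fun x => f x * g x).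
Proof. by move=> sf sg n; apply: CkM. Qed.

Lemma smooth_cst (R : realType) (c : R) : smooth (fun _ : plane R => c).
Proof. by move=> n; exact: Ck_cst. Qed.

Lemma test_funM (R : realType) (U : set (plane R)) (w chi : plane R -> R) :
  smooth w -> test_fun U chi -> test_fun U (fun x => w x * chi x).
Proof.
move=> sw [schi cchi chiU].
have sub : closure [set x | w x * chi x != 0] `<=` closure [set x | chi x != 0].
  by apply: closure_subset => x /=; rewrite mulf_eq0 negb_or => /andP[].
split; first exact: smoothM.
  apply: subclosed_compact cchi sub; exact: closed_closure.
exact: subset_trans chiU.
Qed.

Lemma test_fun_out (R : realType) (U : set (plane R)) (phi : plane R -> R) x :
  test_fun U phi -> ~ U x -> phi x = 0.
Proof.
move=> [_ _ sU] nU; apply/eqP/negPn/negP => nz; apply: nU; apply: sU.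
exact: subset_closure.
Qed.

Definition psi (R : realType) : R -> R := flat 1.

Lemma psi_ge0 (R : realType) (t : R) : 0 <= psi t.
Proof. by rewrite /psi /flat; case: ifP => // _; rewrite hornerC mul1r expR_ge0. Qed.

Lemma psi_le1 (R : realType) (t : R) : psi t <= 1.
Proof.
rewrite /psi /flat; case: ifP => // t0; rewrite hornerC mul1r.
by rewrite -[leRHS]expR0 ler_expR oppr_le0 invr_ge0 ltW.
Qed.

Lemma psi_gt0 (R : realType) (t : R) : psi t != 0 -> 0 < t.
Proof. by rewrite /psi /flat; case: ifP => //; rewrite eqxx. Qed.

Lemma psi_cvg (R : realType) (s : R) : 0 < s -> psi (n.+1%:R * s) @[n --> \oo] --> (1 : R).
Proof.
move=> s0.
have : expR (- (s^-1 * n.+1%:R^-1)) @[n --> \oo] --> expR (- (s^-1 * 0)).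
  apply: continuous_cvg; first exact: continuous_expR.
  apply: cvgN; apply: cvgMr; exact: cvg_harmonic.
rewrite mulr0 oppr0 expR0; apply: cvg_trans; apply: near_eq_cvg.
near=> n; rewrite /psi /flat ifT.
  by rewrite hornerC mul1r invfM mulrC.
by rewrite mulr_gt0// ltr0n.
Unshelve. all: by end_near. Qed.

Definition bump (R : realType) (q : rat * rat * rat) (n : nat) (x : plane R) : R :=
  (psi (n.+1%:R * (x.1 - (ratr q.1.1 - ratr q.2))) * psi (n.+1%:R * (ratr q.1.1 + ratr q.2 - x.1))) *
  (psi (n.+1%:R * (x.2 - (ratr q.1.2 - ratr q.2))) * psi (n.+1%:R * (ratr q.1.2 + ratr q.2 - x.2))).

Lemma smooth_bump (R : realType) q n : smooth (@bump R q n).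
Proof.
move=> m; rewrite /bump.
have A c : forall m, Ck1 m (fun t : R => psi (n.+1%:R * (t - c))).
  move=> {}m; have := Ck1_flat m 1 n.+1%:R (- (n.+1%:R * c)) (1 : {poly R}).
  by congr (Ck1 m); apply/funext => t; rewrite mul1r mulrBr.
have B c : forall m, Ck1 m (fun t : R => psi (n.+1%:R * (c - t))).
  move=> {}m; have := Ck1_flat m 1 (- n.+1%:R) (n.+1%:R * c) (1 : {poly R}).
  by congr (Ck1 m); apply/funext => t; rewrite mul1r mulrBr mulNr addrC.
by apply: CkM; apply: CkM; [exact: Ck_fst (A _ _)|exact: Ck_fst (B _ _)|
  exact: Ck_snd (A _ _)|exact: Ck_snd (B _ _)].
Qed.

Lemma bump01 (R : realType) q n x : 0 <= @bump R q n x <= 1.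
Proof.
rewrite /bump !mulr_ge0 ?psi_ge0//=.
by rewrite !mulr_ile1 ?mulr_ge0 ?psi_ge0 ?psi_le1.
Qed.

Lemma bump_cbox (R : realType) q n x : @bump R q n x != 0 -> cbox q x.
Proof.
rewrite /bump !mulf_eq0 !negb_or => /andP[/andP[a b] /andP[c d]].
move: a b c d => /psi_gt0 a /psi_gt0 b /psi_gt0 c /psi_gt0 d.
have n0 : 0 < n.+1%:R :> R by rewrite ltr0n.
move: a b c d; rewrite !pmulr_rgt0// => a b c d.
by split; rewrite ler_norml; lra.
Qed.

Lemma bump_cvg (R : realType) q x : qbox q x -> @bump R q n x @[n --> \oo] --> (1 : R).
Proof.
move=> [/= /[!ltr_norml] a b].
suff : bump q n x @[n --> \oo] --> (1 * 1 * (1 * 1) : R) by rewrite !mul1r.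
by apply: cvgM; apply: cvgM; apply: psi_cvg; lra.
Qed.

Lemma closed_cbox (R : realType) q : closed (@cbox R q).
Proof.
have cont (i : bool) c : continuous (fun x : plane R => `|(if i then x.1 else x.2) - c|).
  move=> x; apply: cvg_norm; apply: cvgB; last exact: cvg_cst.
  by case: i; [exact: cvg_fst|exact: cvg_snd].
have -> : @cbox R q = [set x | `|x.1 - ratr q.1.1| <= ratr q.2] `&` [set x | `|x.2 - ratr q.1.2| <= ratr q.2].
  by [].
apply: closedI.
  exact: ((continuous_closedP _).1 (cont true _) _ (@closed_le R (ratr q.2))).
exact: ((continuous_closedP _).1 (cont false _) _ (@closed_le R (ratr q.2))).
Qed.

Lemma compact_cbox (R : realType) q : compact (@cbox R q).
Proof.
have : @cbox R q `<=` box (`|ratr q.1.1| + `|ratr q.1.2| + ratr q.2); last first.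
  exact: subclosed_compact (@closed_cbox R q) (@compact_box R _).
move=> x [a b]; split.
  have := ler_normD (x.1 - ratr q.1.1) (ratr q.1.1); rewrite subrK => h.
  have := normr_ge0 (ratr q.1.2 : R); lra.
have := ler_normD (x.2 - ratr q.1.2) (ratr q.1.2); rewrite subrK => h.
have := normr_ge0 (ratr q.1.1 : R); lra.
Qed.

(** The boxes are enumerated by the countability of their rational data; an
    index whose box is not contained in U contributes the zero function. *)
Definition ibump (R : realType) (U : set (plane R)) (n i : nat) (x : plane R) : R :=
  if (unpickle i : option (rat * rat * rat)) is Some q then
    if `[< @cbox R q `<=` U >] then bump q n x else 0
  else 0.

(** A smooth substitute for the maximum of the first n bump functions: it lies
    between each of them and 1. *)
Definition cutoff (R : realType) (U : set (plane R)) (n : nat) (x : plane R) : R :=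
  1 - \prod_(i <- iota 0 n) (1 - ibump U n i x).

Lemma ibump01 (R : realType) (U : set (plane R)) n i x : 0 <= ibump U n i x <= 1.
Proof.
by rewrite /ibump; case: unpickle => [q|]; [case: ifP => _|]; rewrite ?bump01 ?lexx ?ler01.
Qed.

Lemma smooth_ibump (R : realType) (U : set (plane R)) n i : smooth (ibump U n i).
Proof.
rewrite /ibump; case: unpickle => [q|]; [case: asbool|]; try exact: smooth_cst.
exact: smooth_bump.
Qed.

Lemma prod_unit_itv (R : realType) (r : seq nat) (P : pred nat) (f : nat -> R) :
  (forall i, 0 <= f i <= 1) -> 0 <= \prod_(i <- r | P i) f i <= 1.
Proof.
move=> f01; elim/big_ind : _ => [|a b /andP[a0 a1] /andP[b0 b1]|//].
  by rewrite ler01 lexx.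
by rewrite mulr_ge0// mulr_ile1.
Qed.

Lemma cutoff01 (R : realType) (U : set (plane R)) n x : 0 <= cutoff U n x <= 1.
Proof.
have h : 0 <= \prod_(i <- iota 0 n) (1 - ibump U n i x) <= 1.
  by apply: prod_unit_itv => i; have := ibump01 U n i x; lra.
by rewrite /cutoff; lra.
Qed.

Definition ibox (R : realType) (U : set (plane R)) (i : nat) : set (plane R) :=
  if (unpickle i : option (rat * rat * rat)) is Some q then
    if `[< @cbox R q `<=` U >] then @cbox R q else set0
  else set0.

Lemma compact_ibox (R : realType) (U : set (plane R)) i : compact (ibox U i).
Proof.
rewrite /ibox; case: unpickle => [q|]; [case: asbool|]; try exact: compact0.
exact: compact_cbox.
Qed.

Lemma closed_ibox (R : realType) (U : set (plane R)) i : closed (ibox U i).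
Proof.
rewrite /ibox; case: unpickle => [q|]; [case: asbool|]; try exact: closed0.
exact: closed_cbox.
Qed.

Lemma cutoff_support (R : realType) (U : set (plane R)) n :
  closure [set x | cutoff U n x != 0] `<=` \bigcup_(i in `I_n) ibox U i.
Proof.
rewrite [X in _ `<=` X](closure_id _).1; last first.
  by apply: closed_bigcup => // i _; exact: closed_ibox.
apply: closure_subset => x /=; rewrite /cutoff => nz.
apply: contrapT => nK; move/eqP: nz; apply.
rewrite big1_seq ?subrr// => i /=; rewrite mem_iota add0n => /= iln.
rewrite /ibump; case E : unpickle => [q|]; rewrite ?subr0//.
case: ifPn => qU; rewrite ?subr0//.
have [->|nz] := eqVneq (bump q n x) 0; rewrite ?subr0//.
by exfalso; apply: nK; exists i => //; rewrite /ibox E qU; exact: bump_cbox nz.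
Qed.

Lemma cutoff_test_fun (R : realType) (U : set (plane R)) n : test_fun U (cutoff U n).
Proof.
split.
- move=> m; rewrite /cutoff; apply: CkD; first exact: Ck_cst.
  have -> : (fun x => - \prod_(i <- iota 0 n) (1 - ibump U n i x)) =
     (fun x => (-1) * \prod_(i <- iota 0 n) (1 + (-1) * ibump U n i x)).
    by apply/funext => x; rewrite mulN1r; congr (- _); apply: eq_bigr => i _; rewrite mulN1r.
  apply: CkM; first exact: Ck_cst.
  apply: (@Ck_prod _ _ _ _ (fun i x => 1 + (-1) * ibump U n i x)) => i.
  apply: CkD; first exact: Ck_cst.
  by apply: CkM; [exact: Ck_cst|exact: smooth_ibump].
- apply: subclosed_compact (@cutoff_support R U n); first exact: closed_closure.
  by rewrite bigcup_mkord; apply: bigsetU_compact => i _; exact: compact_ibox.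
- apply: (subset_trans (@cutoff_support R U n)) => x [i _]; rewrite /ibox.
  by case: unpickle => [q|//]; case: ifPn => // /asboolP qU /qU.
Qed.

(** Around x there is a box of the list inside U; from its index on, the cutoff
    dominates its bump function, which tends to 1 inside the box. *)
Lemma cutoff_cvg (R : realType) (U : set (plane R)) x :
  open U -> U x -> cutoff U n x @[n --> \oo] --> (1 : R).
Proof.
move=> oU Ux; have [q [qx qU]] := open_qbox oU Ux.
pose i0 := pickle q.
apply: (@squeeze_cvgr _ _ _ _ (bump q ^~ x) (fun=> 1)); last 2 first.
- exact: bump_cvg.
- exact: cvg_cst.
near=> n; have /andP[_ ->] := cutoff01 U n x; rewrite andbT.
rewrite /cutoff lerBrDl -lerBrDr.
have iln : (i0 < n)%N by near: n; exact: nbhs_infty_gt.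
rewrite (bigD1_seq i0) ?iota_uniq//=; last by rewrite mem_iota add0n.
rewrite {1}/ibump pickleK; have -> : `[< @cbox R q `<=` U >] = true by apply/asboolP.
apply: ler_piMr; first by have := bump01 q n x; lra.
have : 0 <= \prod_(i <- iota 0 n | i != i0) (1 - ibump U n i x) <= 1.
  by apply: prod_unit_itv => i; have := ibump01 U n i x; lra.
by case/andP.
Unshelve. all: by end_near. Qed.

(** * Integrals along segments *)

Section segment_integrals.
Context (R : realType).
Local Notation leb := (@lebesgue_measure R).
Implicit Types (f : plane R -> R) (a b c x : plane R).

Definition pt a b (t : R) : plane R := ((1 - t) * a.1 + t * b.1, (1 - t) * a.2 + t * b.2).

Lemma continuous_pt a b : continuous (pt a b).
Proof.
move=> t; apply: (@cvg_pair _ _ _ _ (nbhs ((1 - t) * a.1 + t * b.1)) (nbhs ((1 - t) * a.2 + t * b.2))).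
  apply: cvgD; apply: cvgM; try exact: cvg_cst; try exact: cvg_id.
  by apply: cvgB; [exact: cvg_cst|exact: cvg_id].
apply: cvgD; apply: cvgM; try exact: cvg_cst; try exact: cvg_id.
by apply: cvgB; [exact: cvg_cst|exact: cvg_id].
Qed.

(** The integral along a segment in its unit parametrisation, that is, the
    length average and not the integral with respect to arc length. *)
Definition seg_int f a b : R := \int[leb]_(t in `[0, 1]) f (pt a b t).

Lemma continuous_fpt f a b : continuous f -> continuous (fun t => f (pt a b t)).
Proof. by move=> cf t; apply: continuous_comp; [exact: continuous_pt|exact: cf]. Qed.

Lemma seg_int_sym f a b : continuous f -> seg_int f b a = seg_int f a b.
Proof.
move=> cf; rewrite /seg_int.
have cG : {within `[0, 1], continuous (fun t : R => f (pt b a t))}.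
  by apply: continuous_subspaceT; exact: continuous_fpt.
rewrite (Rintegration_by_substitution_onem _ cG); last by rewrite ler01 lexx.
rewrite onem1; apply: eq_Rintegral => t _; congr f.
by rewrite /pt /onem; congr pair; ring.
Qed.

Lemma continuous_integrable01 (h : R -> R) (a b : R) : continuous h ->
  leb.-integrable `[a, b] (EFin \o h).
Proof.
move=> ch; apply: continuous_compact_integrable; first exact: segment_compact.
exact: continuous_subspaceT.
Qed.

Lemma integral_itv_oo_cc (h : R -> R) (a b : R) : continuous h ->
  (\int[leb]_(x in `]a, b[) (h x)%:E = \int[leb]_(x in `[a, b]) (h x)%:E)%E.
Proof.
move=> ch; symmetry; apply: integral_itv_bndoo.
apply/measurable_EFinP; apply: measurable_funS (continuous_measurable_fun ch) => //.
Qed.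

Lemma affine_subst (h : R -> R) (p q : R) : p < q -> continuous h ->
  (\int[leb]_(y in `]p, q[) (h y)%:E =
   ((q - p) * \int[leb]_(t in `[0, 1]) h ((1 - t) * p + t * q))%R%:E)%E.
Proof.
move=> pq ch; rewrite integral_itv_oo_cc//.
pose F (t : R) : R := (1 - t) * p + t * q.
have dF (t : R) : is_derive t (1 : R) F (q - p).
  have -> : F = (fun t => t * (q - p) + p) by apply/funext => s; rewrite /F; ring.
  by apply: is_derive_eq; rewrite /GRing.scale /=; ring.
have F'E : (F^`())%classic = (fun=> q - p).
  by apply/funext => t; rewrite derive1E; case: (dF t).
have cF : continuous F.
  by move=> t; apply/differentiable_continuous/derivable1_diffP; case: (dF t).
have := @integration_by_substitution_increasing R F h 0 1 ler01.
rewrite F'E (_ : F 0 = p); last by rewrite /F; ring.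
rewrite (_ : F 1 = q); last by rewrite /F; ring.
move=> ->.
- rewrite /Rintegral EFinM fineK; last first.
    apply: integrable_fin_num => //.
    apply: continuous_integrable01 => t; apply: continuous_comp (cF t) (ch _).
  rewrite -integralZl//; last first.
    apply: continuous_integrable01 => t; apply: continuous_comp (cF t) (ch _).
  by apply: eq_integral => t _; rewrite -EFinM mulrC.
- move=> s t _ _ st; rewrite /F -subr_gt0.
  have -> : (1 - t) * p + t * q - ((1 - s) * p + s * q) = (t - s) * (q - p) by ring.
  by rewrite mulr_gt0// subr_gt0.
- by move=> t _; exact: cvg_cst.
- exact: is_cvg_cst.
- exact: is_cvg_cst.
- split; first by move=> t _; case: (dF t).
  + by apply: cvg_at_right_filter; exact: cF.
  + by apply: cvg_at_left_filter; exact: cF.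
- exact: continuous_subspaceT.
Qed.

(** The abscissa at height y of the line through a and b. *)
Definition xat a b (y : R) : R := a.1 + (y - a.2) / (b.2 - a.2) * (b.1 - a.1).

Lemma continuous_xat a b : continuous (xat a b).
Proof.
move=> y; apply: cvgD; first exact: cvg_cst.
apply: cvgM; last exact: cvg_cst.
apply: cvgM; last exact: cvg_cst.
by apply: cvgB; [exact: cvg_id|exact: cvg_cst].
Qed.

Lemma continuous_fxat f a b : continuous f -> continuous (fun y => f (xat a b y, y)).
Proof.
move=> cf y; apply: (@continuous_comp _ _ _ (fun y => (xat a b y, y)) f); last exact: cf.
apply: (@cvg_pair _ _ _ _ (nbhs (xat a b y)) (nbhs y)); [exact: continuous_xat|exact: cvg_id].
Qed.

Lemma seg_int_line f a b : continuous f -> a.2 < b.2 ->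
  (\int[leb]_(y in `]a.2, b.2[) (f (xat a b y, y))%:E = ((b.2 - a.2) * seg_int f a b)%:E)%E.
Proof.
move=> cf ab; rewrite (@affine_subst (fun y => f (xat a b y, y)))//; last exact: continuous_fxat.
congr (_ * _)%:E; apply: eq_Rintegral => t _; congr f.
rewrite /pt /xat; congr pair; field.
by rewrite subr_eq0 gt_eqF.
Qed.

Lemma FTC_oo (h h' : R -> R) (l r : R) : l < r ->
  (forall t, is_derive t (1 : R) h (h' t)) -> continuous h' ->
  (\int[leb]_(x in `]l, r[) (h' x)%:E = (h r - h l)%:E)%E.
Proof.
move=> lr dh ch'; rewrite integral_itv_oo_cc//.
have ch : continuous h.
  by move=> t; apply/differentiable_continuous/derivable1_diffP; case: (dh t).
rewrite (@continuous_FTC2 _ _ h)//.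
- exact: continuous_subspaceT.
- split; first by move=> t _; case: (dh t).
  + by apply: cvg_at_right_filter; exact: ch.
  + by apply: cvg_at_left_filter; exact: ch.
- by move=> t _; rewrite derive1E; case: (dh t).
Qed.

(** The open interval between l and r, whichever of them is smaller, when D has
    the sign of r - l.  It lets one formula cover both orientations of a
    triangle. *)
Definition signed_itv (D l r : R) : set R := [set x | 0 < D * (x - l) /\ 0 < D * (r - x)].

Lemma FTC_signed (h h' : R -> R) (l r D : R) : 0 < D * (r - l) ->
  (forall t, is_derive t (1 : R) h (h' t)) -> continuous h' ->
  (\int[leb]_(x in signed_itv D l r) (h' x)%:E =
   (Num.sg D * (h r - h l))%:E)%E.
Proof.
move=> Drl dh ch'.
have [D0|D0|D0] := ltgtP D 0; last by rewrite D0 mul0r ltxx in Drl.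
- have -> : signed_itv D l r = `]r, l[%classic.
    apply/seteqP; split => x; rewrite /signed_itv /= in_itv /= !nmulr_rgt0// !subr_lt0.
      by move=> [-> ->].
    by move=> /andP[].
  rewrite (FTC_oo _ dh ch'); first by congr EFin; rewrite ltr0_sg//; ring.
  by move: Drl; rewrite nmulr_rgt0// subr_lt0.
- have -> : signed_itv D l r = `]l, r[%classic.
    apply/seteqP; split => x; rewrite /signed_itv /= in_itv /= !pmulr_rgt0// !subr_gt0.
      by move=> [-> ->].
    by move=> /andP[].
  rewrite (FTC_oo _ dh ch'); first by congr EFin; rewrite gtr0_sg// mul1r.
  by move: Drl; rewrite pmulr_rgt0// subr_gt0.
Qed.

End segment_integrals.

(** * Integrals of partial derivatives over a triangle *)

Section triangle.
Context (R : realType).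
Local Notation leb := (@lebesgue_measure R).
Implicit Types (f : plane R -> R) (a b c x : plane R).

(** Twice the signed area of the triangle. *)
Definition orient a b c : R := cross (b - a) (c - a).

(** The open triangle, by the signs of its barycentric coordinates. *)
Definition tri a b c : set (plane R) :=
  [set x | [/\ 0 < orient a b c * cross (c - b) (x - b),
               0 < orient a b c * cross (a - c) (x - c) &
               0 < orient a b c * cross (b - a) (x - a)]].

Definition C1x f := [/\ continuous f, (forall x, derivable f x ((1, 0) : plane R)) & continuous (d1 f)].
Definition C1y f := [/\ continuous f, (forall x, derivable f x ((0, 1) : plane R)) & continuous (d2 f)].

Lemma orient_cyc a b c : orient b c a = orient a b c.
Proof. by rewrite /orient /cross /=; ring. Qed.

Lemma orient_swap a b c : orient b a c = - orient a b c.
Proof. by rewrite /orient /cross /=; ring. Qed.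

Lemma tri_cyc a b c : tri b c a = tri a b c.
Proof. by rewrite /tri orient_cyc; apply/seteqP; split => x []. Qed.

Lemma cross_edge_swap a b x : cross (a - b) (x - b) = - cross (b - a) (x - a).
Proof. by rewrite /cross /=; ring. Qed.

Lemma tri_swap a b c : tri b a c = tri a b c.
Proof.
rewrite /tri orient_swap; apply/seteqP; split => x /=.
  by rewrite (cross_edge_swap a b) (cross_edge_swap b c) (cross_edge_swap c a) !mulrNN => -[].
by rewrite (cross_edge_swap a b) (cross_edge_swap b c) (cross_edge_swap c a) !mulrNN => -[].
Qed.

Lemma continuous_cross a b : continuous (fun x : plane R => cross a (x - b)).
Proof.
move=> x; rewrite /cross; apply: cvgB; (apply: cvgM; first exact: cvg_cst).
  by apply: cvgB; [exact: cvg_snd|exact: cvg_cst].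
by apply: cvgB; [exact: cvg_fst|exact: cvg_cst].
Qed.

Lemma open_half (k : R) a b : open [set x : plane R | 0 < k * cross a (x - b)].
Proof.
have ck : continuous (fun x : plane R => k * cross a (x - b)).
  by move=> x; apply: cvgM; [exact: cvg_cst|exact: continuous_cross].
exact: ((continuousP _).1 ck _ (@open_gt R 0)).
Qed.

Lemma open_tri a b c : open (tri a b c).
Proof.
have -> : tri a b c = [set x : plane R | 0 < orient a b c * cross (c - b) (x - b)] `&`
  ([set x : plane R | 0 < orient a b c * cross (a - c) (x - c)] `&`
   [set x : plane R | 0 < orient a b c * cross (b - a) (x - a)]).
  by apply/seteqP; split => x /= => [[]|[? []]].
by apply: openI; [|apply: openI]; exact: open_half.
Qed.

Lemma tri_box a b c : orient a b c != 0 -> exists M, tri a b c `<=` box M.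
Proof.
move=> D0; exists (`|a.1| + `|b.1| + `|c.1| + `|a.2| + `|b.2| + `|c.2|).
move=> x; rewrite /tri /=.
set D := orient a b c; set A := cross (c - b) _; set B := cross (a - c) _; set C := cross (b - a) _.
move=> [A0 B0 C0].
have D2 : 0 < D * D by rewrite -expr2 exprn_even_gt0.
have E : D = A + B + C by rewrite /D /A /B /C /orient /cross /=; ring.
have E1 : D * x.1 = A * a.1 + B * b.1 + C * c.1 by rewrite /D /A /B /C /orient /cross /=; ring.
have E2 : D * x.2 = A * a.2 + B * b.2 + C * c.2 by rewrite /D /A /B /C /orient /cross /=; ring.
have bd (p q r s : R) : D * s = A * p + B * q + C * r -> `|s| <= `|p| + `|q| + `|r|.
  move=> Es; rewrite -(ler_pM2l D2).
  have -> : D * D * `|s| = `|(D * A) * p + (D * B) * q + (D * C) * r|.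
    rewrite -[X in X * `|s|](gtr0_norm D2) -normrM; congr `|_|.
    by rewrite -!mulrA -!mulrDr -Es.
  have -> : D * D = D * A + D * B + D * C by rewrite {2}E; ring.
  apply: (le_trans (ler_normD _ _)); apply: (le_trans (lerD (ler_normD _ _) (lexx _))).
  rewrite !normrM [`|D| * `|A|]( _ : _ = D * A); last by rewrite -normrM gtr0_norm.
  rewrite [`|D| * `|B|]( _ : _ = D * B); last by rewrite -normrM gtr0_norm.
  rewrite [`|D| * `|C|]( _ : _ = D * C); last by rewrite -normrM gtr0_norm.
  have := normr_ge0 p; have := normr_ge0 q; have := normr_ge0 r.
  move: A0 B0 C0; move: (D * A) (D * B) (D * C) `|p| `|q| `|r| => {A B C E E1 E2 Es} A B C P Q S; nra.
have h1 := bd _ _ _ _ E1; have h2 := bd _ _ _ _ E2.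
have := normr_ge0 a.1; have := normr_ge0 b.1; have := normr_ge0 c.1.
have := normr_ge0 a.2; have := normr_ge0 b.2; have := normr_ge0 c.2.
by split; lra.
Qed.

Lemma integrable_sub_box (f : plane R -> R) (A : set (plane R)) M :
  measurable (A : set (mplane R)) -> A `<=` box M -> continuous f ->
  (leb2 R).-integrable A (EFin \o f : mplane R -> \bar R).
Proof.
move=> measurable_coef AM cf; apply: measurable_bounded_integrable => //.
- apply: (le_lt_trans _ (leb2_box_fin M)).
  by apply: le_measure => //; rewrite inE//; exact: measurable_box.
- exact: measurable_funS (plane_continuous_measurable cf).
- have [C C0 HC] := continuous_bounded_box M cf.
  exists C; split; first exact: num_real.
  by move=> K CK x Ax; apply: (le_trans (HC _ (AM _ Ax))); exact: ltW.
Qed.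

Lemma measurable_tri a b c : measurable (tri a b c : set (mplane R)).
Proof. by apply: plane_open_measurable; exact: open_tri. Qed.

Lemma integrable_tri f a b c : orient a b c != 0 -> continuous f ->
  (leb2 R).-integrable (tri a b c) (EFin \o f : mplane R -> \bar R).
Proof.
move=> D0 cf; have [M HM] := tri_box D0.
by apply: integrable_sub_box HM cf; exact: measurable_tri.
Qed.

Lemma cross_xat a b x : a.2 != b.2 ->
  cross (b - a) (x - a) = (b.2 - a.2) * (xat a b x.2 - x.1).
Proof.
by move=> ab; rewrite /cross /xat /=; field; rewrite subr_eq0 eq_sym.
Qed.

Lemma cross_xatN a b x : a.2 != b.2 ->
  cross (a - b) (x - b) = (b.2 - a.2) * (x.1 - xat a b x.2).
Proof. by move=> ab; rewrite cross_edge_swap cross_xat//; ring. Qed.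

Lemma cross_sum2 a b c x :
  cross (c - b) (x - b) * (a.2 - b.2) + cross (b - a) (x - a) * (c.2 - b.2) =
  orient a b c * (x.2 - b.2).
Proof. by rewrite /orient /cross /=; ring. Qed.

(** For vertices sorted by height, the horizontal slice at height y lies between
    the long side a c and one of the two other sides; which one depends on the
    position of y relative to the middle vertex. *)
Lemma slice_low a b c y : a.2 < y < b.2 -> b.2 <= c.2 ->
  [set t | tri a b c (t, y)] = signed_itv (orient a b c) (xat a c y) (xat a b y).
Proof.
move=> /andP[ay yb] bc; have ab := lt_trans ay yb; have ac := lt_le_trans ab bc.
have ab' : 0 < b.2 - a.2 by rewrite subr_gt0.
have ac' : 0 < c.2 - a.2 by rewrite subr_gt0.
have Eb t := @cross_xatN a c (t, y) (negbT (lt_eqF ac)).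
have Ec t := @cross_xat a b (t, y) (negbT (lt_eqF ab)).
apply/seteqP; split => t; rewrite /tri /signed_itv /= Eb Ec /= ![orient a b c * (_ * _)]mulrCA.
  by move=> [_ + +]; rewrite (pmulr_rgt0 _ ac') (pmulr_rgt0 _ ab'); split.
move=> [Tb Tc]; split; last 2 first.
- by rewrite pmulr_rgt0.
- by rewrite pmulr_rgt0.
have D0 : orient a b c != 0 by apply/eqP => D0; move: Tb; rewrite D0 mul0r ltxx.
have D2 : 0 < orient a b c * orient a b c by rewrite -expr2 exprn_even_gt0.
rewrite -(@pmulr_lgt0 _ (b.2 - a.2))//.
have := cross_sum2 a b c (t, y); rewrite Ec /= => E.
set A := cross _ _ in E *.
have -> : orient a b c * A * (b.2 - a.2) =
   (b.2 - a.2) * (c.2 - b.2) * (orient a b c * (xat a b y - t)) +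
   orient a b c * orient a b c * (b.2 - y).
  have -> : orient a b c * A * (b.2 - a.2) = - orient a b c * (A * (a.2 - b.2)) by ring.
  have -> : A * (a.2 - b.2) = orient a b c * (y - b.2) - (b.2 - a.2) * (xat a b y - t) * (c.2 - b.2).
    by rewrite -E addrK.
  by ring.
rewrite ltr_wpDl//; last by rewrite mulr_gt0// subr_gt0.
by apply: mulr_ge0; [apply: mulr_ge0; [exact: ltW|rewrite subr_ge0]|exact: ltW].
Qed.

Lemma slice_high a b c y : a.2 <= b.2 -> b.2 < y < c.2 ->
  [set t | tri a b c (t, y)] = signed_itv (orient a b c) (xat a c y) (xat b c y).
Proof.
move=> ab /andP[by' yc]; have bc := lt_trans by' yc; have ac := le_lt_trans ab bc.
have bc' : 0 < c.2 - b.2 by rewrite subr_gt0.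
have ac' : 0 < c.2 - a.2 by rewrite subr_gt0.
have Eb t := @cross_xatN a c (t, y) (negbT (lt_eqF ac)).
have Ea t := @cross_xat b c (t, y) (negbT (lt_eqF bc)).
apply/seteqP; split => t; rewrite /tri /signed_itv /= Eb Ea /= ![orient a b c * (_ * _)]mulrCA.
  by move=> [+ + _]; rewrite (pmulr_rgt0 _ ac') (pmulr_rgt0 _ bc'); split.
move=> [Tb Ta]; split.
- by rewrite pmulr_rgt0.
- by rewrite pmulr_rgt0.
have D0 : orient a b c != 0 by apply/eqP => D0; move: Tb; rewrite D0 mul0r ltxx.
have D2 : 0 < orient a b c * orient a b c by rewrite -expr2 exprn_even_gt0.
rewrite -(@pmulr_lgt0 _ (c.2 - b.2))//.
have := cross_sum2 a b c (t, y); rewrite Ea /= => E.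
set C := cross _ _ in E *.
have -> : orient a b c * C * (c.2 - b.2) =
   (c.2 - b.2) * (b.2 - a.2) * (orient a b c * (xat b c y - t)) +
   orient a b c * orient a b c * (y - b.2).
  have -> : orient a b c * C * (c.2 - b.2) = orient a b c * (C * (c.2 - b.2)) by ring.
  have -> : C * (c.2 - b.2) = orient a b c * (y - b.2) - (c.2 - b.2) * (xat b c y - t) * (a.2 - b.2).
    by rewrite -E addrAC subrr add0r.
  by ring.
rewrite ltr_wpDl//; last by rewrite mulr_gt0// subr_gt0.
by apply: mulr_ge0; [apply: mulr_ge0; [exact: ltW|rewrite subr_ge0]|exact: ltW].
Qed.

Lemma slice_out a b c y : a.2 <= b.2 -> b.2 <= c.2 -> ~~ (a.2 < y < c.2) ->
  [set t | tri a b c (t, y)] = set0.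
Proof.
move=> ab bc; apply: contraNeq => /set0P[t]; rewrite /tri /=.
set D := orient a b c; set A := cross (c - b) _; set B := cross (a - c) _; set C := cross (b - a) _.
move=> [A0 B0 C0].
have D0 : D != 0 by apply/eqP => D0; move: A0; rewrite D0 mul0r ltxx.
have D2 : 0 < D * D by rewrite -expr2 exprn_even_gt0.
have E : D = A + B + C by rewrite /D /A /B /C /orient /cross /=; ring.
have E2 : D * y = A * a.2 + B * b.2 + C * c.2 by rewrite /D /A /B /C /orient /cross /=; ring.
have ac : a.2 < c.2.
  rewrite lt_neqAle (le_trans ab bc) andbT; apply/eqP => ac.
  have ab' : a.2 = b.2 by apply/eqP; rewrite eq_le ab ac bc.
  by move/eqP: D0; apply; rewrite /D /orient /cross /= -ab' -ac; ring.
have ya : 0 < D * D * (y - a.2).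
  have -> : D * D * (y - a.2) = D * B * (b.2 - a.2) + D * C * (c.2 - a.2).
    have -> : D * D * (y - a.2) = D * (D * y) - D * a.2 * D by ring.
    by rewrite E2 {3}E; ring.
  apply: ltr_wpDl; first by apply: mulr_ge0; [exact: ltW|rewrite subr_ge0].
  by apply: mulr_gt0; [by []|rewrite subr_gt0].
have yc : 0 < D * D * (c.2 - y).
  have -> : D * D * (c.2 - y) = D * B * (c.2 - b.2) + D * A * (c.2 - a.2).
    have -> : D * D * (c.2 - y) = D * c.2 * D - D * (D * y) by ring.
    by rewrite E2 {2}E; ring.
  apply: ltr_wpDl; first by apply: mulr_ge0; [exact: ltW|rewrite subr_ge0].
  by apply: mulr_gt0; [by []|rewrite subr_gt0].
have ya' : a.2 < y by rewrite -subr_gt0 -(pmulr_rgt0 _ D2).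
by rewrite ya' /= -subr_gt0 -(pmulr_rgt0 _ D2).
Qed.

Lemma xat_low a b c y : a.2 < y < b.2 -> b.2 <= c.2 -> orient a b c != 0 ->
  0 < orient a b c * (xat a b y - xat a c y).
Proof.
move=> /andP[ay yb] bc D0; have ab := lt_trans ay yb; have ac := lt_le_trans ab bc.
have -> : xat a b y - xat a c y = (y - a.2) * orient a b c / ((b.2 - a.2) * (c.2 - a.2)).
  by rewrite /xat /orient /cross /=; field; rewrite !subr_eq0 !gt_eqF.
have -> : orient a b c * ((y - a.2) * orient a b c / ((b.2 - a.2) * (c.2 - a.2))) =
  orient a b c ^+ 2 * (y - a.2) / ((b.2 - a.2) * (c.2 - a.2)) by ring.
by apply: divr_gt0; apply: mulr_gt0; rewrite ?(subr_gt0 a.2) ?(subr_gt0 b.2) ?(subr_gt0 y) // exprn_even_gt0.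
Qed.

Lemma xat_high a b c y : a.2 <= b.2 -> b.2 < y < c.2 -> orient a b c != 0 ->
  0 < orient a b c * (xat b c y - xat a c y).
Proof.
move=> ab /andP[by' yc] D0; have bc := lt_trans by' yc; have ac := le_lt_trans ab bc.
have -> : xat b c y - xat a c y = (c.2 - y) * orient a b c / ((c.2 - b.2) * (c.2 - a.2)).
  by rewrite /xat /orient /cross /=; field; rewrite !subr_eq0 !gt_eqF.
have -> : orient a b c * ((c.2 - y) * orient a b c / ((c.2 - b.2) * (c.2 - a.2))) =
  orient a b c ^+ 2 * (c.2 - y) / ((c.2 - b.2) * (c.2 - a.2)) by ring.
by apply: divr_gt0; apply: mulr_gt0; rewrite ?(subr_gt0 a.2) ?(subr_gt0 b.2) ?(subr_gt0 y) // exprn_even_gt0.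
Qed.

Definition Rint_oo (h : R -> R) p q : R := \int[leb]_(y in `]p, q[) h y.

Lemma integrable_oo (h : R -> R) p q : continuous h -> leb.-integrable `]p, q[ (EFin \o h).
Proof.
move=> ch; apply: integrableS (continuous_integrable01 p q ch) => //.
exact: subset_itv_oo_cc.
Qed.

Lemma Rint_oo_cc (h : R -> R) p q : continuous h -> Rint_oo h p q = \int[leb]_(y in `[p, q]) h y.
Proof. by move=> ch; rewrite /Rint_oo /Rintegral (integral_itv_oo_cc _ _ ch). Qed.

Lemma Rint_oo_split (h : R -> R) p q r : continuous h -> p <= q -> q <= r ->
  Rint_oo h p r = Rint_oo h p q + Rint_oo h q r.
Proof.
move=> ch pq qr; rewrite !Rint_oo_cc//.
rewrite -[X in _ = _ + X]Rintegral_itv_obnd_cbnd; last first.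
  apply: integrableS (continuous_integrable01 q r ch) => //.
  exact: subset_itv_oc_cc.
rewrite -(@Rintegral_itvB _ _ (BLeft p)); first by rewrite addrC subrK.
- exact: continuous_integrable01.
- by rewrite bnd_simp.
- by rewrite bnd_simp.
Qed.

Lemma Rint_oo_lin (h1 h2 : R -> R) k p q : continuous h1 -> continuous h2 ->
  Rint_oo (fun y => k * (h1 y - h2 y)) p q = k * (Rint_oo h1 p q - Rint_oo h2 p q).
Proof.
move=> c1 c2; rewrite /Rint_oo RintegralZl//.
  by rewrite RintegralB//; exact: integrable_oo.
by apply: integrable_oo => y; apply: cvgB; [exact: c1|exact: c2].
Qed.

Lemma Rint_oo_line f a b : continuous f -> a.2 <= b.2 ->
  Rint_oo (fun y => f (xat a b y, y)) a.2 b.2 = (b.2 - a.2) * seg_int f a b.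
Proof.
move=> cf; rewrite le_eqVlt => /predU1P[E|ab].
  by rewrite /Rint_oo E set_itv_ge ?bnd_simp// Rintegral_set0 subrr mul0r.
by rewrite /Rint_oo /Rintegral seg_int_line.
Qed.

Lemma is_derive_slice f y t : C1x f -> is_derive t (1 : R) (fun t => f (t, y)) (d1 f (t, y)).
Proof.
move=> [_ df _].
have E : (fun h : R => h^-1 *: (f ((h *: ((1, 0) : plane R) + (t, y))) - f (t, y))) =
         (fun h : R => h^-1 *: (f (h *: (1 : R) + t, y) - f (t, y))).
  apply/funext => h; congr (_ *: (f _ - _)).
  have -> : h *: ((1, 0) : plane R) + (t, y) = (h *: (1 : R) + t, h *: (0 : R) + y) by [].
  by rewrite scaler0 add0r.
have := df (t, y); rewrite /derivable /d1 /derive E => h.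
by apply: DeriveDef.
Qed.

Lemma continuous_slice f y : continuous f -> continuous (fun t => f (t, y)).
Proof.
move=> cf t; apply: (@continuous_comp _ _ _ (fun t => (t, y)) f); last exact: cf.
by apply: (@cvg_pair _ _ _ _ (nbhs t) (nbhs y)); [exact: cvg_id|exact: cvg_cst].
Qed.

(** The integral of f dy over the boundary of the triangle traversed from a to
    b to c. *)
Definition tri_edges f a b c := 
  (b.2 - a.2) * seg_int f a b + (c.2 - b.2) * seg_int f b c + (a.2 - c.2) * seg_int f c a.

(** Integrating d1 f along the horizontal slices leaves the difference of f at
    the two ends of each slice, and integrating over the heights gives the three
    sides.  The side a c is met in both halves and is put together by
    [Rint_oo_split]. *)
Lemma tri_sorted f a b c : a.2 <= b.2 -> b.2 <= c.2 -> orient a b c != 0 -> C1x f ->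
  (\int[leb2 R]_(x in tri a b c) (d1 f x)%:E = (Num.sg (orient a b c) * tri_edges f a b c)%:E)%E.
Proof.
move=> ab bc D0 C1f; have [cf df cdf] := C1f.
have ii := integrable_tri D0 cdf.
have ii' : (leb2 R).-integrable setT ((EFin \o d1 f) \_ (tri a b c) : mplane R -> \bar R).
  by apply/(integrable_mkcond _ (measurable_tri a b c)).
rewrite integral_mkcond (leb2_integral_yx ii').
(* g1 and g2 are the slice integrals below and above the middle vertex b *)
pose s := Num.sg (orient a b c).
pose g1 y := s * (f (xat a b y, y) - f (xat a c y, y)).
pose g2 y := s * (f (xat b c y, y) - f (xat a c y, y)).
have inner y : (\int[leb]_x ((EFin \o d1 f) \_ (tri a b c)) (x, y) =
   \int[leb]_(x in [set t | tri a b c (t, y)]) (d1 f (x, y))%:E)%E.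
  rewrite [RHS]integral_mkcond; apply: eq_integral => x _.
  by rewrite /patch; congr (if _ then _ else _); apply/idP/idP; rewrite !inE.
under eq_integral do rewrite inner.
have low y : a.2 < y < b.2 -> (\int[leb]_(x in [set t | tri a b c (t, y)]) (d1 f (x, y))%:E = (g1 y)%:E)%E.
  move=> yab; rewrite (slice_low yab bc).
  apply: (@FTC_signed _ (fun t => f (t, y)) (fun t => d1 f (t, y))).
  - exact: xat_low.
  - by move=> t; exact: is_derive_slice.
  - exact: continuous_slice.
have high y : b.2 < y < c.2 -> (\int[leb]_(x in [set t | tri a b c (t, y)]) (d1 f (x, y))%:E = (g2 y)%:E)%E.
  move=> ybc; rewrite (slice_high ab ybc).
  apply: (@FTC_signed _ (fun t => f (t, y)) (fun t => d1 f (t, y))).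
  - exact: xat_high.
  - by move=> t; exact: is_derive_slice.
  - exact: continuous_slice.
have out y : ~~ (a.2 < y < c.2) -> (\int[leb]_(x in [set t | tri a b c (t, y)]) (d1 f (x, y))%:E = 0)%E.
  by move=> yac; rewrite slice_out// integral_set0.
have cg1 : continuous g1.
  by move=> y; apply: cvgM; [exact: cvg_cst|apply: cvgB; exact: continuous_fxat].
have cg2 : continuous g2.
  by move=> y; apply: cvgM; [exact: cvg_cst|apply: cvgB; exact: continuous_fxat].
have i1 := integrable_oo a.2 b.2 cg1; have i2 := integrable_oo b.2 c.2 cg2.
transitivity (\int[leb]_y (((EFin \o g1) \_ `]a.2, b.2[ y) + ((EFin \o g2) \_ `]b.2, c.2[ y)))%E.
  apply: ae_eq_integral => //.
  - under eq_fun do rewrite -inner.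
    exact: measurable_fubini_G ii'.
  - apply: emeasurable_funD; apply/(measurable_restrictT _ _).1 => //.
      exact: measurable_int i1.
    exact: measurable_int i2.
  - exists [set b.2]; split => //; first exact: lebesgue_measure_set1.
    move=> y /= ne; apply: contrapT => yb; apply: ne => _.
    rewrite /patch !mem_setE !in_itv /=.
    have [y1|y1] := leP y a.2.
      rewrite out; last by rewrite ltNge y1.
      by rewrite /= ltNge (le_trans y1 ab) /= adde0.
    have [y2|y2|y2] := ltgtP y b.2; last by exfalso; exact: yb.
      by rewrite low ?y1// adde0.
    have [y3|y3] := ltP y c.2; first by rewrite high ?y2// add0e.
    by rewrite out ?adde0// (ltNge y) y3 andbF.
have mk (h : R -> R) p q : continuous h ->
    leb.-integrable setT ((EFin \o h) \_ `]p, q[).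
  by move=> ch; apply: (integrable_mkcond _ _).1; [exact: measurable_itv|exact: integrable_oo].
rewrite integralD//; [|exact: mk..].
rewrite -!integral_mkcond.
have roo_int (h : R -> R) p q : continuous h ->
    (\int[leb]_(x in `]p, q[) (EFin \o h) x = (Rint_oo h p q)%:E)%E.
  by move=> ch; rewrite /Rint_oo /Rintegral fineK//; apply: integrable_fin_num => //; exact: integrable_oo.
rewrite !roo_int// -EFinD; congr EFin.
rewrite !Rint_oo_lin; try exact: continuous_fxat.
rewrite -mulrDr; congr (_ * _).
rewrite (Rint_oo_line cf ab) (Rint_oo_line cf bc).
have := Rint_oo_line cf (le_trans ab bc); rewrite (Rint_oo_split _ ab bc); last exact: continuous_fxat.
rewrite /tri_edges (seg_int_sym a c cf) => E.
by rewrite addrACA -opprD E; ring.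
Qed.

Lemma tri_edges_cyc f a b c : tri_edges f b c a = tri_edges f a b c.
Proof. by rewrite /tri_edges addrC addrA. Qed.

Lemma tri_edges_swap f a b c : continuous f -> tri_edges f b a c = - tri_edges f a b c.
Proof.
move=> cf; rewrite /tri_edges (seg_int_sym a b cf) (seg_int_sym b c cf) (seg_int_sym c a cf).
by ring.
Qed.

(** The sum over the sides and the orientation both change sign when two
    vertices are exchanged, so the vertices may be sorted by height. *)
Lemma tri_int_d1 f a b c : orient a b c != 0 -> C1x f ->
  (\int[leb2 R]_(x in tri a b c) (d1 f x)%:E = (Num.sg (orient a b c) * tri_edges f a b c)%:E)%E.
Proof.
move=> D0 C1f; have [cf _ _] := C1f.
pose P a b c :=
  (\int[leb2 R]_(x in tri a b c) (d1 f x)%:E = (Num.sg (orient a b c) * tri_edges f a b c)%:E)%E.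
have cyc p q r : P q r p -> P p q r by rewrite /P tri_cyc orient_cyc tri_edges_cyc.
have swap_coord p q r : P q p r -> P p q r.
  by rewrite /P tri_swap orient_swap (tri_edges_swap _ _ _ cf) sgrN mulrNN.
have n1 : orient b c a != 0 by rewrite orient_cyc.
have n2 : orient c a b != 0 by rewrite orient_cyc.
have n3 : orient b a c != 0 by rewrite orient_swap oppr_eq0.
have n4 : orient a c b != 0 by rewrite orient_cyc.
have n5 : orient c b a != 0 by rewrite orient_cyc.
have srt p q r : orient p q r != 0 -> p.2 <= q.2 -> q.2 <= r.2 -> P p q r.
  by move=> nzD pq qr; exact: tri_sorted.
suff : P a b c by [].
have [ab|/ltW ba] := leP a.2 b.2; have [bc|/ltW cb] := leP b.2 c.2; have [ac|/ltW ca] := leP a.2 c.2.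
- exact: srt.
- exact: srt.
- exact/cyc/cyc/swap_coord/srt.
- exact/cyc/cyc/srt.
- exact/swap_coord/srt.
- exact/cyc/srt.
- exact/cyc/swap_coord/srt.
- exact/cyc/swap_coord/srt.
Qed.

Definition swap_coord x : plane R := (x.2, x.1).

Lemma orient_swap_coord a b c : orient (swap_coord a) (swap_coord b) (swap_coord c) = - orient a b c.
Proof. by rewrite /orient /cross /swap_coord /=; ring. Qed.

Lemma tri_swap_coord a b c x :
  tri a b c (swap_coord x) <-> tri (swap_coord a) (swap_coord b) (swap_coord c) x.
Proof.
rewrite /tri /= orient_swap_coord.
have E p q : cross (swap_coord q - swap_coord p) (x - swap_coord p) = - cross (q - p) (swap_coord x - p).
  by rewrite /cross /swap_coord /=; ring.
by rewrite !E !mulrNN.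
Qed.

(** The reflection in the diagonal exchanges the two partial derivatives and
    reverses the orientation. *)
Lemma tri_int_d2 f a b c : orient a b c != 0 -> C1y f ->
  (\int[leb2 R]_(x in tri a b c) (d2 f x)%:E =
    (- Num.sg (orient a b c) *
       ((b.1 - a.1) * seg_int f a b + (c.1 - b.1) * seg_int f b c + (a.1 - c.1) * seg_int f c a))%:E)%E.
Proof.
move=> D0 [cf df cdf].
have ii := integrable_tri D0 cdf.
have ii' : (leb2 R).-integrable setT ((EFin \o d2 f) \_ (tri a b c) : mplane R -> \bar R).
  by apply/(integrable_mkcond _ (measurable_tri a b c)).
rewrite integral_mkcond (leb2_integral_swap ii').
pose g x := f (swap_coord x).
have d1g x : d1 g x = d2 f (swap_coord x) by [].
have D0' : orient (swap_coord a) (swap_coord b) (swap_coord c) != 0 by rewrite orient_swap_coord oppr_eq0.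
have cs : continuous swap_coord.
  by move=> x; apply: (@cvg_pair _ _ _ _ (nbhs x.2) (nbhs x.1)); [exact: cvg_snd|exact: cvg_fst].
have C1g : C1x g.
  split.
  - by move=> x; apply: continuous_comp; [exact: cs|exact: cf].
  - by move=> x; exact: (df (swap_coord x)).
  - by move=> x; apply: (@continuous_comp _ _ _ swap_coord (d2 f)); [exact: cs|exact: cdf].
have := tri_int_d1 D0' C1g.
rewrite integral_mkcond orient_swap_coord sgrN.
have -> : tri_edges g (swap_coord a) (swap_coord b) (swap_coord c) =
  (b.1 - a.1) * seg_int f a b + (c.1 - b.1) * seg_int f b c + (a.1 - c.1) * seg_int f c a by [].
move=> <-; apply: eq_integral => x _.
rewrite /patch /= -/(swap_coord x).
have [xt|xt] := pselect (tri a b c (swap_coord x)).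
  by rewrite !mem_set//; exact: (tri_swap_coord a b c x).1.
by rewrite !memNset// => /(tri_swap_coord a b c x).2.
Qed.

End triangle.

(** * Barycentric coordinates *)

Lemma I3_ind (P : 'I_3 -> Prop) : P 0 -> P 1 -> P 2%:R -> forall k, P k.
Proof.
move=> P0 P1 P2 [[|[|[|//]]] Hk].
- by rewrite (_ : Ordinal Hk = 0)//; exact/val_inj.
- by rewrite (_ : Ordinal Hk = 1)//; exact/val_inj.
- by rewrite (_ : Ordinal Hk = 2%:R)//; exact/val_inj.
Qed.

Lemma sumI3 (V : nmodType) (F : 'I_3 -> V) : \sum_k F k = F 0 + F 1 + F 2%:R.
Proof.
rewrite !big_ord_recl big_ord0 addr0 addrA.
by congr (_ + _ + _); congr F; exact/val_inj.
Qed.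

Lemma inord1_I3 : inord 1 = 1 :> 'I_3.
Proof. by apply/val_inj; rewrite /= inordK. Qed.

Lemma inord2_I3 : inord 2 = 2%:R :> 'I_3.
Proof. by apply/val_inj; rewrite /= inordK. Qed.

Lemma addI3E : (((0 + 1)%R = 1%R :> 'I_3) * ((0 + 2%:R)%R = 2%:R%R :> 'I_3) *
  ((1 + 1)%R = 2%:R%R :> 'I_3) * ((1 + 2%:R)%R = 0%R :> 'I_3) *
  ((2%:R + 1)%R = 0%R :> 'I_3) * ((2%:R + 2%:R)%R = 1%R :> 'I_3))%type.
Proof. by do ! split; exact/val_inj. Qed.

Section barycentric.
Context (R : realType).
Implicit Types (v : 'I_3 -> plane R) (x y : plane R) (B : {set 'I_3}).

Definition tdet v : R := orient (v 0) (v 1) (v 2%:R).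

Definition bary v (k : 'I_3) x : R :=
  cross (v (k + 2%:R) - v (k + 1)) (x - v (k + 1)) / tdet v.

(** The faces of a mesh are these sets for the vertices of one triangle. *)
Definition conv v B : set (plane R) :=
  [set x | exists t : 'I_3 -> R,
    [/\ forall k, 0 <= t k, forall k, k \notin B -> t k = 0,
        \sum_k t k = 1 & x = \sum_k (t k *: v k)]].

Lemma bary_sum v x : tdet v != 0 -> \sum_k bary v k x = 1.
Proof.
move=> D0; rewrite sumI3 /bary !addI3E -!mulrDl.
rewrite [X in X / _](_ : _ = tdet v) ?divff// /tdet /orient /cross /=; ring.
Qed.

Lemma sumI3_pair (t : 'I_3 -> R) v :
  \sum_k (t k *: v k) = (\sum_k (t k * (v k).1), \sum_k (t k * (v k).2)).
Proof. by rewrite !sumI3; case: (v 0) (v 1) (v 2%:R) => [? ?] [? ?] [? ?]. Qed.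

Lemma bary_comb v x : tdet v != 0 -> x = \sum_k (bary v k x *: v k).
Proof.
move=> D0; rewrite sumI3_pair !sumI3 /bary !addI3E.
case: x => x1 x2; congr pair.
  transitivity (x1 * tdet v / tdet v); first by rewrite mulfK.
  by rewrite !(mulrAC _ _^-1) -!mulrDl; congr (_ / _); rewrite /tdet /orient /cross /=; ring.
transitivity (x2 * tdet v / tdet v); first by rewrite mulfK.
by rewrite !(mulrAC _ _^-1) -!mulrDl; congr (_ / _); rewrite /tdet /orient /cross /=; ring.
Qed.

Lemma bary_vert v j k : tdet v != 0 -> bary v k (v j) = (k == j)%:R.
Proof.
move=> D0.
have E1 k' : bary v k' (v (k' + 1)) = 0 by rewrite /bary subrr /cross /= !mulr0 subrr mul0r.
have E2 k' : bary v k' (v (k' + 2%:R)) = 0.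
  by rewrite /bary (_ : cross _ _ = 0) ?mul0r// /cross; ring.
have E0 k' : bary v k' (v k') = 1.
  rewrite /bary [X in X / _](_ : _ = tdet v) ?divff//.
  by move: k'; apply: I3_ind; rewrite !addI3E /tdet /orient /cross /=; ring.
move: k j; apply: I3_ind; apply: I3_ind; rewrite ?E0 ?eqxx//.
- by move: (E1 0); rewrite !addI3E => ->.
- by move: (E2 0); rewrite !addI3E => ->.
- by move: (E2 1); rewrite !addI3E => ->.
- by move: (E1 2%:R); rewrite !addI3E => ->.
- by move: (E2 2%:R); rewrite !addI3E => ->.
Qed.

Lemma bary_affine v k (t : 'I_3 -> R) w : \sum_j t j = 1 ->
  bary v k (\sum_j (t j *: w j)) = \sum_j t j * bary v k (w j).
Proof.
rewrite sumI3_pair !sumI3 => t1.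
have t0 : t 0 = 1 - t 1 - t 2%:R by rewrite -t1; ring.
by rewrite /bary /cross /= t0; ring.
Qed.

Lemma bary_affine2 v k (s : R) x y : bary v k (x + s *: (x - y)) = (1 + s) * bary v k x - s * bary v k y.
Proof. by rewrite /bary /cross /= /GRing.scale /=; ring. Qed.

Lemma bary_line v k (s : R) x y :
  bary v k (pt x y s) = (1 - s) * bary v k x + s * bary v k y.
Proof. by rewrite /bary /cross /=; ring. Qed.

(** The coefficients of a convex combination of the vertices of a nondegenerate
    triangle are its barycentric coordinates. *)
Lemma convE v B x : tdet v != 0 ->
  conv v B x <-> (forall k, 0 <= bary v k x) /\ (forall k, k \notin B -> bary v k x = 0).
Proof.
move=> D0; split => [[t [t0 tB t1 xE]]|[b0 bB]].
  have E k : bary v k x = t k.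
    rewrite xE bary_affine// (bigD1 k)//= bary_vert// eqxx mulr1 big1 ?addr0// => j jk.
    by rewrite bary_vert// eq_sym (negbTE jk) mulr0.
  by split => k; rewrite E; [exact: t0|exact: tB].
by exists (bary v ^~ x); split => //; [exact: bary_sum|exact: bary_comb].
Qed.

Lemma continuous_bary v k : continuous (bary v k).
Proof. by move=> x; apply: cvgM; [exact: continuous_cross|exact: cvg_cst]. Qed.

Lemma bary_gt0_tri v x : tdet v != 0 ->
  (forall k, 0 < bary v k x) <-> tri (v 0) (v 1) (v 2%:R) x.
Proof.
move=> D0.
have D2 : 0 < tdet v * tdet v by rewrite -expr2 exprn_even_gt0.
have E k : (0 < bary v k x) = (0 < tdet v * cross (v (k + 2%:R) - v (k + 1)) (x - v (k + 1))).
  rewrite -[RHS](pmulr_rgt0 _ D2) -[LHS](pmulr_rgt0 _ (mulr_gt0 D2 D2)).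
  by congr (0 < _); rewrite /bary; field.
split.
  move=> H; have := H 0; have := H 1; have := H 2%:R; rewrite !E !addI3E /tri /=.
  by split.
by rewrite /tri => -[h0 h1 h2]; apply: I3_ind; rewrite E !addI3E.
Qed.

Lemma closed_conv v B : tdet v != 0 -> closed (conv v B).
Proof.
move=> D0.
have -> : conv v B = \bigcap_(k in [set: 'I_3]) ([set x | 0 <= bary v k x] `&`
    [set x | k \notin B -> bary v k x = 0]).
  apply/seteqP; split => x.
    by move=> /(convE _ _ D0)[h1 h2] k _; split; [exact: h1|exact: h2].
  by move=> h; apply/(convE _ _ D0); split => k; have [] := h k I.
apply: closed_bigI => k _; apply: closedI.
  exact: ((continuous_closedP _).1 (@continuous_bary v k) _ (@closed_ge R 0)).
have [kB|kB] := boolP (k \in B).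
  have -> : [set x | ~~ true -> bary v k x = 0] = setT by apply/seteqP; split.
  exact: closedT.
have -> : [set x | ~~ false -> bary v k x = 0] = bary v k @^-1` [set 0].
  by apply/seteqP; split => x /=; [apply|].
exact: ((continuous_closedP _).1 (@continuous_bary v k) _ (@closed_eq R 0)).
Qed.

(** If the coordinate of index k vanishes at an interior point x, then moving
    from x away from vertex k makes it negative while staying in the closed
    triangle. *)
Lemma interior_conv v : tdet v != 0 ->
  (conv v [set: 'I_3])° = tri (v 0) (v 1) (v 2%:R).
Proof.
move=> D0; apply/seteqP; split => x; last first.
  suff sub : tri (v 0) (v 1) (v 2%:R) `<=` conv v [set: 'I_3].
    by move: x; rewrite -/(tri _ _ _ `<=` _) -open_subsetE//; exact: open_tri.
  move=> y /(bary_gt0_tri y D0) ty; apply/(convE _ _ D0); split => k.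
    exact: ltW.
  by rewrite inE.
move=> /= xi; apply/(bary_gt0_tri x D0) => k.
have /(convE _ _ D0)[x0 _] := interior_subset xi.
rewrite lt_neqAle x0 andbT; apply/eqP => xk0.
have cs : (fun s : R => x + s *: (x - v k)) @ (0 : R)^'+ --> x.
  apply: cvg_at_right_filter; suff : (fun s : R => x + s *: (x - v k)) @ (0 : R) --> x + (0 : R) *: (x - v k).
    by rewrite scale0r addr0.
  apply: cvgD; first exact: cvg_cst.
  by apply: cvgZr_tmp; exact: cvg_id.
have : \forall s \near (0 : R)^'+, conv v [set: 'I_3] (x + s *: (x - v k)) by exact: (cs _ xi).
move=> H; have [s [s0 hs]] : exists s : R, 0 < s /\ conv v [set: 'I_3] (x + s *: (x - v k)).
  near (0 : R)^'+ => s; exists s; split; first by [].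
  by near: s.
have /(convE _ _ D0)[/(_ k)] := hs.
by rewrite bary_affine2 -xk0 mulr0 add0r bary_vert// eqxx mulr1 oppr_ge0 leNgt s0.
Unshelve. all: by end_near. Qed.

Lemma conv_closure_cell v x : tdet v != 0 -> conv v [set: 'I_3] x ->
  ~ tri (v 0) (v 1) (v 2%:R) x -> exists k, bary v k x = 0.
Proof.
move=> D0 /(convE _ _ D0)[x0 _] nt; apply: contrapT => /forallNP H; apply: nt.
apply/(bary_gt0_tri x D0) => k; rewrite lt_neqAle x0 andbT eq_sym; exact/eqP.
Qed.

End barycentric.

(** * Geometry of the mesh *)

Section mesh_geometry.
Context (R : realType).
Variables (O : set (plane R)) (T : mesh R).
Hypotheses (lipO : lipschitz_boundary O) (hT : triangulation O T).
Local Notation face i B := (@face R T i B).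
Implicit Types (i j : 'I_(ncell T)) (x y z : plane R).

(** A Lipschitz domain has no slits: near a boundary point z, the region strictly
    below the graph is disjoint from O, hence from its closure, and it contains
    points arbitrarily close to z.  So z is not interior to the closure. *)
Lemma lipschitz_interior_closure : (closure O)° `<=` O.
Proof.
move=> z zi; apply: contrapT => nOz.
have bz : boundary O z.
  by split; [exact: interior_subset zi|move=> /interior_subset].
have [e [r [k [L [phi [e1 r0 k0 Lphi HO]]]]]] := lipO bz.
have {}e1 : e.1 ^+ 2 + e.2 ^+ 2 = 1.
  have /(congr1 (fun t => t ^+ 2)) := e1.
  rewrite /enorm sqr_sqrtr ?expr1n /dot ?expr2//.
  by rewrite addr_ge0// -expr2 sqr_ge0.
(* z itself is the point with local coordinates (0, 0) *)
have phi0 : 0 <= phi 0.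
  rewrite leNgt; apply/negP => phi0; apply: nOz.
  have := (HO 0 0); rewrite normr0 => /(_ r0 k0)[_ /(_ phi0)].
  by rewrite !mul0r !addr0 subr0; case: (z).
(* the local coordinates of a point in the orthonormal frame of the chart *)
pose S x : R := (x.1 - z.1) * e.2 - (x.2 - z.2) * e.1.
pose U x : R := (x.1 - z.1) * e.1 + (x.2 - z.2) * e.2.
have cS : continuous S.
  move=> x; apply: cvgB; (apply: cvgM; last exact: cvg_cst).
    by apply: cvgB; [exact: cvg_fst|exact: cvg_cst].
  by apply: cvgB; [exact: cvg_snd|exact: cvg_cst].
have cU : continuous U.
  move=> x; apply: cvgD; (apply: cvgM; last exact: cvg_cst).
    by apply: cvgB; [exact: cvg_fst|exact: cvg_cst].
  by apply: cvgB; [exact: cvg_snd|exact: cvg_cst].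
(* the cone below z of slope L lies under the graph, as phi 0 >= 0 *)
have notO x : `|S x| < r -> `|U x| < k -> U x < - (L * `|S x|) -> ~ O x.
  move=> Sr Uk UL.
  have xE : x = (z.1 + S x * e.2 + U x * e.1, z.2 - S x * e.1 + U x * e.2).
    case: x {Sr Uk UL} => x1 x2; rewrite /S /U /=; congr pair.
      have -> : z.1 + ((x1 - z.1) * e.2 - (x2 - z.2) * e.1) * e.2 +
         ((x1 - z.1) * e.1 + (x2 - z.2) * e.2) * e.1 =
         z.1 + (x1 - z.1) * (e.1 ^+ 2 + e.2 ^+ 2) by ring.
      by rewrite e1 mulr1 addrC subrK.
    have -> : z.2 - ((x1 - z.1) * e.2 - (x2 - z.2) * e.1) * e.1 +
         ((x1 - z.1) * e.1 + (x2 - z.2) * e.2) * e.2 =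
         z.2 + (x2 - z.2) * (e.1 ^+ 2 + e.2 ^+ 2) by ring.
    by rewrite e1 mulr1 addrC subrK.
  rewrite xE => /(HO _ _ Sr Uk).
  apply/negP; rewrite -leNgt.
  have := Lphi (S x) 0; rewrite subr0 ler_norml => /andP[h _]; lra.
(* the points of the axis of that cone approach z *)
pose q t : plane R := (z.1 - t * e.1, z.2 - t * e.2).
have Sq t : S (q t) = 0 by rewrite /S /q /=; ring.
have Uq t : U (q t) = - t.
  rewrite /U /q /=.
  have -> : (z.1 - t * e.1 - z.1) * e.1 + (z.2 - t * e.2 - z.2) * e.2 =
    - t * (e.1 ^+ 2 + e.2 ^+ 2) by ring.
  by rewrite e1 mulr1.
have cq : q @ (0 : R)^'+ --> z.
  apply: cvg_at_right_filter; suff : q @ (0 : R) --> q 0.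
    by rewrite /q !mul0r !subr0; case: (z).
  apply: (@cvg_pair _ _ _ _ (nbhs (z.1 - 0 * e.1)) (nbhs (z.2 - 0 * e.2))).
    by apply: cvgB; [exact: cvg_cst|apply: cvgM; [exact: cvg_id|exact: cvg_cst]].
  by apply: cvgB; [exact: cvg_cst|apply: cvgM; [exact: cvg_id|exact: cvg_cst]].
have [t [t0 tk cOt]] : exists t, [/\ 0 < t, t < k & closure O (q t)].
  have zi' : nbhs z (closure O) := zi.
  have nO : \forall t \near (0 : R)^'+, closure O (q t) := cq _ zi'.
  near (0 : R)^'+ => t; exists t; split; first by [].
    by near: t; exact: nbhs_right_lt.
  by near: t.
have cV : continuous (fun x => U x + L * `|S x|).
  move=> x; apply: cvgD; first exact: cU.
  by apply: cvgM; [exact: cvg_cst|apply: cvg_norm; exact: cS].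
have nb : nbhs (q t) [set x | [/\ `|S x| < r, `|U x| < k & U x + L * `|S x| < 0]].
  have n1 : nbhs (q t) [set x | `|S x| < r].
    by apply: (cvgr_norm_lt _ (cS (q t))); rewrite Sq normr0.
  have n2 : nbhs (q t) [set x | `|U x| < k].
    by apply: (cvgr_norm_lt _ (cU (q t))); rewrite Uq normrN gtr0_norm.
  have n3 : nbhs (q t) [set x | U x + L * `|S x| < 0].
    by apply: (cvgr_lt _ (cV (q t))); rewrite Sq Uq normr0 mulr0 addr0 oppr_lt0.
  by apply: filterS3 n1 n2 n3 => x; split.
have [x [Ox [h1 h2 h3]]] := cOt _ nb.
by apply: notO h1 h2 _ Ox; rewrite -subr_lt0 opprK.
Unshelve. all: by end_near. Qed.

Lemma nondeg i : tdet (vert i) != 0.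
Proof. by have [h _ _] := hT; have := h i; rewrite inord1_I3 inord2_I3. Qed.

Lemma cellE i : cell i = tri (vert i 0) (vert i 1) (vert i 2%:R).
Proof. exact: interior_conv (nondeg i). Qed.

Lemma cellP i x : cell i x <-> forall k, 0 < bary (vert i) k x.
Proof. by rewrite cellE; symmetry; exact: bary_gt0_tri (nondeg i). Qed.

Lemma faceP i B x : face i B x <->
  (forall k, 0 <= bary (vert i) k x) /\ (forall k, k \notin B -> bary (vert i) k x = 0).
Proof. exact: convE (nondeg i). Qed.

Lemma face_closure i B : face i B `<=` closure O.
Proof.
have [_ -> _] := hT; move=> x /faceP[h _]; exists i => //.
by apply/faceP; split => // k; rewrite inE.
Qed.

Lemma cell_sub i : cell i `<=` O.
Proof.
move=> x cx; apply: lipschitz_interior_closure; apply: interiorS cx.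
exact: face_closure.
Qed.

Lemma proper_label (B : {set 'I_3}) : B != [set: 'I_3]%SET -> exists k, k \notin B.
Proof.
move=> BT; apply: contrapT => /forallNP H; move/eqP: BT; apply.
by apply/setP => k; rewrite inE; apply/idPn => /H.
Qed.

Lemma cells_disjoint i j x : cell i x -> cell j x -> i = j.
Proof.
move=> ci cj; apply/eqP; apply: contrapT => /negP ij.
have [_ _ h] := hT; have [B [C [BT _ E _]]] := h i j ij.
have [k kB] := proper_label BT.
have : face i B x by rewrite -E; split; exact: interior_subset.
move=> /faceP[_ /(_ k kB)] b0.
by have /cellP/(_ k) := ci; rewrite b0 ltxx.
Qed.

Lemma O_cover x : O x -> (exists i, cell i x) \/ exists i k, bary (vert i) k x = 0.
Proof.
move=> /subset_closure; have [_ -> _] := hT; move=> [i _ fx].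
have [cx|ncx] := pselect (cell i x); first by left; exists i.
right; exists i; apply: conv_closure_cell (nondeg i) fx _.
by rewrite -cellE.
Qed.

End mesh_geometry.

Lemma I3_cases (k j : 'I_3) : [\/ j = k, j = k + 1 | j = k + 2%:R].
Proof.
move: k j; apply: I3_ind; apply: I3_ind; rewrite !addI3E;
  by [constructor 1|constructor 2|constructor 3].
Qed.

Lemma addk1 (k : 'I_3) : (k + 1 == k) = false.
Proof. by move: k; apply: I3_ind. Qed.
Lemma addk2 (k : 'I_3) : (k + 2%:R == k) = false.
Proof. by move: k; apply: I3_ind. Qed.
Lemma addk12 (k : 'I_3) : (k + 1 == k + 2%:R) = false.
Proof. by move: k; apply: I3_ind. Qed.

Lemma sumI3k (V : nmodType) (F : 'I_3 -> V) k : \sum_j F j = F k + F (k + 1) + F (k + 2%:R).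
Proof.
rewrite sumI3; move: k; apply: I3_ind; rewrite ?addI3E //.
  by rewrite [RHS]addrC addrA.
by rewrite [LHS]addrC addrA.
Qed.

Section edges.
Context (R : realType).
Variables (O : set (plane R)) (T : mesh R).
Hypotheses (oO : open O) (lipO : lipschitz_boundary O) (hT : triangulation O T).
Implicit Types (i j : 'I_(ncell T)) (x y z : plane R).
Let D0 := nondeg hT.

(** Some point of the closed edge is in O; by moving it towards y one gets such a
    point z in the open edge.  Near z the domain extends beyond the edge, where
    another triangle j must be found, since finitely many closed triangles cover
    the closure of O.  By conformity the common part of both triangles is a
    common face; as it contains z it is the whole edge, so j lies on the other
    side of the whole edge.  Hence every point y of the open edge is interior to
    the union of both triangles, which is contained in the closure of O, and
    [lipschitz_interior_closure] applies. *)
Lemma edge_interior i k y :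
  ~ (face i (~: [set k])%SET `<=` boundary O) ->
  bary (vert i) k y = 0 -> (forall m, m != k -> 0 < bary (vert i) m y) -> O y.
Proof.
move=> nb yk ym; set v := vert i in yk ym *.
have cO x : closure O x -> ~ boundary O x -> O x.
  by move=> cx nbx; apply: contrapT => nO; apply: nbx; split=> // /interior_subset.
have edgeP x : face i (~: [set k])%SET x <-> (forall m, 0 <= bary v m x) /\ bary v k x = 0.
  split.
    by move=> /(faceP hT)[h1 h2]; split => //; apply: h2; rewrite !inE eqxx.
  move=> [h1 h2]; apply/(faceP hT); split => // m; rewrite !inE negbK => /eqP ->.
  exact: h2.
have [z [zk zm Oz]] : exists z, [/\ bary v k z = 0, (forall m, m != k -> 0 < bary v m z) & O z].
  have [z0 [ez0 nbz0]] : exists z0, face i (~: [set k])%SET z0 /\ ~ boundary O z0.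
    apply: contrapT => /forallNP H; apply: nb => x ex; apply: contrapT => nbx.
    by apply: (H x).
  have Oz0 : O z0 by apply: cO nbz0; exact: face_closure hT _ _ _ ez0.
  have nO : \forall s \near (0 : R)^'+, O (pt z0 y s).
    have : pt z0 y @ (0 : R)^'+ --> z0.
      have z0E : pt z0 y 0 = z0 by rewrite /pt subr0 !mul1r !mul0r !addr0; case: (z0).
      by apply: cvg_at_right_filter; have := @continuous_pt R z0 y 0; rewrite /continuous_at z0E.
    by move=> /(_ O); apply; apply: open_nbhs_nbhs; split.
  near (0 : R)^'+ => s; exists (pt z0 y s); split.
  - have /edgeP[_ h] := ez0.
    by rewrite bary_line h yk !mulr0 addr0.
  - move=> m mk; rewrite bary_line.
    have /edgeP[h _] := ez0.
    have s0 : 0 < s by [].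
    have s1 : s < 1 by near: s; exact: nbhs_right_lt.
    apply: ltr_wpDl; last by apply: mulr_gt0; [|exact: ym].
    by apply: mulr_ge0; [rewrite subr_ge0 ltW|exact: h].
  - by near: s.
pose xe (s : R) := z + s *: (z - v k).
have cxe : xe @ (0 : R)^'+ --> z.
  apply: cvg_at_right_filter; suff : xe @ (0 : R) --> xe 0 by rewrite /xe scale0r addr0.
  by apply: cvgD; [exact: cvg_cst|apply: cvgZr_tmp; exact: cvg_id].
have [j [fz [s [s0 fs]]]] :
    exists j, face j [set: 'I_3]%SET z /\ exists s, 0 < s /\ face j [set: 'I_3]%SET (xe s).
  apply: contrapT => /forallNP H.
  have nf j : \forall s \near (0 : R)^'+, ~ face j [set: 'I_3]%SET (xe s).
    have [fz|nfz] := pselect (face j [set: 'I_3]%SET z).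
      near=> s => fs; apply: (H j); split => //; exists s; split => //.
    have ofc : nbhs z (~` face j [set: 'I_3]%SET).
      apply: open_nbhs_nbhs; split => //; apply: closed_openC.
      exact: closed_conv (D0 j).
    exact: cxe ofc.
  have nO : \forall s \near (0 : R)^'+, O (xe s).
    by apply: (cxe O); apply: open_nbhs_nbhs; split.
  have nf' := filter_forall _ nf.
  near (0 : R)^'+ => s.
  have Os : O (xe s) by near: s.
  have : forall j, ~ face j [set: 'I_3]%SET (xe s).
    by near: s; exact: nf'.
  have := subset_closure Os; have [_ -> _] := hT; move=> [j _ fj] /(_ j); exact.
set w := vert j.
have ij : i != j.
  apply/eqP => E; move: fs; rewrite -E => /(faceP hT)[/(_ k)].
  by rewrite -/v /xe bary_affine2 zk mulr0 add0r bary_vert ?eqxx ?mulr1 ?oppr_ge0 ?leNgt ?s0//; exact: D0.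
have [_ _ /(_ i j ij)[B [C [BT CT EB EC]]]] := hT.
have fiz : face i [set: 'I_3]%SET z.
  apply/(faceP hT); split => m; rewrite ?inE//.
  by have [->|mk] := eqVneq m k; rewrite ?zk//; exact/ltW/zm.
have fBz : face i B z by rewrite -EB.
have Bk : forall m, m \notin B -> m = k.
  move=> m mB; apply/eqP; apply/negPn/negP => mk.
  by have /(faceP hT)[_ /(_ m mB) h] := fBz; have := zm m mk; rewrite h ltxx.
have kB : k \notin B by have [m mB] := proper_label BT; rewrite -(Bk m mB).
have [l lC] := proper_label CT.
have edgeC x : (forall m, 0 <= bary v m x) -> bary v k x = 0 -> face j C x.
  move=> h1 h2; rewrite -EC; apply/(faceP hT); split => // m /Bk ->; exact: h2.
set p := v (k + 1); set q := v (k + 2%:R).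
have bk0 : v (k + 1) = p by [].
have [p0 q0] : face j C p /\ face j C q.
  split; apply: edgeC => [m|]; rewrite bary_vert ?ler0n//; try exact: D0.
    by rewrite eq_sym addk1.
  by rewrite eq_sym addk2.
move: p0 q0 => /(faceP hT)[p0 /(_ l lC) pl] /(faceP hT)[q0 /(_ l lC) ql].
rewrite -/w in p0 pl q0 ql.
have wE m x : bary w m x = bary v k x * bary w m (v k) + bary v (k + 1) x * bary w m p +
    bary v (k + 2%:R) x * bary w m q.
  rewrite {1}(bary_comb x (D0 i)) bary_affine; last exact: bary_sum (D0 i).
  by rewrite (sumI3k _ k).
(* The coordinate l of triangle j vanishes on the edge, so it is a multiple of
   the coordinate k of triangle i; xe s shows that the factor is negative. *)
have wl x : bary w l x = bary v k x * bary w l (v k) by rewrite wE pl ql !mulr0 !addr0.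
have wlk : bary w l (v k) < 0.
  rewrite lt_neqAle; apply/andP; split.
    apply/eqP => E0; have := wl (w l); rewrite E0 mulr0 bary_vert ?eqxx; last exact: D0.
    by move/eqP; rewrite oner_eq0.
  have /(faceP hT)[/(_ l)] := fs.
  rewrite -/w (wl (xe s)) /xe bary_affine2 zk mulr0 add0r.
  by rewrite bary_vert ?eqxx ?mulr1; [rewrite mulNr oppr_ge0 pmulr_rle0|exact: D0].
have pq : p <> q.
  move=> E; have := @bary_vert R v (k + 2%:R) (k + 1) (D0 i).
  by rewrite -/q -E bary_vert ?eqxx ?addk12; [move/eqP; rewrite oner_eq0|exact: D0].
(* y is in the open edge of triangle j as well: otherwise both p and q would be
   the same vertex of j *)
have wm m : m != l -> 0 < bary w m y.
  move=> ml; have y1 := ym (k + 1); have y2 := ym (k + 2%:R).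
  rewrite addk1 in y1; rewrite addk2 in y2.
  have {}y1 := y1 isT; have {}y2 := y2 isT.
  have t1 : 0 <= bary v (k + 1) y * bary w m p by apply: mulr_ge0; [exact: ltW|exact: p0].
  have t2 : 0 <= bary v (k + 2%:R) y * bary w m q by apply: mulr_ge0; [exact: ltW|exact: q0].
  rewrite wE yk mul0r add0r lt_neqAle addr_ge0// andbT eq_sym paddr_eq0//.
  apply/negP => /andP[/eqP h1 /eqP h2].
  have nz (c d : R) : 0 < c -> c * d = 0 -> d = 0.
    by move=> c0 /eqP; rewrite mulf_eq0 (gt_eqF c0) => /eqP.
  have pm := nz _ _ y1 h1; have qm := nz _ _ y2 h2.
  have [n [nl nm lnm]] : exists n, [/\ n != l, n != m & forall a, a = l \/ a = m \/ a = n].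
    have [E|E|E] := I3_cases l m; first by rewrite E eqxx in ml.
      exists (l + 2%:R); rewrite addk2 E eq_sym addk12; split => // a.
      by have [->|->|->] := I3_cases l a; auto.
    exists (l + 1); rewrite addk1 E addk12; split => // a.
    by have [->|->|->] := I3_cases l a; auto.
  have one x : bary w l x = 0 -> bary w m x = 0 -> x = w n.
    move=> xl xm.
    have wj a : a != n -> bary w a x = 0.
      by have [->|[->|->]] := lnm a; rewrite ?eqxx.
    have := bary_sum x (D0 j); rewrite (bigD1 n)//= big1 ?addr0 => [xn|a an]; last exact: wj.
    rewrite (bary_comb x (D0 j)) (bigD1 n)//= big1 ?addr0 => [|a an].
      by rewrite xn scale1r.
    by rewrite -/w wj// scale0r.
  by apply: pq; rewrite (one p pl pm) (one q ql qm).
have nv m : m != k -> \forall x \near y, 0 < bary v m x.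
  by move=> mk; apply: (cvgr_gt _ (@continuous_bary R v m y)); exact: ym.
have nw m : m != l -> \forall x \near y, 0 < bary w m x.
  by move=> mk; apply: (cvgr_gt _ (@continuous_bary R w m y)); exact: wm.
apply: (lipschitz_interior_closure lipO).
have Nv : nbhs y [set x | forall m, m != k -> 0 < bary v m x].
  apply: (@filter_forall _ _ (fun m => [set x | m != k -> 0 < bary v m x]) _ (nbhs_filter y)) => m.
  have [->|mk] := eqVneq m k; first by apply: filterE => x /eqP.
  by apply: filterS (nv m mk) => x h _.
have Nw : nbhs y [set x | forall m, m != l -> 0 < bary w m x].
  apply: (@filter_forall _ _ (fun m => [set x | m != l -> 0 < bary w m x]) _ (nbhs_filter y)) => m.
  have [->|mk] := eqVneq m l; first by apply: filterE => x /eqP.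
  by apply: filterS (nw m mk) => x h _.
apply: filterS2 Nv Nw => x hv hw.
(* x is in triangle i or in triangle j according to its side of the edge *)
have [bx|bx] := leP 0 (bary v k x).
  apply: (face_closure hT (i := i) (B := [set: 'I_3]%SET)); apply/(faceP hT); split => m; rewrite ?inE//.
  by have [->|mk] := eqVneq m k; [|exact/ltW/hv].
apply: (face_closure hT (i := j) (B := [set: 'I_3]%SET)); apply/(faceP hT); split => m; rewrite ?inE//.
have [->|ml] := eqVneq m l; last exact/ltW/hw.
by rewrite -/w wl mulr_le0 ?ltW.
Unshelve. all: by end_near. Qed.

End edges.

Section null_lines.
Context (R : realType).
Implicit Types a b x : plane R.

Lemma null_line a b : a != 0 ->
  leb2 R [set x | cross a (x - b) = 0] = 0%E.
Proof.
move=> a0; have [a1|a1] := eqVneq a.1 0.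
  have a2 : a.2 != 0 by apply: contraNneq a0 => a2; case: a a1 a2 => ? ? /= -> ->.
  have -> : [set x | cross a (x - b) = 0] = [set b.1] `*` setT.
    apply/seteqP; split => x /=; rewrite /cross a1 mul0r sub0r.
      move=> /eqP; rewrite oppr_eq0 mulf_eq0 (negbTE a2) /= subr_eq0 => /eqP ->.
      by split.
    move=> [E _]; have E' : x.1 - b.1 = 0 by rewrite E subrr.
    by rewrite -[LHS]/(- (a.2 * (x.1 - b.1))) E' mulr0 oppr0.
  have -> : leb2 R ([set b.1] `*` setT) = (@lebesgue_measure R [set b.1] * @lebesgue_measure R setT)%E.
    by apply: product_measure1E => //; exact: measurable_set1.
  by rewrite lebesgue_measure_set1 mul0e.
rewrite /leb2 /= /product_measure1.
rewrite -[RHS](@integral0 _ _ _ (@lebesgue_measure R) setT); apply: eq_integral => t _ /=.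
have -> : xsection [set x | cross a (x - b) = 0] t = [set b.2 + a.2 * (t - b.1) / a.1].
  apply/seteqP; split => y; rewrite /xsection /= inE /cross /=.
    move=> /eqP; rewrite subr_eq0 => /eqP E.
    have -> : y = b.2 + (y - b.2) by rewrite addrC subrK.
    by congr (_ + _); rewrite -E mulrAC mulfV// mul1r.
  by move=> ->; rewrite addrAC subrr add0r mulrCA mulfV// mulr1 subrr.
exact: lebesgue_measure_set1.
Qed.

Lemma measurable_line a b : measurable ([set x | cross a (x - b) = 0] : set (mplane R)).
Proof.
have cl : closed [set x : plane R | cross a (x - b) = 0].
  have cc := @continuous_cross R a b.
  have -> : [set x : plane R | cross a (x - b) = 0] =
      (fun x : plane R => cross a (x - b)) @^-1` [set y : R | y = 0].
    by [].
  exact: ((continuous_closedP _).1 cc _ (@closed_eq R 0)).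
rewrite -[X in measurable X]setCK.
by apply: measurableC; apply: plane_open_measurable; exact: closed_openC.
Qed.

End null_lines.

Section cells.
Context (R : realType).
Variables (O : set (plane R)) (T : mesh R).
Hypotheses (oO : open O) (lipO : lipschitz_boundary O) (hT : triangulation O T).
Implicit Types (i j : 'I_(ncell T)) (x y z : plane R).
Let D0 := nondeg hT.

Lemma edge_neq0 i k : vert i (k + 2%:R) - vert i (k + 1) != 0.
Proof.
apply/eqP => E; have := @bary_vert R (vert i) k k (D0 i).
rewrite eqxx /bary E /cross /= !mul0r subrr mul0r => /eqP.
by rewrite eq_sym oner_eq0.
Qed.

Lemma bary0_null i k : (leb2 R).-negligible [set x | bary (vert i) k x = 0].
Proof.
exists [set x | cross (vert i (k + 2%:R) - vert i (k + 1)) (x - vert i (k + 1)) = 0]; split.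
- exact: measurable_line.
- exact: null_line (edge_neq0 i k).
- move=> x /=; rewrite /bary => /eqP; rewrite mulf_eq0 invr_eq0 (negbTE (D0 i)) orbF.
  by move/eqP.
Qed.

Lemma measurable_cell i : measurable (cell i : set (mplane R)).
Proof. by rewrite (cellE hT); exact: measurable_tri. Qed.

Lemma open_cell i : open (cell i).
Proof. by rewrite (cellE hT); exact: open_tri. Qed.

Lemma measurable_domain : measurable (O : set (mplane R)).
Proof. exact: plane_open_measurable. Qed.

Definition cells := \big[setU/set0]_(i < ncell T) cell i.

Lemma cellsP x : cells x <-> exists i, cell i x.
Proof.
rewrite /cells; split.
  elim/big_ind : _ => [//|A B HA HB [/HA|/HB]//|i _ cx]; by exists i.
by move=> [i cx]; rewrite (bigD1 i)//=; left.
Qed.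

Lemma measurable_cells : measurable (cells : set (mplane R)).
Proof. by apply: bigsetU_measurable => i _; exact: measurable_cell. Qed.

(** What the open triangles leave out lies on the lines through finitely many
    edges. *)
Lemma O_minus_cells_null : leb2 R (O `\` cells) = 0%E.
Proof.
apply/negligibleP; first by apply: measurableD; [exact: measurable_domain|exact: measurable_cells].
pose N (n : nat) := if (unpickle n : option ('I_(ncell T) * 'I_3)) is Some p then
   [set x | bary (vert p.1) p.2 x = 0] else set0.
have nN : (leb2 R).-negligible (\bigcup_n N n).
  apply: negligible_bigcup => n; rewrite /N; case: unpickle => [p|]; first exact: bary0_null.
  exact: negligible_set0.
apply: negligibleS nN => x [Ox ncx]; have [cx|[i [k b0]]] := O_cover hT Ox.
  by exfalso; apply: ncx; apply/cellsP.
by exists (pickle (i, k)) => //; rewrite /N pickleK.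
Qed.

Lemma Rint_cells (h : plane R -> R) :
  (leb2 R).-integrable O (EFin \o h : mplane R -> \bar R) ->
  \int[leb2 R]_(x in O) h x = \sum_(i < ncell T) \int[leb2 R]_(x in cell i) h x.
Proof.
move=> ih.
have cO : cells `<=` O by move=> x /cellsP[i]; exact: cell_sub.
have mh : measurable_fun (cells : set (mplane R)) (h : mplane R -> R).
  by apply: measurable_funS (measurable_domain) cO _; apply/measurable_EFinP; exact: measurable_int ih.
have mN : measurable (O `\` cells : set (mplane R)).
  by apply: measurableD; [exact: measurable_domain|exact: measurable_cells].
rewrite /Rintegral.
have -> := @negligible_integral _ (mplane R) R (leb2 R) O (O `\` cells) (EFin \o h)
  mN measurable_domain ih O_minus_cells_null.
rewrite setDD (setIidr cO) /cells integral_bigsetU_EFin//.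
- rewrite -sum_fine// => i _; apply: integrable_fin_num; first exact: measurable_cell.
  apply: integrableS ih; [exact: measurable_domain|exact: measurable_cell|exact: cell_sub].
- exact: measurable_cell.
- exact: index_enum_uniq.
- move=> i j _ _ [x [ci cj]]; exact: cells_disjoint hT _ _ _ ci cj.
- exact/measurable_EFinP.
Qed.

Lemma RTfun_cell c i x : cell i x -> RTfun c x = rtpoly (c i) x.
Proof.
move=> cx; rewrite /RTfun (bigD1 i)//= indicE mem_set// scale1r big1 ?addr0// => j ji.
rewrite indicE memNset ?scale0r// => cj; move/eqP: ji; apply.
exact: cells_disjoint hT _ _ _ cj cx.
Qed.

Lemma P0fun_cell v i x : cell i x -> P0fun v x = v i.
Proof.
move=> cx; rewrite /P0fun (bigD1 i)//= indicE mem_set// mulr1 big1 ?addr0// => j ji.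
rewrite indicE memNset ?mulr0// => cj; move/eqP: ji; apply.
exact: cells_disjoint hT _ _ _ cj cx.
Qed.

End cells.

(** * The divergence theorem on a triangle *)

Section divergence_theorem.
Context (R : realType).
Implicit Types (f g w : plane R -> R) (v : 'I_3 -> plane R) (c : plane R * R).

Lemma seg_int_lin f g (r s : R) (a b : plane R) : continuous f -> continuous g ->
  seg_int (fun x => r * f x + s * g x) a b = r * seg_int f a b + s * seg_int g a b.
Proof.
move=> cf cg; rewrite /seg_int.
have mf (h : plane R -> R) (t : R) : continuous h -> continuous (fun u : R => t * h (pt a b u)).
  by move=> ch u; apply: cvgM; [exact: cvg_cst|exact: continuous_fpt].
rewrite RintegralD//; [|exact: continuous_integrable01 (mf f r cf)|
  exact: continuous_integrable01 (mf g s cg)].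
by rewrite !RintegralZl//; apply: continuous_integrable01; exact: continuous_fpt.
Qed.

Lemma smooth_continuous f : smooth f -> continuous f.
Proof. by move=> sf; exact: Ck_continuous (sf 0%N). Qed.

Lemma smooth_C1x f : smooth f -> C1x f.
Proof.
move=> sf; have [cf [df [c1 c2]]] := sf 1%N.
by split; [exact: cf|move=> x; case: (df x)|case: c1].
Qed.

Lemma smooth_C1y f : smooth f -> C1y f.
Proof.
move=> sf; have [cf [df [c1 c2]]] := sf 1%N.
by split; [exact: cf|move=> x; case: (df x)|case: c2].
Qed.

Lemma smooth_rt1 c : smooth (fun x : plane R => (rtpoly c x).1).
Proof.
have : smooth (fun x : plane R => c.1.1 + c.2 * x.1).
  apply: smoothD; first exact: smooth_cst.
  by apply: smoothM; [exact: smooth_cst|move=> n; apply: Ck_fst (Ck1_id _ _)].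
by [].
Qed.

Lemma smooth_rt2 c : smooth (fun x : plane R => (rtpoly c x).2).
Proof.
have : smooth (fun x : plane R => c.1.2 + c.2 * x.2).
  apply: smoothD; first exact: smooth_cst.
  by apply: smoothM; [exact: smooth_cst|move=> n; apply: Ck_snd (Ck1_id _ _)].
by [].
Qed.

Lemma d1_rt1 c x : d1 (fun x : plane R => (rtpoly c x).1) x = c.2.
Proof.
suff H : is_derive (x.1 : R) (1 : R) (fun t : R => c.1.1 + c.2 * t) c.2.
  have -> : d1 (fun x : plane R => (rtpoly c x).1) x = 'D_1 (fun t : R => c.1.1 + c.2 * t) x.1 by [].
  exact: derive_val.
by apply: is_derive_eq; rewrite /GRing.scale /=; ring.
Qed.

Lemma d2_rt2 c x : d2 (fun x : plane R => (rtpoly c x).2) x = c.2.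
Proof.
suff H : is_derive (x.2 : R) (1 : R) (fun t : R => c.1.2 + c.2 * t) c.2.
  have -> : d2 (fun x : plane R => (rtpoly c x).2) x = 'D_1 (fun t : R => c.1.2 + c.2 * t) x.2 by [].
  exact: derive_val.
by apply: is_derive_eq; rewrite /GRing.scale /=; ring.
Qed.

(** The outer normal scaled by the length of the edge; the orientation of the
    triangle is accounted for by the sign.  Together with the unit
    parametrisation of [seg_int] it makes [eflux] the flux of w times the
    Raviart-Thomas polynomial c through the edge. *)
Definition tnormal v (k : 'I_3) : plane R :=
  let t := v (k + 2%:R) - v (k + 1) in Num.sg (tdet v) *: (t.2, - t.1).

Definition eflux v k c w : R :=
  seg_int (fun x => dot (rtpoly c x) (tnormal v k) * w x) (v (k + 1)) (v (k + 2%:R)).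

Lemma eflux_split v k c w : smooth w ->
  eflux v k c w = Num.sg (tdet v) *
   (((v (k + 2%:R)).2 - (v (k + 1)).2) * seg_int (fun x => (rtpoly c x).1 * w x) (v (k + 1)) (v (k + 2%:R)) -
    ((v (k + 2%:R)).1 - (v (k + 1)).1) * seg_int (fun x => (rtpoly c x).2 * w x) (v (k + 1)) (v (k + 2%:R))).
Proof.
move=> sw; rewrite mulrBr !mulrA -mulNr.
rewrite -seg_int_lin; last 2 first.
- exact: smooth_continuous (smoothM (smooth_rt1 c) sw).
- exact: smooth_continuous (smoothM (smooth_rt2 c) sw).
congr seg_int; apply/funext => x; rewrite /dot /tnormal /= /GRing.scale /=; ring.
Qed.

(** The integrand is the divergence of w times a + b x. *)
Lemma divergence_triangle v c w : tdet v != 0 -> smooth w ->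
  \int[leb2 R]_(x in tri (v 0) (v 1) (v 2%:R)) (dot (rtpoly c x) (grad w x) + 2 * c.2 * w x) =
  \sum_k eflux v k c w.
Proof.
move=> D0 sw.
pose g1 x := (rtpoly c x).1 * w x; pose g2 x := (rtpoly c x).2 * w x.
have s1 : smooth g1 by exact: smoothM (smooth_rt1 c) sw.
have s2 : smooth g2 by exact: smoothM (smooth_rt2 c) sw.
have [_ dw1 _] := smooth_C1x sw; have [_ dw2 _] := smooth_C1y sw.
have [_ dr1 _] := smooth_C1x (smooth_rt1 c); have [_ dr2 _] := smooth_C1y (smooth_rt2 c).
have E x : dot (rtpoly c x) (grad w x) + 2 * c.2 * w x = d1 g1 x + d2 g2 x.
  rewrite /g1 (d1M (dr1 x) (dw1 x)) /g2 (d2M (dr2 x) (dw2 x)) d1_rt1 d2_rt2 /dot /=; ring.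
under eq_Rintegral do rewrite E.
have [c1 _ cd1] := smooth_C1x s1; have [c2 _ cd2] := smooth_C1y s2.
rewrite RintegralD; [|exact: measurable_tri|exact: integrable_tri|exact: integrable_tri].
rewrite /Rintegral (tri_int_d1 D0 (smooth_C1x s1)) (tri_int_d2 D0 (smooth_C1y s2)) /=.
rewrite sumI3 !eflux_split// !addI3E /tri_edges -/(tdet v) /g1 /g2; ring.
Qed.

End divergence_theorem.

(** * Integrability and cutoffs *)

Section integrability.
Context (R : realType).
Variable m : {measure set (mplane R) -> \bar R}.
Implicit Types (D U : set (plane R)) (f h w : plane R -> R).

Lemma Lpnorm_integral D (p : R) f : 0 < p -> measurable (D : set (mplane R)) ->
  (Lpnorm m D p%:E f `^ p = \int[m]_(x in D) ((`|f x| `^ p)%R)%:E)%E.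
Proof.
move=> p0 mD; rewrite /Lpnorm powR_Lnorm; last by rewrite gt_eqF.
rewrite [RHS]integral_mkcond; apply: eq_integral => x _; rewrite /patch /=.
by case: ifP => xD; rewrite ?normr0 ?powR0 ?gt_eqF.
Qed.

Lemma Lpnorm_fin D (p : R) f : 0 < p -> measurable (D : set (mplane R)) ->
  (Lpnorm m D p%:E f < +oo)%E -> (\int[m]_(x in D) ((`|f x| `^ p)%R)%:E < +oo)%E.
Proof. by move=> p0 mD h; rewrite -Lpnorm_integral// poweR_lty. Qed.

Lemma Lp_integrable D (p : R) f : 1 <= p -> measurable (D : set (mplane R)) ->
  (m D < +oo)%E -> inLp m D p%:E f -> m.-integrable D (EFin \o f : mplane R -> \bar R).
Proof.
move=> p1 mD Dfin [mf fp]; have p0 : 0 < p by exact: lt_le_trans p1.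
have {}fp := Lpnorm_fin p0 mD fp.
apply/integrableP; split; first exact/measurable_EFinP.
have mfp : measurable_fun D (fun x : mplane R => (`|f x| `^ p)%:E).
  apply/measurable_EFinP; apply: (@measurableT_comp _ _ _ _ _ _ (fun t : R => t `^ p)) => //.
  exact: measurableT_comp.
apply: (@le_lt_trans _ _ (\int[m]_(x in D) (1 + (`|f x| `^ p)%:E))%E).
  apply: ge0_le_integral => //.
  - by apply: measurableT_comp => //; exact/measurable_EFinP.
  - by apply: emeasurable_funD.
  move=> x Dx; rewrite /= -EFinD lee_fin.
  have [f1|f1] := leP `|f x| 1; first by rewrite (le_trans f1)// lerDl powR_ge0.
  rewrite (@le_trans _ _ (`|f x| `^ p))//; last by rewrite lerDr.
  by rewrite -[leLHS]powRr1// ler_powR// ltW.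
rewrite ge0_integralD//.
by rewrite integral_cst//= mul1e lte_add_pinfty.
Qed.

Lemma integrable_mul_bounded D f w C : measurable (D : set (mplane R)) ->
  m.-integrable D (EFin \o f : mplane R -> \bar R) ->
  measurable_fun (D : set (mplane R)) (w : mplane R -> R) ->
  (forall x, D x -> `|w x| <= C) ->
  m.-integrable D (EFin \o (fun x => f x * w x) : mplane R -> \bar R).
Proof.
move=> mD fi mw wC.
have mf : measurable_fun D (f : mplane R -> R) by apply/measurable_EFinP; exact: measurable_int fi.
have Cf : m.-integrable D (fun x : mplane R => (C%:E * (`|f x|)%:E)%E).
  by apply: integrableZl => //; exact: (integrable_abse fi).
apply: le_integrable Cf => //.
  by apply/measurable_EFinP; exact: measurable_funM.
move=> x Dx; rewrite /= !lee_fin normrM mulrC.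
rewrite (le_trans _ (ler_norm _))//.
by rewrite ler_wpM2r//; exact: wC.
Qed.

End integrability.

Section cutoffs.
Context (R : realType).
Implicit Types (D U O : set (plane R)) (f h w phi : plane R -> R).

Lemma integrable_mul_cont D f w : measurable (D : set (mplane R)) -> bounded_set D ->
  (leb2 R).-integrable D (EFin \o f : mplane R -> \bar R) -> continuous w ->
  (leb2 R).-integrable D (EFin \o (fun x => f x * w x) : mplane R -> \bar R).
Proof.
move=> mD bD fi cw; have [M M0 DM] := bounded_sub_box bD.
have [C C0 HC] := continuous_bounded_box M cw.
apply: (@integrable_mul_bounded _ _ _ _ _ C) => //.
  exact: measurable_funS (plane_continuous_measurable cw).
by move=> x /DM/HC.
Qed.

Lemma test_funS U O phi : U `<=` O -> test_fun U phi -> test_fun O phi.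
Proof. by move=> UO [s c k]; split => //; exact: subset_trans UO. Qed.

Lemma test_fun_grad_out U phi x : test_fun U phi -> ~ U x -> grad phi x = 0.
Proof.
move=> [_ _ sU] nU.
have nx : nbhs x (~` closure [set x | phi x != 0]).
  apply: open_nbhs_nbhs; split; last by move=> /sU.
  by apply: closed_openC; exact: closed_closure.
have E : \forall y \near x, phi y = cst 0 y.
  apply: filterS nx => y ny; apply/eqP/negPn/negP => nz; apply: ny; exact: subset_closure.
by rewrite /grad /d1 /d2 !(near_eq_derive _ E) !derive_cst.
Qed.

Lemma cutoff_limit U h : open U -> bounded_set U ->
  (leb2 R).-integrable U (EFin \o h : mplane R -> \bar R) ->
  \int[leb2 R]_(x in U) (h x * cutoff U n x) @[n --> \oo] --> \int[leb2 R]_(x in U) h x.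
Proof.
move=> oU bU ih.
have mU := plane_open_measurable oU.
have mh : measurable_fun U (h : mplane R -> R) by apply/measurable_EFinP; exact: measurable_int ih.
have mc n : measurable_fun U (cutoff U n : mplane R -> R).
  apply: measurable_funS (plane_continuous_measurable _) => //.
  by apply: smooth_continuous; case: (cutoff_test_fun U n).
have mhc n : measurable_fun U (fun x : mplane R => (h x * cutoff U n x)%:E).
  by apply/measurable_EFinP; exact: measurable_funM.
have cvh : {ae leb2 R, forall x, U x -> (h x * cutoff U n x)%:E @[n --> \oo] --> (EFin \o h) x}.
  apply: aeW => x Ux.
  have c1 : (h x * cutoff U n x : R) @[n --> \oo] --> (h x * 1 : R).
    by apply: cvgM; [exact: cvg_cst|exact: cutoff_cvg].
  rewrite mulr1 in c1.
  by apply: cvg_EFin; [exact: nearW|exact: c1].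
have dom : {ae leb2 R, forall x n, U x -> (`|(h x * cutoff U n x)%:E| <= (abse \o (EFin \o h)) x)%E}.
  apply: aeW => x n Ux; rewrite /= lee_fin normrM ler_piMr//.
  by have /andP[c0 c1] := cutoff01 U n x; rewrite ger0_norm.
have [_ _ H] := @dominated_convergence _ (mplane R) R (leb2 R) U mU
  (fun n x => (h x * cutoff U n x)%:E) (EFin \o h) (abse \o (EFin \o h)) mhc
  (measurable_int _ ih) cvh (integrable_abse ih) dom.
apply: fine_cvg; rewrite fineK; last exact: integrable_fin_num.
exact: H.
Qed.

End cutoffs.

(** * Green's formula for smooth functions *)

Section eflux_limits.
Context (R : realType).
Local Notation leb := (@lebesgue_measure R).
Implicit Types (v : 'I_3 -> plane R) (c : plane R * R) (w : plane R -> R).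

Lemma seg_int_eq0 (f : plane R -> R) (a b : plane R) :
  (forall t, 0 <= t <= 1 -> f (pt a b t) = 0) -> seg_int f a b = 0.
Proof.
move=> f0; rewrite /seg_int (@eq_Rintegral _ _ _ _ _ (fun=> 0)).
  by rewrite Rintegral_cst// mul0r.
by move=> t; rewrite inE /= in_itv /=; exact: f0.
Qed.

Lemma smooth_dot_normal v k c : smooth (fun x => dot (rtpoly c x) (tnormal v k)).
Proof.
apply: smoothD; apply: smoothM; try exact: smooth_cst.
  exact: smooth_rt1.
exact: smooth_rt2.
Qed.

(** It is enough that the open edge lies in U: the two end points are a null
    set. *)
Lemma eflux_cutoff v k c w (U : set (plane R)) : smooth w -> open U ->
  (forall t, 0 < t < 1 -> U (pt (v (k + 1)) (v (k + 2%:R)) t)) ->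
  eflux v k c (fun x => w x * cutoff U n x) @[n --> \oo] --> eflux v k c w.
Proof.
move=> sw oU eU; rewrite /eflux /seg_int.
set a := v (k + 1); set b := v (k + 2%:R).
pose h (t : R) : R := dot (rtpoly c (pt a b t)) (tnormal v k) * w (pt a b t).
have ch : continuous h.
  have := @continuous_fpt R _ a b (smooth_continuous (smoothM (smooth_dot_normal v k c) sw)).
  by [].
have ih := continuous_integrable01 0 1 ch.
have mh := measurable_int _ ih.
have mc n : measurable_fun (`[0, 1]%classic : set (measurableTypeR R)) (fun t => cutoff U n (pt a b t)).
  apply: measurable_funS (continuous_measurable_fun _) => //.
  by apply: continuous_fpt; apply: smooth_continuous; case: (cutoff_test_fun U n).
have mhc n : measurable_fun (`[0, 1]%classic : set (measurableTypeR R))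
    (fun t => (h t * cutoff U n (pt a b t))%:E).
  by apply/measurable_EFinP; apply: measurable_funM => //; exact/measurable_EFinP.
have cvh : {ae leb, forall t, `[0, 1]%classic t ->
    (h t * cutoff U n (pt a b t))%:E @[n --> \oo] --> (EFin \o h) t}.
  exists ([set 0] `|` [set 1]); split.
  - by apply: measurableU; exact: measurable_set1.
  - by rewrite null_set_setU//; try exact: lebesgue_measure_set1; exact: measurable_set1.
  move=> t /= nt; apply: contrapT => t01; apply: nt; rewrite in_itv /= => /andP[t0 t1].
  have tU : U (pt a b t).
    apply: eU; apply/andP; split; rewrite lt_neqAle ?t0 ?t1 andbT; apply/eqP => E; apply: t01.
      by left.
    by right.
  have c1 : (h t * cutoff U n (pt a b t) : R) @[n --> \oo] --> (h t * 1 : R).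
    by apply: cvgM; [exact: cvg_cst|exact: cutoff_cvg].
  rewrite mulr1 in c1.
  by apply: cvg_EFin; [exact: nearW|exact: c1].
have dom : {ae leb, forall t n, `[0, 1]%classic t ->
    (`|(h t * cutoff U n (pt a b t))%:E| <= (abse \o (EFin \o h)) t)%E}.
  apply: aeW => t n _; rewrite /= lee_fin normrM ler_piMr//.
  by have /andP[c0 c1] := cutoff01 U n (pt a b t); rewrite ger0_norm.
have [_ _ H] := @dominated_convergence _ _ R leb `[0, 1]%classic (measurable_itv _)
  (fun n t => (h t * cutoff U n (pt a b t))%:E) (EFin \o h) (abse \o (EFin \o h)) mhc
  mh cvh (integrable_abse ih) dom.
under eq_cvg => n do under eq_Rintegral do rewrite mulrA.
apply: fine_cvg; rewrite fineK; last exact: integrable_fin_num.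
exact: H.
Qed.

End eflux_limits.

Lemma cvg_finsum (R : realType) (I : Type) (s : seq I) (P : pred I) (u : I -> nat -> R) (l : I -> R) :
  (forall i, P i -> u i n @[n --> \oo] --> l i) ->
  (\sum_(i <- s | P i) u i n) @[n --> \oo] --> \sum_(i <- s | P i) l i.
Proof.
move=> ul; elim: s => [|i s IH].
  by rewrite big_nil; under eq_fun do rewrite big_nil; exact: cvg_cst.
rewrite big_cons; under eq_fun do rewrite big_cons.
by case: ifPn => Pi //; apply: cvgD => //; exact: ul.
Qed.

Lemma cvg_zero (R : realType) (u : nat -> R) (l : R) :
  u n @[n --> \oo] --> l -> (forall n, u n = 0) -> l = 0.
Proof.
move=> ul u0; have E : u = (fun=> 0) by exact/funext.
rewrite E in ul; apply: (cvg_unique (@Rhausdorff R) ul); exact: cvg_cst.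
Qed.

Section green.
Context (R : realType).
Variables (O : set (plane R)) (T : mesh R).
Hypotheses (oO : open O) (bO : bounded_set O) (lipO : lipschitz_boundary O) (hT : triangulation O T).
Variables (c : {ffun 'I_(ncell T) -> plane R * R}) (dc : plane R -> R).
Hypothesis hc : inRT0 O c dc.
Implicit Types (i j : 'I_(ncell T)) (x y z : plane R) (w phi : plane R -> R).
Let D0 := nondeg hT.
Let mO' := measurable_domain oO.
Let Ofin := leb2_bounded_fin bO mO'.

Lemma cell_bounded i : bounded_set (@cell R T i).
Proof.
have [M [Mr HM]] := bO; exists M; split => // r Mr' x cx.
by apply: HM => //; exact: cell_sub lipO hT _ _ cx.
Qed.

Lemma integrable_dc : (leb2 R).-integrable O (EFin \o dc : mplane R -> \bar R).
Proof. by have [_ h _] := hc; apply: Lp_integrable h => //; rewrite ler1n. Qed.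

Lemma integrable_RT1 : (leb2 R).-integrable O (EFin \o (fun x => (RTfun c x).1) : mplane R -> \bar R).
Proof. by have [[h _] _ _] := hc; apply: Lp_integrable h => //; rewrite ler1n. Qed.

Lemma integrable_RT2 : (leb2 R).-integrable O (EFin \o (fun x => (RTfun c x).2) : mplane R -> \bar R).
Proof. by have [[_ h] _ _] := hc; apply: Lp_integrable h => //; rewrite ler1n. Qed.

Lemma integrable_cell h i : (leb2 R).-integrable O (EFin \o h : mplane R -> \bar R) ->
  (leb2 R).-integrable (cell i) (EFin \o h : mplane R -> \bar R).
Proof.
by apply: integrableS; [exact: mO'|exact: measurable_cell hT _|exact: cell_sub].
Qed.

Lemma integrable_RT_grad w : smooth w ->
  (leb2 R).-integrable O (EFin \o (fun x => dot (RTfun c x) (grad w x)) : mplane R -> \bar R).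
Proof.
move=> sw; have [_ _ c1] := smooth_C1x sw; have [_ _ c2] := smooth_C1y sw.
have i1 := integrable_mul_cont mO' bO integrable_RT1 c1.
have i2 := integrable_mul_cont mO' bO integrable_RT2 c2.
exact: (integrableD mO' i1 i2).
Qed.

Lemma integrable_dc_mul w : smooth w ->
  (leb2 R).-integrable O (EFin \o (fun x => dc x * w x) : mplane R -> \bar R).
Proof. by move=> sw; apply: integrable_mul_cont integrable_dc (smooth_continuous sw). Qed.

Lemma integrable_cont_cell w i : continuous w ->
  (leb2 R).-integrable (cell i) (EFin \o w : mplane R -> \bar R).
Proof. by move=> cw; rewrite (cellE hT); exact: (integrable_tri (D0 i) cw). Qed.

Lemma weak_div_cells phi : test_fun O phi ->
  \sum_(i < ncell T) \int[leb2 R]_(x in cell i) dot (rtpoly (c i) x) (grad phi x) =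
  - \sum_(i < ncell T) \int[leb2 R]_(x in cell i) (dc x * phi x).
Proof.
move=> tphi; have [sphi _ _] := tphi; have [_ _ wd] := hc.
have := wd phi tphi; rewrite (Rint_cells oO lipO hT (integrable_RT_grad sphi)).
rewrite (Rint_cells oO lipO hT (integrable_dc_mul sphi)) => <-.
apply: eq_bigr => i _; apply: eq_Rintegral => x; rewrite inE => cx.
by rewrite (RTfun_cell hT _ cx).
Qed.

Lemma continuous_dot_rt i w : smooth w -> continuous (fun x => dot (rtpoly (c i) x) (grad w x)).
Proof.
move=> sw; have [_ _ c1] := smooth_C1x sw; have [_ _ c2] := smooth_C1y sw.
have r1 := smooth_continuous (smooth_rt1 (c i)).
have r2 := smooth_continuous (smooth_rt2 (c i)).
by move=> x; apply: cvgD; apply: cvgM; [exact: r1|exact: c1|exact: r2|exact: c2].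
Qed.

Lemma green_cell i w : smooth w ->
  \int[leb2 R]_(x in cell i) dot (rtpoly (c i) x) (grad w x) +
  \int[leb2 R]_(x in cell i) (2 * (c i).2 * w x) = \sum_k eflux (vert i) k (c i) w.
Proof.
move=> sw; rewrite -divergence_triangle// -(cellE hT) RintegralD//.
- exact: measurable_cell hT i.
- by apply: integrable_cont_cell; exact: continuous_dot_rt.
- by apply: integrable_cont_cell; exact: smooth_continuous (smoothM (smooth_cst _) sw).
Qed.

(** For the test functions w chi_n with chi_n supported in the open triangle, the
    weak divergence and the divergence theorem give the same right-hand side.
    The cutoffs are removed by dominated convergence. *)
Lemma cell_div i w : smooth w ->
  \int[leb2 R]_(x in cell i) (dc x * w x) = \int[leb2 R]_(x in cell i) (2 * (c i).2 * w x).
Proof.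
move=> sw.
have i1 := integrable_cell i (integrable_dc_mul sw).
have i2 : (leb2 R).-integrable (cell i) (EFin \o (fun x => 2 * (c i).2 * w x) : mplane R -> \bar R).
  by apply: integrable_cont_cell; exact: smooth_continuous (smoothM (smooth_cst _) sw).
have mi := measurable_cell hT i.
apply/eqP; rewrite -subr_eq0 -RintegralB//; apply/eqP.
have ii : (leb2 R).-integrable (cell i)
    (EFin \o (fun x => dc x * w x - 2 * (c i).2 * w x) : mplane R -> \bar R).
  exact: (integrableB mi i1 i2).
have L := cutoff_limit (@open_cell R O T hT i) (@cell_bounded i) ii.
suff Z n : \int[leb2 R]_(x in cell i) ((dc x * w x - 2 * (c i).2 * w x) * cutoff (cell i) n x) = 0.
  exact: cvg_zero L Z.
pose phi x := w x * cutoff (cell i) n x.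
have tc : test_fun (cell i) phi by exact: test_funM sw (cutoff_test_fun _ _).
have tO : test_fun O phi by exact: test_funS (@cell_sub _ _ _ lipO hT i) tc.
have [sphi _ _] := tc.
have := weak_div_cells tO.
(* phi is zero outside triangle i *)
rewrite (bigD1 i)//= big1 ?addr0; last first.
  move=> j ji; rewrite (@eq_Rintegral _ _ _ _ _ (fun=> 0)).
    by rewrite Rintegral_cst ?mul0r//; exact: measurable_cell hT j.
  move=> x; rewrite inE => cx; rewrite (test_fun_grad_out tc) /dot ?mulr0 ?addr0//.
  by move=> ci; move/eqP: ji; apply; exact: cells_disjoint hT _ _ _ cx ci.
rewrite (bigD1 i)//= big1 ?addr0; last first.
  move=> j ji; rewrite (@eq_Rintegral _ _ _ _ _ (fun=> 0)).
    by rewrite Rintegral_cst ?mul0r//; exact: measurable_cell hT j.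
  move=> x; rewrite inE => cx; rewrite (test_fun_out tc) ?mulr0//.
  by move=> ci; move/eqP: ji; apply; exact: cells_disjoint hT _ _ _ cx ci.
have := green_cell i sphi.
rewrite big1 => [|k _]; last first.
  apply: seg_int_eq0 => t t01; rewrite (test_fun_out tc) ?mulr0//.
  move=> /(cellP hT)/(_ k); rewrite bary_line !bary_vert//.
  by rewrite eq_sym addk1 eq_sym addk2 !mulr0 addr0 ltxx.
move=> g1 g2; rewrite g2 in g1.
transitivity (\int[leb2 R]_(x in cell i) (dc x * phi x - 2 * (c i).2 * phi x)).
  by apply: eq_Rintegral => x _; rewrite /phi; ring.
rewrite RintegralB//.
- by apply/eqP; rewrite -oppr_eq0 opprB addrC g1.
- exact: integrable_cell (integrable_dc_mul sphi).
- by apply: integrable_cont_cell; exact: smooth_continuous (smoothM (smooth_cst _) sphi).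
Qed.

Definition bdry_edge i (k : 'I_3) : bool := `[< face i (~: [set k])%SET `<=` boundary O >].

Lemma edge_pt_face i k t : 0 <= t <= 1 ->
  face i (~: [set k])%SET (pt (vert i (k + 1)) (vert i (k + 2%:R)) t).
Proof.
move=> /andP[t0 t1]; apply/(faceP hT); split => m.
  rewrite bary_line !bary_vert//.
  by rewrite addr_ge0// mulr_ge0 ?ler0n// subr_ge0.
rewrite !inE negbK => /eqP ->.
by rewrite bary_line !bary_vert// eq_sym addk1 eq_sym addk2 !mulr0 addr0.
Qed.

Lemma edge_pt_in_O i k t : ~~ bdry_edge i k -> 0 < t < 1 ->
  O (pt (vert i (k + 1)) (vert i (k + 2%:R)) t).
Proof.
move=> /asboolP nb /andP[t0 t1]; apply: (edge_interior oO lipO hT nb).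
  by rewrite bary_line !bary_vert// eq_sym addk1 eq_sym addk2 !mulr0 addr0.
move=> m mk; rewrite bary_line !bary_vert//.
have [E|E|E] := I3_cases k m; first by rewrite E eqxx in mk.
  by rewrite E eqxx addk12 mulr0 addr0 mulr1 subr_gt0.
by rewrite E eqxx eq_sym addk12 mulr0 add0r mulr1.
Qed.

(** Green's formula on each triangle, summed, for the test functions w chi_n of
    O: the left-hand side vanishes by the definition of the weak divergence and
    by [cell_div], and the boundary edges contribute nothing since chi_n is zero
    there.  On the other edges chi_n tends to 1. *)
Lemma interior_flux0 w : smooth w ->
  \sum_(i < ncell T) \sum_(k | ~~ bdry_edge i k) eflux (vert i) k (c i) w = 0.
Proof.
move=> sw; pose phi n x := w x * cutoff O n x.
have tphi n : test_fun O (phi n) by exact: test_funM sw (cutoff_test_fun _ _).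
have Z n : \sum_(i < ncell T) \sum_(k | ~~ bdry_edge i k) eflux (vert i) k (c i) (phi n) = 0.
  have [sphi _ _] := tphi n.
  transitivity (\sum_(i < ncell T) \sum_k eflux (vert i) k (c i) (phi n)).
    apply: eq_bigr => i _; rewrite [RHS](bigID (bdry_edge i))/=.
    rewrite [X in _ = X + _]big1 ?add0r// => k /asboolP bk.
    apply: seg_int_eq0 => t t01; rewrite (test_fun_out (tphi n)) ?mulr0// => Ox.
    by have [_] := bk _ (edge_pt_face i k t01); apply; apply: open_nbhs_nbhs.
  under eq_bigr do rewrite -green_cell//.
  rewrite big_split/= weak_div_cells//.
  by under [X in _ + X]eq_bigr do rewrite -cell_div//; rewrite addNr.
have L : (\sum_(i < ncell T) \sum_(k | ~~ bdry_edge i k) eflux (vert i) k (c i) (phi n))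
   @[n --> \oo] --> \sum_(i < ncell T) \sum_(k | ~~ bdry_edge i k) eflux (vert i) k (c i) w.
  apply: cvg_finsum => i _; apply: cvg_finsum => k bk.
  by apply: eflux_cutoff => // t t01; exact: edge_pt_in_O.
exact: cvg_zero L Z.
Qed.

Theorem green_smooth w : smooth w ->
  \sum_(i < ncell T) (\int[leb2 R]_(x in cell i) dot (rtpoly (c i) x) (grad w x) +
     \int[leb2 R]_(x in cell i) (2 * (c i).2 * w x)) =
  \sum_(i < ncell T) \sum_(k | bdry_edge i k) eflux (vert i) k (c i) w.
Proof.
move=> sw; under eq_bigr do rewrite green_cell//.
rewrite -[RHS]addr0 -[X in _ = _ + X](interior_flux0 sw) -big_split/=.
by apply: eq_bigr => i _; rewrite [LHS](bigID (bdry_edge i)).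
Qed.

End green.

(** * Arc length on boundary segments *)

Section arclength.
Context (R : realType).
Local Notation leb := (@lebesgue_measure R).
Implicit Types (O : set (plane R)) (a b : plane R) (f : plane R -> R).

Lemma segmentE a b : segment a b = pt a b @` `[0, 1]%classic.
Proof. by []. Qed.

Lemma compact_segment a b : compact (segment a b).
Proof.
rewrite segmentE; apply: continuous_compact; last exact: segment_compact.
by apply: continuous_subspaceT; exact: continuous_pt.
Qed.

Lemma closed_segment a b : closed (segment a b).
Proof. by apply: compact_closed; [exact: norm_hausdorff|exact: compact_segment]. Qed.

Lemma measurable_closed (U : set (plane R)) : closed U -> measurable (U : set (mplane R)).
Proof.
move=> cU; rewrite -[X in measurable X]setCK; apply: measurableC.
by apply: plane_open_measurable; exact: closed_openC.
Qed.

Lemma preimage_pt_segment a b : a != b -> pt a b @^-1` segment a b = `[0, 1]%classic.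
Proof.
move=> ab; rewrite segmentE; apply/seteqP; split => t /=; last by exists t.
move=> [t' t'01 E].
suff -> : t = t' by [].
have e1 : (t' - t) * (b.1 - a.1) = 0.
  have := congr1 fst E; rewrite /pt /= => E1.
  have -> : (t' - t) * (b.1 - a.1) = ((1 - t') * a.1 + t' * b.1) - ((1 - t) * a.1 + t * b.1) by ring.
  by rewrite E1 subrr.
have e2 : (t' - t) * (b.2 - a.2) = 0.
  have := congr1 snd E; rewrite /pt /= => E1.
  have -> : (t' - t) * (b.2 - a.2) = ((1 - t') * a.2 + t' * b.2) - ((1 - t) * a.2 + t * b.2) by ring.
  by rewrite E1 subrr.
apply/eqP; rewrite eq_sym -subr_eq0; apply: contraNT ab => tt.
move: e1 e2 => /eqP; rewrite mulf_eq0 (negbTE tt) /= subr_eq0 => /eqP e1.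
move=> /eqP; rewrite mulf_eq0 (negbTE tt) /= subr_eq0 => /eqP e2.
by apply/eqP; case: a b e1 e2 {E} => ? ? [? ?] /= -> ->.
Qed.

Lemma measurable_pt a b : measurable_fun setT (pt a b : measurableTypeR R -> mplane R).
Proof.
apply/measurable_fun_pairP; split => /=.
  apply: continuous_measurable_fun => t; apply: cvgD; apply: cvgM; try exact: cvg_cst; try exact: cvg_id.
  by apply: cvgB; [exact: cvg_cst|exact: cvg_id].
apply: continuous_measurable_fun => t; apply: cvgD; apply: cvgM; try exact: cvg_cst; try exact: cvg_id.
by apply: cvgB; [exact: cvg_cst|exact: cvg_id].
Qed.

Variables (O : set (plane R)) (s : {measure set (mplane R) -> \bar R}).
Hypothesis hs : is_arclength O s.

Lemma enorm_ge0 (x : plane R) : 0 <= enorm x.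
Proof. exact: sqrtr_ge0. Qed.

(** On subsets of a boundary segment, the arc length measure is by definition
    the image of the multiple |b - a| of Lebesgue measure on [0, 1] under the
    parametrisation. *)
Lemma arclength_ge0_integral a b (f : mplane R -> \bar R) : a != b ->
  segment a b `<=` boundary O -> measurable_fun setT f -> (forall x, 0 <= f x)%E ->
  (\int[s]_(x in segment a b) f x =
   (enorm (b - a)%R)%:E * \int[leb]_(t in `[0%R, 1%R]) f (pt a b t))%E.
Proof.
move=> ab sb mf f0.
have mseg : measurable (segment a b : set (mplane R)) by apply: measurable_closed; exact: closed_segment.
pose k := NngNum (enorm_ge0 (b - a)).
have mpt := measurable_pt a b.
pose nu : {measure set (mplane R) -> \bar R} :=
  mscale k (pushforward leb (pt a b : measurableTypeR R -> mplane R)).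
rewrite (@eq_measure_integral _ _ _ _ (nu mpt)).
  rewrite ge0_integral_mscale//; last exact: measurable_funTS.
  congr (_ * _)%E.
  rewrite ge0_integral_pushforward//; last exact: measurable_funTS.
  by rewrite preimage_pt_segment.
move=> A measurable_coef AS.
have [_ /(_ a b sb A measurable_coef)] := hs.
rewrite (setIidl AS) => ->.
rewrite /nu /= /mscale /=; congr (_ * _)%E; rewrite /pushforward.
rewrite setIidr//; rewrite -[X in _ `<=` X](preimage_pt_segment ab).
by move=> t At; apply: AS.
Qed.

End arclength.

Section arclength2.
Context (R : realType).
Local Notation leb := (@lebesgue_measure R).
Variables (O : set (plane R)) (s : {measure set (mplane R) -> \bar R}).
Hypothesis hs : is_arclength O s.
Implicit Types (a b : plane R) (f : plane R -> R).

Lemma arclength_segment_fin a b : a != b -> segment a b `<=` boundary O ->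
  (s (segment a b) < +oo)%E.
Proof.
move=> ab sb; have [_ /(_ a b sb)] := hs => /(_ _ (measurable_closed (@closed_segment R a b))).
rewrite setIid => ->.
apply: lte_mul_pinfty; rewrite ?lee_fin ?enorm_ge0//.
apply: (@le_lt_trans _ _ (leb `[0%R, 1%R]%classic)).
  rewrite -/(pt a b) [X in leb (_ `&` X)](_ : _ = pt a b @^-1` segment a b)//.
  by rewrite (preimage_pt_segment ab) setIid.
by rewrite lebesgue_measure_itv /= lte_fin ltr01 -EFinD ltry.
Qed.

Lemma arclength_Rintegral a b f : a != b -> segment a b `<=` boundary O -> continuous f ->
  \int[s]_(x in segment a b) f x = enorm (b - a) * seg_int f a b.
Proof.
move=> ab sb cf.
have mf : measurable_fun setT (EFin \o f : mplane R -> \bar R).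
  by apply/measurable_EFinP; exact: plane_continuous_measurable.
pose h (t : R) : R := f (pt a b t).
have ih : leb.-integrable `[0, 1] (EFin \o h).
  by apply: continuous_integrable01; exact: continuous_fpt.
have ip : (\int[leb]_(t in `[0%R, 1%R]) (EFin \o h)^\+ t)%E \is a fin_num.
  by apply: integrable_fin_num => //; exact: integrable_funepos.
have inn : (\int[leb]_(t in `[0%R, 1%R]) (EFin \o h)^\- t)%E \is a fin_num.
  by apply: integrable_fin_num => //; exact: integrable_funeneg.
rewrite /seg_int /Rintegral integralE -/h [in RHS]integralE.
rewrite (arclength_ge0_integral hs ab sb (measurable_funepos mf))//.
rewrite (arclength_ge0_integral hs ab sb (measurable_funeneg mf))//.
have -> : (\int[leb]_(t in `[0%R, 1%R]) (EFin \o f)^\+ (pt a b t) =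
    \int[leb]_(t in `[0%R, 1%R]) (EFin \o h)^\+ t)%E.
  by apply: eq_integral => t _; exact: (esym (congr1 (fun g => g t) (funepos_comp (EFin \o f) (pt a b)))).
have -> : (\int[leb]_(t in `[0%R, 1%R]) (EFin \o f)^\- (pt a b t) =
    \int[leb]_(t in `[0%R, 1%R]) (EFin \o h)^\- t)%E.
  by apply: eq_integral => t _; exact: (esym (congr1 (fun g => g t) (funeneg_comp (EFin \o f) (pt a b)))).
by rewrite -muleBr ?fin_num_adde_defr// fineM// fin_numB ip inn.
Qed.
End arclength2.

Section hoelder_on_sets.
Context (R : realType).
Variable m : {measure set (mplane R) -> \bar R}.
Implicit Types (D : set (plane R)) (f g F : plane R -> R).

Lemma hoelder_set D (p q : R) f g : measurable (D : set (mplane R)) ->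
  measurable_fun D (f : mplane R -> R) -> measurable_fun D (g : mplane R -> R) ->
  0 < p -> 0 < q -> p^-1 + q^-1 = 1 ->
  (\int[m]_(x in D) (`|f x * g x|)%:E <= Lpnorm m D p%:E f * Lpnorm m D q%:E g)%E.
Proof.
move=> mD mf mg p0 q0 pq.
have mf' : measurable_fun [set: mplane R] (f \_ D : mplane R -> R) by apply/(measurable_restrictT _ mD).
have mg' : measurable_fun [set: mplane R] (g \_ D : mplane R -> R) by apply/(measurable_restrictT _ mD).
apply: le_trans (hoelder m mf' mg' p0 q0 pq).
rewrite Lnorm1 [leLHS]integral_mkcond le_eqVlt; apply/orP; left; apply/eqP.
apply: eq_integral => x _.
by rewrite /= /patch; case: ifP => //; rewrite mul0r normr0.
Qed.

Lemma LpnormS D D' (p : R) f : 0 < p -> D' `<=` D ->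
  measurable (D : set (mplane R)) -> measurable (D' : set (mplane R)) ->
  measurable_fun D (f : mplane R -> R) ->
  (Lpnorm m D' p%:E f <= Lpnorm m D p%:E f)%E.
Proof.
move=> p0 sD mD mD' mf.
have H : (Lpnorm m D' p%:E f `^ p <= Lpnorm m D p%:E f `^ p)%E.
  rewrite !Lpnorm_integral//; apply: ge0_subset_integral => //.
  apply/measurable_EFinP; apply: (@measurableT_comp _ _ _ _ _ _ (fun t : R => t `^ p)) => //.
  exact: measurableT_comp.
have pV0 : 0 <= p^-1 by rewrite invr_ge0 ltW.
rewrite -[leLHS](@poweRe1 _ _ (Lnorm_ge0 _ _ _)) -[leRHS](@poweRe1 _ _ (Lnorm_ge0 _ _ _)).
have -> : (1 : R) = p * p^-1 by rewrite mulfV ?gt_eqF.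
by rewrite !poweRrM; apply: gt0_ler_poweR => //; rewrite in_itv /= poweR_ge0 leey.
Qed.

(** Convergence in L^p on a set of finite measure implies convergence of the
    integrals, by Hoelder's inequality against the constant 1. *)
Lemma Lp_to_zero D (p q C : R) (F : nat -> plane R -> R) (f : nat -> plane R -> R) :
  measurable (D : set (mplane R)) -> (m D < +oo)%E -> 0 < p -> 0 < q -> p^-1 + q^-1 = 1 -> 0 <= C ->
  (forall n, measurable_fun D (f n : mplane R -> R)) ->
  (forall n, measurable_fun D (F n : mplane R -> R)) ->
  (forall n x, D x -> `|F n x| <= C * `|f n x|) ->
  Lpnorm m D p%:E (f n) @[n --> \oo] --> 0%E ->
  \int[m]_(x in D) F n x @[n --> \oo] --> (0 : R).
Proof.
move=> mD Dfin p0 q0 pq C0 mf mF FC fn0.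
pose K := (C%:E * Lpnorm m D q%:E (fun=> 1%R))%E.
have Kfin : K \is a fin_num.
  rewrite /K fin_numM// ge0_fin_numE ?Lnorm_ge0//.
  apply: (@lty_poweRy _ _ q); first by rewrite gt_eqF.
  rewrite Lpnorm_integral//.
  under eq_integral do rewrite normr1 powR1.
  by rewrite integral_cst// mul1e.
have bd n : (`| \int[m]_(x in D) (F n x)%:E | <= K * Lpnorm m D p%:E (f n))%E.
  have mFn : measurable_fun D (fun x : mplane R => (F n x)%:E) by apply/measurable_EFinP; exact: mF.
  have mfn : measurable_fun D (fun x : mplane R => (`|f n x * 1|)%:E).
    by apply/measurable_EFinP; apply: measurableT_comp => //; apply: measurable_funM => //; exact: mf.
  apply: (le_trans (le_abse_integral m mD mFn)).
  apply: (@le_trans _ _ (\int[m]_(x in D) (C%:E * (`|f n x * 1|)%:E))%E).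
    apply: ge0_le_integral => //.
    - exact: measurableT_comp.
    - exact: emeasurable_funM.
    - by move=> x Dx; rewrite mulr1 /= -EFinM lee_fin; exact: FC.
  rewrite ge0_integralZl//.
  rewrite /K -muleA [X in (_ <= _ * X)%E]muleC; apply: lee_wpmul2l; first by rewrite lee_fin.
  by apply: hoelder_set.
have cv : (K * Lpnorm m D p%:E (f n))%E @[n --> \oo] --> 0%E.
  by rewrite -(mule0 K); apply: cvgeZl.
have cv2 : (`| \int[m]_(x in D) (F n x)%:E |)%E @[n --> \oo] --> 0%E.
  apply: (@squeeze_cvge _ _ _ _ (fun=> 0%E)) cv => //; last exact: cvg_cst.
  by near=> n; rewrite abse_ge0 bd.
apply: fine_cvg; exact/cvg_abse0P.
Unshelve. all: by end_near. Qed.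

End hoelder_on_sets.

(** * Green's formula for Sobolev functions *)

Section euclid.
Context (R : realType).
Implicit Types x y : plane R.

Lemma enorm_sqr x : enorm x ^+ 2 = x.1 ^+ 2 + x.2 ^+ 2.
Proof. by rewrite /enorm sqr_sqrtr /dot ?expr2// addr_ge0// -expr2 sqr_ge0. Qed.

Lemma le_fst_enorm x : `|x.1| <= enorm x.
Proof.
rewrite -(@ler_pXn2r _ 2)// ?nnegrE ?enorm_ge0// enorm_sqr real_normK ?num_real//.
by rewrite lerDl sqr_ge0.
Qed.

Lemma le_snd_enorm x : `|x.2| <= enorm x.
Proof.
rewrite -(@ler_pXn2r _ 2)// ?nnegrE ?enorm_ge0// enorm_sqr real_normK ?num_real//.
by rewrite lerDr sqr_ge0.
Qed.

Lemma dot_le_enorm x y : `|dot x y| <= enorm x * enorm y.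
Proof.
rewrite -(@ler_pXn2r _ 2)// ?nnegrE ?mulr_ge0 ?enorm_ge0//.
rewrite exprMn !enorm_sqr real_normK ?num_real// /dot -subr_ge0.
have -> : (x.1 ^+ 2 + x.2 ^+ 2) * (y.1 ^+ 2 + y.2 ^+ 2) - (x.1 * y.1 + x.2 * y.2) ^+ 2 =
   (x.1 * y.2 - x.2 * y.1) ^+ 2 by ring.
exact: sqr_ge0.
Qed.

Lemma measurable_enorm (D : set (plane R)) (F : plane R -> plane R) :
  measurable_fun D ((fun x => (F x).1) : mplane R -> R) ->
  measurable_fun D ((fun x => (F x).2) : mplane R -> R) ->
  measurable_fun D ((fun x => enorm (F x)) : mplane R -> R).
Proof.
move=> m1 m2; rewrite /enorm.
apply: (@measurableT_comp _ _ _ _ _ _ (@Num.sqrt R)).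
  by apply: continuous_measurable_fun; exact: sqrt_continuous.
by apply: measurable_funD; apply: measurable_funM.
Qed.

End euclid.

Section passing_to_limit.
Context (R : realType).
Variable m : {measure set (mplane R) -> \bar R}.
Implicit Types (D : set (plane R)) (X : plane R -> R) (p q : R).

(** The form in which limits are taken below: the error of the integrand on D' is
    at most a multiple of a sequence that is small in L^p of the larger set D,
    where D is O or its boundary and D' a triangle or an edge. *)
Lemma Rintegral_cvg D D' p q C (Xn : nat -> plane R -> R) X (f : nat -> plane R -> R) :
  measurable (D : set (mplane R)) -> measurable (D' : set (mplane R)) -> D' `<=` D ->
  (m D' < +oo)%E -> 0 < p -> 0 < q -> p^-1 + q^-1 = 1 -> 0 <= C ->
  (forall n, measurable_fun D (f n : mplane R -> R)) ->
  (forall n, m.-integrable D' (EFin \o Xn n : mplane R -> \bar R)) ->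
  m.-integrable D' (EFin \o X : mplane R -> \bar R) ->
  (forall n x, D' x -> `|Xn n x - X x| <= C * `|f n x|) ->
  Lpnorm m D p%:E (f n) @[n --> \oo] --> 0%E ->
  \int[m]_(x in D') Xn n x @[n --> \oo] --> \int[m]_(x in D') X x.
Proof.
move=> mD mD' sD Dfin p0 q0 pq C0 mf iXn iX bd f0.
have f0' : Lpnorm m D' p%:E (f n) @[n --> \oo] --> 0%E.
  apply: (@squeeze_cvge _ _ _ _ (fun=> 0%E)) f0 => //; last exact: cvg_cst.
  by near=> n; rewrite Lnorm_ge0 /= LpnormS.
have mint Y : m.-integrable D' (EFin \o Y : mplane R -> \bar R) -> measurable_fun D' (Y : mplane R -> R).
  by move=> iY; apply/measurable_EFinP; exact: measurable_int iY.
have H := @Lp_to_zero R m D' p q C (fun n x => Xn n x - X x) f mD' Dfin p0 q0 pq C0 _ _ bd f0'.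
have {}H : \int[m]_(x in D') (Xn n x - X x) @[n --> \oo] --> (0 : R).
  apply: H => n; first exact: measurable_funS mD sD (mf n).
  by apply: measurable_funB; exact: mint.
have E n : \int[m]_(x in D') Xn n x = \int[m]_(x in D') (Xn n x - X x) + \int[m]_(x in D') X x.
  by rewrite RintegralB// subrK.
pose l : R := \int[m]_(x in D') X x.
pose u1 n : R := \int[m]_(x in D') (Xn n x - X x).
have cl : (fun _ : nat => l) @ \oo --> l by exact: cvg_cst.
have H2 : (fun n => u1 n + l) @ \oo --> (0 + l : R) by exact: cvgD H cl.
rewrite add0r in H2.
have E' : (fun n => \int[m]_(x in D') Xn n x) = (fun n => u1 n + l) by exact/funext.
by rewrite E'.
Unshelve. all: by end_near. Qed.

End passing_to_limit.

Section green_trace.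
Context (R : realType).
Variables (O : set (plane R)) (T : mesh R).
Hypotheses (oO : open O) (bO : bounded_set O) (lipO : lipschitz_boundary O) (hT : triangulation O T).
Variables (c : {ffun 'I_(ncell T) -> plane R * R}) (dc : plane R -> R).
Hypothesis hc : inRT0 O c dc.
Variable (s : {measure set (mplane R) -> \bar R}).
Hypothesis hs : is_arclength O s.
Implicit Types (i j : 'I_(ncell T)) (x y z : plane R) (w : plane R -> R).
Let D0 := nondeg hT.
Let mO' := measurable_domain oO.

Lemma face_segment i k : face i (~: [set k])%SET = segment (vert i (k + 1)) (vert i (k + 2%:R)).
Proof.
rewrite segmentE; apply/seteqP; split => x; last first.
  by move=> [t /= /[!in_itv]/= t01 <-]; exact: (edge_pt_face hT).
move=> /(faceP hT)[b0 bk]; have {}bk : bary (vert i) k x = 0 by apply: bk; rewrite !inE eqxx.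
have bs := bary_sum x (D0 i); rewrite (sumI3k _ k) bk add0r in bs.
exists (bary (vert i) (k + 2%:R) x) => /=.
  rewrite in_itv /= b0 -bs lerDr; exact: b0.
rewrite [RHS](bary_comb x (D0 i)) (sumI3k _ k) bk scale0r add0r.
by rewrite /pt -bs addrK.
Qed.

Lemma outer_normalE i k (y : plane R) :
  dot y (outer_normal i k) = (enorm (vert i (k + 2%:R) - vert i (k + 1)))^-1 * dot y (tnormal (vert i) k).
Proof.
have E : cross (vert i (k + 2%:R) - vert i (k + 1)) (vert i k - vert i (k + 1)) = tdet (vert i).
  by move: k; apply: I3_ind; rewrite !addI3E /tdet /orient /cross /=; ring.
by rewrite /outer_normal /tnormal /= E /dot /= /GRing.scale /=; ring.
Qed.

Lemma enorm_edge_neq0 i k : enorm (vert i (k + 2%:R) - vert i (k + 1)) != 0.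
Proof.
apply: contra_neq (edge_neq0 hT i k) => E.
have := le_fst_enorm (vert i (k + 2%:R) - vert i (k + 1)).
have := le_snd_enorm (vert i (k + 2%:R) - vert i (k + 1)).
rewrite E !normr_le0 => /eqP h2 /eqP h1.
by case: (_ - _) h1 h2 => ? ? /= -> ->.
Qed.

Lemma bdry_term i k w : bdry_edge O i k -> smooth w ->
  \int[s]_(x in face i (~: [set k])%SET) (dot (rtpoly (c i) x) (outer_normal i k) * w x) =
  eflux (vert i) k (c i) w.
Proof.
move=> /asboolP bk sw; rewrite face_segment in bk *.
have ab : vert i (k + 1) != vert i (k + 2%:R).
  by have := edge_neq0 hT i k; rewrite subr_eq0 eq_sym.
have sn := smoothM (smooth_dot_normal (vert i) k (c i)) sw.
have cn := smooth_continuous (smoothM (smooth_cst (enorm (vert i (k + 2%:R) - vert i (k + 1)))^-1) sn).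
under eq_Rintegral do rewrite outer_normalE -mulrA.
rewrite (arclength_Rintegral hs ab bk cn) /eflux.
have -> : seg_int (fun x => (enorm (vert i (k + 2%:R) - vert i (k + 1)))^-1 *
    (dot (rtpoly (c i) x) (tnormal (vert i) k) * w x)) (vert i (k + 1)) (vert i (k + 2%:R)) =
  (enorm (vert i (k + 2%:R) - vert i (k + 1)))^-1 * eflux (vert i) k (c i) w.
  rewrite /eflux /seg_int RintegralZl//.
  apply: continuous_integrable01.
  by have := @continuous_fpt R _ (vert i (k + 1)) (vert i (k + 2%:R)) (smooth_continuous sn).
by rewrite mulrA mulfV ?mul1r ?enorm_edge_neq0.
Qed.

Variables (p : R) (u : plane R -> R) (du : plane R -> plane R) (g : plane R -> R).
Hypotheses (p1 : 1 < p) (hu : inW1p O p u du) (htr : has_trace O s p u du g)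
  (hg : inLp s (boundary O) p%:E g).
Let p0 : 0 < p := lt_trans ltr01 p1.
Let q := p / (p - 1).

Lemma conj_gt0 : 0 < q.
Proof. by rewrite /q divr_gt0// subr_gt0. Qed.

Lemma conj_exp : p^-1 + q^-1 = 1.
Proof.
by rewrite /q; field; rewrite subr_eq0 !gt_eqF.
Qed.

Let Ofin : (leb2 R O < +oo)%E := leb2_bounded_fin bO mO'.

Lemma integrable_u : (leb2 R).-integrable O (EFin \o u : mplane R -> \bar R).
Proof. by have [h _ _] := hu; apply: Lp_integrable h => //; exact: ltW. Qed.

Lemma integrable_du1 : (leb2 R).-integrable O (EFin \o (fun x => (du x).1) : mplane R -> \bar R).
Proof. by have [_ [h _] _] := hu; apply: Lp_integrable h => //; exact: ltW. Qed.

Lemma integrable_du2 : (leb2 R).-integrable O (EFin \o (fun x => (du x).2) : mplane R -> \bar R).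
Proof. by have [_ [_ h] _] := hu; apply: Lp_integrable h => //; exact: ltW. Qed.

Lemma integrable_rt_du i :
  (leb2 R).-integrable (cell i) (EFin \o (fun x => dot (rtpoly (c i) x) (du x)) : mplane R -> \bar R).
Proof.
have mi := measurable_cell hT i.
have i1 := integrable_cell oO lipO hT i
  (integrable_mul_cont mO' bO integrable_du1 (smooth_continuous (smooth_rt1 (c i)))).
have i2 := integrable_cell oO lipO hT i
  (integrable_mul_cont mO' bO integrable_du2 (smooth_continuous (smooth_rt2 (c i)))).
have := integrableD mi i1 i2.
apply: eq_integrable => // x _.
rewrite -[LHS]/((du x).1 * (rtpoly (c i) x).1 + (du x).2 * (rtpoly (c i) x).2)%:E.
by congr EFin; rewrite /dot mulrC; congr (_ + _); exact: mulrC.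
Qed.

(** Both sides of [green_smooth] for w = w_n converge, the triangle terms by the
    convergence of w_n and of its gradient in L^p of O, and the edge terms by the
    convergence of w_n to g in L^p of the boundary. *)
Theorem green_trace :
  \sum_(i < ncell T) (\int[leb2 R]_(x in cell i) dot (rtpoly (c i) x) (du x) +
     \int[leb2 R]_(x in cell i) (2 * (c i).2 * u x)) = bdry_pairing O s c g.
Proof.
have [w [sw wu wdu wg]] := htr.
have [M M0 OM] := bounded_sub_box bO.
have mi i := measurable_cell hT i.
have cO i : cell i `<=` O := @cell_sub _ _ _ lipO hT i.
have cfin i : (leb2 R (cell i) < +oo)%E.
  by apply: le_lt_trans Ofin; apply: le_measure => //; rewrite inE.
have [[mu _] [[mdu1 _] [mdu2 _]] _] := hu.
have mw n (D : set (plane R)) (h : plane R -> R) : continuous h -> measurable_fun D (h : mplane R -> R).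
  by move=> ch; apply: measurable_funS (plane_continuous_measurable ch).
have cd1 n : continuous (d1 (w n)) by have [] := smooth_C1x (sw n).
have cd2 n : continuous (d2 (w n)) by have [] := smooth_C1y (sw n).
have L1 i : \int[leb2 R]_(x in cell i) dot (rtpoly (c i) x) (grad (w n) x) @[n --> \oo] -->
    \int[leb2 R]_(x in cell i) dot (rtpoly (c i) x) (du x).
  have [C1 C10 HC1] := continuous_bounded_box M (smooth_continuous (smooth_rt1 (c i))).
  have [C2 C20 HC2] := continuous_bounded_box M (smooth_continuous (smooth_rt2 (c i))).
  apply: (@Rintegral_cvg R (leb2 R) O (cell i) p q (C1 + C2) _ _
    (fun n x => enorm (grad (w n) x - du x)) mO' (mi i) (cO i) (cfin i) p0 conj_gt0 conj_exp).
  - by rewrite addr_ge0// ltW.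
  - move=> n; apply: measurable_enorm; apply: measurable_funB => //.
      exact: mw (cd1 n).
    exact: mw (cd2 n).
  - by move=> n; apply: integrable_cont_cell hT _ _ _; exact: continuous_dot_rt.
  - exact: integrable_rt_du.
  - move=> n x /cO/OM bx.
    have -> : dot (rtpoly (c i) x) (grad (w n) x) - dot (rtpoly (c i) x) (du x) =
      (rtpoly (c i) x).1 * (grad (w n) x - du x).1 + (rtpoly (c i) x).2 * (grad (w n) x - du x).2.
      by rewrite /dot /=; ring.
    rewrite (ger0_norm (enorm_ge0 _)) [leRHS]mulrDl; apply: (le_trans (ler_normD _ _)).
    apply: lerD; rewrite normrM; apply: ler_pM => //.
    - exact: HC1.
    - exact: le_fst_enorm.
    - exact: HC2.
    - exact: le_snd_enorm.
  - exact: wdu.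
have L2 i : \int[leb2 R]_(x in cell i) (2 * (c i).2 * w n x) @[n --> \oo] -->
    \int[leb2 R]_(x in cell i) (2 * (c i).2 * u x).
  apply: (@Rintegral_cvg R (leb2 R) O (cell i) p q `|2 * (c i).2| _ _
    (fun n x => w n x - u x) mO' (mi i) (cO i) (cfin i) p0 conj_gt0 conj_exp) => //.
  - by move=> n; apply: measurable_funB => //; apply: mw; exact: smooth_continuous.
  - move=> n; apply: integrable_cont_cell hT _ _ _.
    exact: smooth_continuous (smoothM (smooth_cst _) (sw n)).
  - exact: (integrableZl (mi i) _ (integrable_cell oO lipO hT i integrable_u)).
  - by move=> n x _; rewrite -mulrBr normrM.
have mbd : measurable (boundary O : set (mplane R)).
  apply: measurableD; first by apply: measurable_closed; exact: closed_closure.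
  by apply: plane_open_measurable; exact: open_interior.
have [mg _] := hg.
have L3 i k : bdry_edge O i k -> eflux (vert i) k (c i) (w n) @[n --> \oo] -->
   \int[s]_(x in face i (~: [set k])%SET) (dot (rtpoly (c i) x) (outer_normal i k) * g x).
  move=> bk; have /asboolP bk' := bk.
  have mf : measurable (face i (~: [set k])%SET : set (mplane R)).
    by rewrite face_segment; apply: measurable_closed; exact: closed_segment.
  have ab : vert i (k + 1) != vert i (k + 2%:R).
    by have := edge_neq0 hT i k; rewrite subr_eq0 eq_sym.
  have ffin : (s (face i (~: [set k])%SET) < +oo)%E.
    by move: bk'; rewrite face_segment => sb; have H := arclength_segment_fin hs ab sb; exact: H.
  have bf : bounded_set (face i (~: [set k])%SET).
    rewrite face_segment; apply: compact_bounded; exact: compact_segment.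
  pose N x := dot (rtpoly (c i) x) (outer_normal i k).
  have cN : continuous N.
    have -> : N = fun x => (enorm (vert i (k + 2%:R) - vert i (k + 1)))^-1 *
        dot (rtpoly (c i) x) (tnormal (vert i) k).
      by apply/funext => x; exact: outer_normalE.
    exact: smooth_continuous (smoothM (smooth_cst _) (smooth_dot_normal (vert i) k (c i))).
  have [M' M'0 fM] := bounded_sub_box bf.
  have [C C0 HC] := continuous_bounded_box M' cN.
  have ig : s.-integrable (face i (~: [set k])%SET) (EFin \o g : mplane R -> \bar R).
    apply: (@Lp_integrable _ _ _ p) => //; first exact: ltW.
    split; first exact: measurable_funS mg.
    apply: le_lt_trans (hg.2); exact: LpnormS.
  have mN : measurable_fun (face i (~: [set k])%SET : set (mplane R)) (N : mplane R -> R).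
    exact: mw.
  have iN h : s.-integrable (face i (~: [set k])%SET) (EFin \o h : mplane R -> \bar R) ->
    s.-integrable (face i (~: [set k])%SET) (EFin \o (fun x => N x * h x) : mplane R -> \bar R).
    move=> ih; have := integrable_mul_bounded mf ih mN (fun x fx => HC x (fM x fx)).
    by apply: eq_integrable => // x _; rewrite /= mulrC.
  under eq_cvg do rewrite -bdry_term//.
  apply: (@Rintegral_cvg R s (boundary O) (face i (~: [set k])%SET) p q C
    (fun n x => N x * w n x) (fun x => N x * g x)
    (fun n x => w n x - g x) mbd mf bk' ffin p0 conj_gt0 conj_exp (ltW C0)).
  - by move=> n; apply: measurable_funB => //; apply: mw; exact: smooth_continuous.
  - move=> n; apply: iN; apply: measurable_bounded_integrable => //.
      by apply: mw; exact: smooth_continuous.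
    have [K K0 HK] := continuous_bounded_box M' (smooth_continuous (sw n)).
    exists K; split; first exact: num_real.
    by move=> r Kr x fx; apply: (le_trans (HK _ (fM _ fx))); exact: ltW.
  - exact: iN.
  - move=> n x fx; rewrite -mulrBr normrM ler_wpM2r//; exact: HC (fM _ fx).
  - exact: wg.
have LL : \sum_(i < ncell T) (\int[leb2 R]_(x in cell i) dot (rtpoly (c i) x) (grad (w n) x) +
     \int[leb2 R]_(x in cell i) (2 * (c i).2 * w n x)) @[n --> \oo] -->
   \sum_(i < ncell T) (\int[leb2 R]_(x in cell i) dot (rtpoly (c i) x) (du x) +
     \int[leb2 R]_(x in cell i) (2 * (c i).2 * u x)).
  by apply: cvg_finsum => i _; apply: cvgD; [exact: L1|exact: L2].
have LR : \sum_(i < ncell T) \sum_(k | bdry_edge O i k) eflux (vert i) k (c i) (w n) @[n --> \oo] -->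
   bdry_pairing O s c g.
  by apply: cvg_finsum => i _; apply: cvg_finsum => k bk; exact: L3.
apply: (cvg_unique (@Rhausdorff R) LL).
move: LR; under eq_cvg do rewrite -(green_smooth oO bO lipO hT hc)//.
by [].
Qed.

End green_trace.

(** * Elliptic two by two matrices *)

Section two_by_two.
Context (R : realType).
Implicit Types (M : 'M[R]_2) (x y : plane R).

Definition det2 M : R := M ord0 ord0 * M ord_max ord_max - M ord0 ord_max * M ord_max ord0.

Lemma sumI2 (V : nmodType) (F : 'I_2 -> V) : \sum_k F k = F ord0 + F ord_max.
Proof.
by rewrite !big_ord_recl big_ord0 addr0; congr (_ + F _); exact/val_inj.
Qed.

Lemma det2E M : \det M = det2 M.
Proof.
rewrite (expand_det_row _ ord0) sumI2 /cofactor !det_mx11 !mxE /det2 /=.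
rewrite expr0 expr1 mul1r mulN1r mulrN; congr (_ * M _ _ - _ * M _ _); exact/val_inj.
Qed.

Lemma mxv_mul (M N : 'M[R]_2) x : mxv (M *m N) x = mxv M (mxv N x).
Proof. by rewrite /mxv /= !mxE !sumI2; congr pair; ring. Qed.

Lemma mxv1 x : mxv 1%:M x = x.
Proof. by rewrite /mxv !mxE /= !mul1r !mul0r addr0 add0r; case: x. Qed.

Lemma mxvD M x y : mxv M (x + y) = mxv M x + mxv M y.
Proof. by rewrite /mxv /=; congr pair; rewrite /=; ring. Qed.

Lemma mxvN M x : mxv M (- x) = - mxv M x.
Proof. by rewrite /mxv /=; congr pair; rewrite /=; ring. Qed.

(** Cramer's rule, in a form valid for all matrices: the inverse of a singular
    matrix is the matrix itself, by convention.  It shows that the entries of the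
    inverse are measurable functions. *)
Lemma mxv_invmx M y : mxv (invmx M) y =
  if det2 M == 0 then mxv M y else
  ((det2 M)^-1 * (M ord_max ord_max * y.1 - M ord0 ord_max * y.2),
   (det2 M)^-1 * (M ord0 ord0 * y.2 - M ord_max ord0 * y.1)).
Proof.
case: ifPn => [d0|d0].
  by rewrite /invmx unitmxE det2E unitfE d0.
have uM : M \in unitmx by rewrite unitmxE det2E unitfE.
set z := (X in _ = X).
have -> : y = mxv M z.
  by rewrite /mxv /z /=; case: y z => y1 y2 z /=; congr pair; rewrite /det2 in d0 *; field.
by rewrite -mxv_mul mulVmx// mxv1.
Qed.

Definition elliptic alpha M := forall xi : plane R, alpha * enorm xi ^+ 2 <= dot xi (mxv M xi).

(** The kernel of an elliptic matrix is trivial, and a matrix with determinant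
    zero annihilates the vector (- M_12, M_11). *)
Lemma elliptic_unit alpha M : 0 < alpha -> elliptic alpha M -> M \in unitmx.
Proof.
move=> a0 eM; rewrite unitmxE det2E unitfE; apply/eqP => d0.
have k (xi : plane R) : mxv M xi = 0 -> xi = 0.
  move=> E; have := eM xi; rewrite E /dot /= !mulr0 addr0 pmulr_rle0// enorm_sqr => h.
  have h1 : xi.1 ^+ 2 = 0 by apply/eqP; rewrite eq_le sqr_ge0 andbT (le_trans _ h)// lerDl sqr_ge0.
  have h2 : xi.2 ^+ 2 = 0 by apply/eqP; rewrite eq_le sqr_ge0 andbT (le_trans _ h)// lerDr sqr_ge0.
  by move/eqP: h1; move/eqP: h2; rewrite !expf_eq0 /= => /eqP + /eqP; case: xi {E h} => ? ? /= -> ->.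
have [e1 e2] : M ord0 ord0 = 0 /\ M ord0 ord_max = 0.
  have E : mxv M (- M ord0 ord_max, M ord0 ord0) = 0.
    by rewrite /mxv /=; congr pair; rewrite /det2 in d0; [ring|rewrite -[RHS]d0; ring].
  have K := k _ E; have := congr1 fst K; have := congr1 snd K => /= h1 h2.
  by split => //; apply/eqP; rewrite -oppr_eq0 h2.
have := eM (1, 0); rewrite enorm_sqr /dot /mxv /= e1 e2.
rewrite !(mul0r, mul1r, mulr0, mulr1, add0r, addr0, expr1n, expr0n) /= => h.
by move: h; rewrite ?addr0 ?mulr1 leNgt a0.
Qed.

(** With z := M^-1 y, ellipticity gives alpha |z|^2 <= z . y <= |z| |y|. *)
Lemma elliptic_inv_le alpha M y : 0 < alpha -> elliptic alpha M ->
  enorm (mxv (invmx M) y) <= alpha^-1 * enorm y.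
Proof.
move=> a0 eM; have uM := elliptic_unit a0 eM.
set z := mxv _ _.
have yE : y = mxv M z by rewrite /z -mxv_mul mulmxV// mxv1.
have h : alpha * enorm z ^+ 2 <= enorm z * enorm y.
  by apply: (le_trans (eM z)); rewrite -yE (le_trans (ler_norm _))// dot_le_enorm.
have [z0|z0] := eqVneq (enorm z) 0.
  by rewrite z0 mulr_ge0 ?enorm_ge0// invr_ge0 ltW.
have zp : 0 < enorm z by rewrite lt0r z0 enorm_ge0.
by rewrite ler_pdivlMl// -(ler_pM2l zp) mulrCA -expr2.
Qed.

End two_by_two.

Section inverse_measurable.
Context (R : realType).
Variable D : set (plane R).
Local Notation mfun f := (measurable_fun D (f : mplane R -> R)).

Lemma measurable_invr : measurable_fun [set: R] (fun t : R => t^-1).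
Proof.
have -> : (fun t : R => t^-1) = (fun t => t * ((`|t| `^ (-1)) * (`|t| `^ (-1)))).
  apply/funext => t; rewrite powR_inv1// -invfM -expr2 real_normK ?num_real//.
  by have [->|t0] := eqVneq t 0; [rewrite invr0 mul0r|field].
have m : measurable_fun [set: R] (fun t : R => `|t| `^ (-1)).
  apply: (@measurableT_comp _ _ _ _ _ _ (fun t : R => t `^ (-1))) => //.
by apply: measurable_funM => //; exact: measurable_funM.
Qed.

Lemma measurable_inv_fun (f : plane R -> R) : mfun f -> mfun (fun x => (f x)^-1).
Proof. by move=> mf; apply: (measurableT_comp measurable_invr). Qed.

Lemma measurable_eq0 (f : plane R -> R) : mfun f -> mfun (fun x => (f x == 0)%:R).
Proof.
move=> mf.
suff m0 : measurable_fun [set: R] (fun t : R => (t == 0)%:R : R) by exact: (measurableT_comp m0 mf).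
have -> : (fun t : R => (t == 0)%:R) = \1_[set 0] :> (R -> R).
  apply/funext => t; rewrite indicE; congr (_%:R); congr nat_of_bool.
  by apply/eqP/idP; rewrite inE.
by apply: measurable_indic; exact: measurable_set1.
Qed.

Lemma measurable_mxv (A : plane R -> 'M[R]_2) (F : plane R -> plane R) :
  (forall i j, mfun (fun x => A x i j)) -> mfun (fun x => (F x).1) -> mfun (fun x => (F x).2) ->
  mfun (fun x => (mxv (A x) (F x)).1) /\ mfun (fun x => (mxv (A x) (F x)).2).
Proof. by move=> measurable_coef m1 m2; split; apply: measurable_funD; apply: measurable_funM. Qed.

Lemma measurable_mxv_inv (A : plane R -> 'M[R]_2) (F : plane R -> plane R) :
  (forall i j, mfun (fun x => A x i j)) -> mfun (fun x => (F x).1) -> mfun (fun x => (F x).2) ->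
  mfun (fun x => (mxv (invmx (A x)) (F x)).1) /\ mfun (fun x => (mxv (invmx (A x)) (F x)).2).
Proof.
move=> measurable_coef m1 m2; have [m3 m4] := measurable_mxv measurable_coef m1 m2.
have md : mfun (fun x => det2 (A x)).
  by apply: measurable_funB; apply: measurable_funM.
pose z x : R := (det2 (A x) == 0)%:R.
pose c1 x := A x ord_max ord_max * (F x).1 - A x ord0 ord_max * (F x).2.
pose c2 x := A x ord0 ord0 * (F x).2 - A x ord_max ord0 * (F x).1.
have mz : mfun z by exact: measurable_eq0.
have mi := measurable_inv_fun md.
have E (x : plane R) : mxv (invmx (A x)) (F x) =
   (z x * (mxv (A x) (F x)).1 + (det2 (A x))^-1 * c1 x,
    z x * (mxv (A x) (F x)).2 + (det2 (A x))^-1 * c2 x).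
  rewrite mxv_invmx /z; case: ifP => [/eqP ->|_]; last by rewrite !mul0r !add0r.
  by rewrite invr0 !mul0r !addr0 !mul1r; case: (mxv _ _).
split.
- rewrite (_ : (fun x => _) = (fun x => z x * (mxv (A x) (F x)).1 + (det2 (A x))^-1 * c1 x)).
    apply: measurable_funD; apply: measurable_funM => //.
    by apply: measurable_funB; apply: measurable_funM.
  by apply/funext => x; rewrite E.
- rewrite (_ : (fun x => _) = (fun x => z x * (mxv (A x) (F x)).2 + (det2 (A x))^-1 * c2 x)).
    apply: measurable_funD; apply: measurable_funM => //.
    by apply: measurable_funB; apply: measurable_funM.
  by apply/funext => x; rewrite E.
Qed.

End inverse_measurable.

(** * Piecewise constant functions *)

Section lpnorm.
Context (R : realType).
Variable m : {measure set (mplane R) -> \bar R}.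
Implicit Types (D : set (plane R)) (f g : plane R -> R) (p : R).

Lemma le_Lpnorm D p f g : 0 < p -> measurable (D : set (mplane R)) ->
  (\int[m]_(x in D) ((`|f x| `^ p)%R)%:E <= \int[m]_(x in D) ((`|g x| `^ p)%R)%:E)%E ->
  (Lpnorm m D p%:E f <= Lpnorm m D p%:E g)%E.
Proof.
move=> p0 mD; rewrite -!Lpnorm_integral// => H.
have pV0 : 0 <= p^-1 by rewrite invr_ge0 ltW.
rewrite -[leLHS](@poweRe1 _ _ (Lnorm_ge0 _ _ _)) -[leRHS](@poweRe1 _ _ (Lnorm_ge0 _ _ _)).
have -> : (1 : R) = p * p^-1 by rewrite mulfV ?gt_eqF.
by rewrite !poweRrM; apply: gt0_ler_poweR => //; rewrite in_itv /= poweR_ge0 leey.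
Qed.

Lemma eq_Lpnorm D (p : \bar R) f g : (forall x, D x -> f x = g x) ->
  Lpnorm m D p f = Lpnorm m D p g.
Proof.
move=> fg; rewrite /Lpnorm; congr (Lnorm _ _ (EFin \o _)); apply/funext => x.
by rewrite /patch; case: ifPn => // /set_mem /fg.
Qed.

Lemma Lpnorm_bounded_fin D p f C : 0 < p -> measurable (D : set (mplane R)) -> (m D < +oo)%E ->
  measurable_fun D (f : mplane R -> R) ->
  (forall x, D x -> `|f x| <= C) -> (Lpnorm m D p%:E f < +oo)%E.
Proof.
move=> p0 mD Dfin mf fC; apply: (@lty_poweRy _ _ p); first by rewrite gt_eqF.
rewrite Lpnorm_integral//.
apply: (@le_lt_trans _ _ (\int[m]_(x in D) ((C `^ p)%:E))%E).
  apply: ge0_le_integral => //.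
  - apply/measurable_EFinP; apply: (@measurableT_comp _ _ _ _ _ _ (fun t : R => t `^ p)) => //.
    exact: measurableT_comp.
  - move=> x Dx; rewrite lee_fin; have fx := fC x Dx.
    have C0 : 0 <= C by apply: le_trans fx.
    by apply: (ge0_ler_powR (ltW p0)); rewrite ?nnegrE.
by rewrite integral_cst// lte_mul_pinfty// lee_fin powR_ge0.
Qed.

End lpnorm.

Lemma enorm_le_sum (R : realType) (y : plane R) : enorm y <= `|y.1| + `|y.2|.
Proof.
rewrite -(@ler_pXn2r _ 2)// ?nnegrE ?enorm_ge0 ?addr_ge0// enorm_sqr sqrrD !real_normK ?num_real//.
by rewrite addrAC lerDl mulrn_wge0// mulr_ge0.
Qed.

Section discrete_functions.
Context (R : realType).
Variables (O : set (plane R)) (T : mesh R).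
Hypotheses (oO : open O) (bO : bounded_set O) (lipO : lipschitz_boundary O) (hT : triangulation O T).
Implicit Types (i j : 'I_(ncell T)) (x y z : plane R) (v : {ffun 'I_(ncell T) -> R}).
Let mO' := measurable_domain oO.
Let Ofin : (leb2 R O < +oo)%E := leb2_bounded_fin bO mO'.
Let mi i : measurable (cell i : set (mplane R)) := measurable_cell hT i.

Lemma measurable_P0fun v D : measurable_fun D (P0fun v : mplane R -> R).
Proof.
apply: (@measurable_funS _ _ _ _ setT) => //.
rewrite /P0fun; apply: measurable_sum => i.
by apply: measurable_funM => //; apply: measurable_indic; exact: mi.
Qed.

Lemma P0fun_bounded v : exists C, forall x, `|P0fun v x| <= C.
Proof.
exists (\sum_i `|v i|) => x; rewrite /P0fun (le_trans (ler_norm_sum _ _ _))//.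
apply: ler_sum => i _; rewrite normrM ler_piMr// indicE.
by case: (_ \in _); rewrite ?normr1 ?normr0.
Qed.

Lemma P0funB v1 v2 x : P0fun (v1 - v2) x = P0fun v1 x - P0fun v2 x.
Proof.
rewrite /P0fun -sumrB; apply: eq_bigr => i _.
by rewrite !ffunE mulrBl.
Qed.

Lemma integrable_mul_P0 (h : plane R -> R) v :
  (leb2 R).-integrable O (EFin \o h : mplane R -> \bar R) ->
  (leb2 R).-integrable O (EFin \o (fun x => h x * P0fun v x) : mplane R -> \bar R).
Proof.
move=> ih; have [C HC] := P0fun_bounded v.
by apply: (@integrable_mul_bounded _ _ _ _ _ C) => //; exact: measurable_P0fun.
Qed.

Lemma integrable_P0fun v : (leb2 R).-integrable O (EFin \o P0fun v : mplane R -> \bar R).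
Proof.
apply: (measurable_bounded_integrable mO' Ofin (@measurable_P0fun v O)).
have [C HC] := P0fun_bounded v; exists C; split; first exact: num_real.
by move=> r Cr x _; apply: (le_trans (HC x)); exact: ltW.
Qed.

Lemma Rint_mul_P0 (h : plane R -> R) v :
  (leb2 R).-integrable O (EFin \o h : mplane R -> \bar R) ->
  \int[leb2 R]_(x in O) (h x * P0fun v x) = \sum_(i < ncell T) \int[leb2 R]_(x in cell i) h x * v i.
Proof.
move=> ih; rewrite (Rint_cells oO lipO hT (integrable_mul_P0 v ih)).
apply: eq_bigr => i _; have ihi := integrable_cell oO lipO hT i ih.
rewrite -(RintegralZr (v i) (mi i) ihi).
by apply: eq_Rintegral => x; rewrite inE => cx; rewrite (P0fun_cell hT _ cx).
Qed.

(** The mean value is a quotient by the area; when that is zero both sides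
    vanish. *)
Lemma Qh_mean (h : plane R -> R) i :
  (leb2 R).-integrable O (EFin \o h : mplane R -> \bar R) ->
  fine (leb2 R (cell i)) * Qh T h i = \int[leb2 R]_(x in cell i) h x.
Proof.
move=> ih; rewrite /Qh ffunE.
have [E|E] := eqVneq (fine (leb2 R (cell i))) 0; last by rewrite mulrA mulfV// mul1r.
rewrite E mul0r.
have c0 : leb2 R (cell i) = 0%E.
  rewrite -[LHS]fineK ?E// ge0_fin_numE//; apply: le_lt_trans Ofin.
  by apply: le_measure; rewrite ?inE//; exact: cell_sub lipO hT i.
have mh := measurable_int _ (integrable_cell oO lipO hT i ih).
by rewrite /Rintegral (null_set_integral (mi i) mh c0).
Qed.

Lemma Qh_orthogonal (h : plane R -> R) v :
  (leb2 R).-integrable O (EFin \o h : mplane R -> \bar R) ->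
  \int[leb2 R]_(x in O) ((h x - P0fun (Qh T h) x) * P0fun v x) = 0.
Proof.
move=> ih.
have iP := integrable_P0fun.
rewrite Rint_mul_P0; last exact: (integrableB mO' ih (iP _)).
rewrite big1// => i _.
have ihi := integrable_cell oO lipO hT i ih; have ipi := integrable_cell oO lipO hT i (iP (Qh T h)).
rewrite (RintegralB (mi i) ihi ipi).
have -> : \int[leb2 R]_(x in cell i) P0fun (Qh T h) x = Qh T h i * fine (leb2 R (cell i)).
  rewrite -(Rintegral_cst _ (mi i)); apply: eq_Rintegral => x; rewrite inE => cx.
  by rewrite (P0fun_cell hT _ cx).
by rewrite -(Qh_mean i ih) [X in X - _]mulrC subrr mul0r.
Qed.

(** Pythagoras.  If the right-hand side is finite, h - v is square integrable,
    and its square norm is the sum of those of h - Q_h h and Q_h h - v, by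
    orthogonality. *)
Lemma Qh_best (h : plane R -> R) v :
  (leb2 R).-integrable O (EFin \o h : mplane R -> \bar R) ->
  (Lpnorm (leb2 R) O 2%:E (fun x => h x - P0fun (Qh T h) x)%R <=
   Lpnorm (leb2 R) O 2%:E (fun x => h x - P0fun v x)%R)%E.
Proof.
move=> ih.
have [->|fin] := eqVneq (Lpnorm (leb2 R) O 2%:E (fun x => (h x - P0fun v x)%R)) +oo%E; first exact: leey.
have {}fin : (Lpnorm (leb2 R) O 2%:E (fun x => (h x - P0fun v x)%R) < +oo)%E by rewrite ltey.
apply: (le_Lpnorm _ mO'); first by rewrite ltr0n.
pose e x := h x - P0fun v x; pose d x := P0fun (v - Qh T h) x.
have ed x : h x - P0fun (Qh T h) x = e x + d x by rewrite /e /d P0funB; ring.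
have sq (t : R) : `|t| `^ 2 = t * t.
  by rewrite powR_mulrn// real_normK ?num_real// expr2.
under eq_integral do rewrite sq ed.
under [leRHS]eq_integral do rewrite sq -/(e _).
have mh : measurable_fun O (h : mplane R -> R) by apply/measurable_EFinP; exact: measurable_int ih.
have me : measurable_fun O (e : mplane R -> R) by apply: measurable_funB => //; exact: measurable_P0fun.
have iee : (leb2 R).-integrable O (EFin \o (fun x => e x * e x) : mplane R -> \bar R).
  apply/integrableP; split; first by apply/measurable_EFinP; exact: measurable_funM.
  have := Lpnorm_fin (ltr0n R 2) mO' fin.
  under eq_integral do rewrite sq -/(e _).
  move=> H; apply: le_lt_trans H; rewrite le_eqVlt; apply/orP; left; apply/eqP.
  by apply: eq_integral => x _; rewrite /= ger0_norm// -expr2 sqr_ge0.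
have ie : (leb2 R).-integrable O (EFin \o e : mplane R -> \bar R).
  by apply: (@Lp_integrable _ _ _ 2) => //; rewrite ler1n.
have ied : (leb2 R).-integrable O (EFin \o (fun x => e x * d x) : mplane R -> \bar R).
  exact: integrable_mul_P0.
have id := integrable_P0fun (v - Qh T h).
have idd : (leb2 R).-integrable O (EFin \o (fun x => d x * d x) : mplane R -> \bar R).
  exact: integrable_mul_P0.
have orth : \int[leb2 R]_(x in O) (e x * d x) + \int[leb2 R]_(x in O) (d x * d x) = 0.
  rewrite -RintegralD// -[RHS](Qh_orthogonal (v - Qh T h) ih).
  by apply: eq_Rintegral => x _; rewrite ed -/(d x); ring.
have E : \int[leb2 R]_(x in O) ((e x + d x) * (e x + d x)) =
   \int[leb2 R]_(x in O) (e x * e x) - \int[leb2 R]_(x in O) (d x * d x).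
  transitivity (\int[leb2 R]_(x in O) ((e x * e x + e x * d x) + (e x * d x + d x * d x))).
    by apply: eq_Rintegral => x _; ring.
  rewrite RintegralD//; [|exact: (integrableD mO' iee ied)|exact: (integrableD mO' ied idd)].
  rewrite RintegralD// RintegralD// orth addr0; congr (_ + _).
  by apply/eqP; rewrite -subr_eq0 opprK orth.
have iD : (leb2 R).-integrable O (EFin \o (fun x => (e x + d x) * (e x + d x)) : mplane R -> \bar R).
  have := integrableD mO' (integrableD mO' iee ied) (integrableD mO' ied idd).
  by apply: eq_integrable => // x _; rewrite /= -!EFinD; congr EFin; ring.
rewrite -(@fineK _ (\int[leb2 R]_(x in O) ((e x + d x) * (e x + d x))%:E)%E); last exact: integrable_fin_num.
rewrite -(@fineK _ (\int[leb2 R]_(x in O) (e x * e x)%:E)%E); last exact: integrable_fin_num.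
rewrite lee_fin -/(Rintegral _ _ _) E gerBl Rintegral_ge0// => x _.
by rewrite -expr2 sqr_ge0.
Qed.

Variable (c : {ffun 'I_(ncell T) -> plane R * R}).

Lemma RT_bounded : exists2 C, 0 <= C & forall x, O x -> enorm (RTfun c x) <= C.
Proof.
have [M M0 OM] := bounded_sub_box bO.
have H i : exists C, 0 <= C /\ forall x, O x -> enorm (rtpoly (c i) x) <= C.
  have [C1 C10 HC1] := continuous_bounded_box M (smooth_continuous (smooth_rt1 (c i))).
  have [C2 C20 HC2] := continuous_bounded_box M (smooth_continuous (smooth_rt2 (c i))).
  exists (C1 + C2); split=> [|x /OM bx]; first by rewrite addr_ge0// ltW.
  apply: (le_trans (enorm_le_sum _)); apply: lerD; [exact: HC1|exact: HC2].
pose C i := projT1 (cid (H i)).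
have HC i : 0 <= C i /\ forall x, O x -> enorm (rtpoly (c i) x) <= C i by exact: projT2 (cid (H i)).
exists (\sum_i C i) => [|x Ox]; first by apply: sumr_ge0 => i _; case: (HC i).
have [[i cx]|ncx] := pselect (exists i, cell i x).
  rewrite (RTfun_cell hT _ cx) (bigD1 i)//=; have [_ h] := HC i.
  rewrite (le_trans (h _ Ox))// lerDl sumr_ge0// => j _; by case: (HC j).
rewrite (_ : RTfun c x = 0).
  rewrite /enorm /dot /= !mul0r addr0 sqrtr0.
  by apply: sumr_ge0 => i _; case: (HC i).
rewrite /RTfun big1// => i _; rewrite indicE memNset ?scale0r// => cx.
by apply: ncx; exists i.
Qed.

End discrete_functions.

(** * The error identity *)

Lemma ae_imp (R : realType) (P Q : plane R -> Prop) : (forall x, P x -> Q x) ->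
  {ae leb2 R, forall x, P x} -> {ae leb2 R, forall x, Q x}.
Proof. by move=> PQ; apply: negligibleS => x nQ Px; apply: nQ; exact: PQ. Qed.

Section error_identity.
Context (R : realType).
Variables (O : set (plane R)) (T : mesh R).
Hypotheses (oO : open O) (bO : bounded_set O) (lipO : lipschitz_boundary O) (hT : triangulation O T).
Variables (s : {measure set (mplane R) -> \bar R}) (hs : is_arclength O s).
Variables (alpha beta : R) (a0 : 0 < alpha) (A : plane R -> 'M[R]_2) (hA : sym_elliptic O alpha beta A).
Variables (p : R) (p1 : 1 < p).
Variables (u : plane R -> R) (du : plane R -> plane R) (g : plane R -> R).
Hypotheses (hu : inW1p O p u du) (htr : has_trace O s p u du g) (hg : inLp s (boundary O) p%:E g).
Variable x0 : plane R.
Local Notation mfun f := (measurable_fun O (f : mplane R -> R)).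
Local Notation intO f := ((leb2 R).-integrable O (EFin \o f : mplane R -> \bar R)).
Let mO' := measurable_domain oO.
Let Ofin : (leb2 R O < +oo)%E := leb2_bounded_fin bO mO'.
Let q := p / (p - 1).
Let p0 : 0 < p := lt_trans ltr01 p1.

Lemma measurable_coef i j : mfun (fun x => A x i j).
Proof. by have [h _ _] := hA; have [] := h i j. Qed.

Lemma ae_elliptic : {ae leb2 R, forall x, O x -> elliptic alpha (A x)}.
Proof.
have [_ _ h] := hA; apply: ae_imp h => x h Ox xi.
by have /andP[] := h Ox xi.
Qed.

Definition Ainv (F : plane R -> plane R) (x : plane R) : plane R := mxv (invmx (A x)) (F x).

Lemma measurable_Ainv F : mfun (fun x => (F x).1) -> mfun (fun x => (F x).2) ->
  mfun (fun x => (Ainv F x).1) /\ mfun (fun x => (Ainv F x).2).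
Proof. by move=> m1 m2; apply: (measurable_mxv_inv measurable_coef m1 m2). Qed.

Lemma integrable_ae_le (f h : plane R -> R) : mfun f -> intO h -> (forall x, 0 <= h x) ->
  {ae leb2 R, forall x, O x -> `|f x| <= h x} -> intO f.
Proof.
move=> mf ih h0 fh; apply/integrableP; split; first exact/measurable_EFinP.
have mh := measurable_int _ ih.
have hfin : (\int[leb2 R]_(x in O) (h x)%:E < +oo)%E.
  by have := integrable_fin_num mO' ih; rewrite fin_numE ltey => /andP[].
apply: le_lt_trans hfin; apply: ae_ge0_le_integral => //.
- by apply: measurableT_comp => //; exact/measurable_EFinP.
- by move=> x _; rewrite lee_fin.
Qed.

Lemma integrable_Ainv F : mfun (fun x => (F x).1) -> mfun (fun x => (F x).2) ->
  intO (fun x => enorm (F x)) ->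
  intO (fun x => (Ainv F x).1) /\ intO (fun x => (Ainv F x).2).
Proof.
move=> m1 m2 iF; have [m3 m4] := measurable_Ainv m1 m2.
have iF' : intO (fun x => alpha^-1 * enorm (F x)) by exact: (integrableZl mO' _ iF).
have h0 x : 0 <= alpha^-1 * enorm (F x).
  by rewrite mulr_ge0 ?enorm_ge0// invr_ge0 ltW.
split; apply: (integrable_ae_le _ iF' h0) => //.
- apply: ae_imp ae_elliptic => x eA Ox; apply: (le_trans (le_fst_enorm _)).
  exact: elliptic_inv_le a0 (eA Ox).
- apply: ae_imp ae_elliptic => x eA Ox; apply: (le_trans (le_snd_enorm _)).
  exact: elliptic_inv_le a0 (eA Ox).
Qed.

Section test_field.
Variables (c : {ffun 'I_(ncell T) -> plane R * R}) (dc : plane R -> R).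
Hypothesis hc : inRT0 O c dc.

Lemma measurable_RT : mfun (fun x => (RTfun c x).1) /\ mfun (fun x => (RTfun c x).2).
Proof. by have [[[h1 _] [h2 _]] _ _] := hc. Qed.

Lemma integrable_dot_RT F : intO (fun x => (F x).1) -> intO (fun x => (F x).2) ->
  intO (fun x => dot (F x) (RTfun c x)).
Proof.
move=> i1 i2; have [m1 m2] := measurable_RT; have [C C0 HC] := RT_bounded bO hT c.
have b1 x : O x -> `|(RTfun c x).1| <= C by move=> /HC; apply: le_trans; exact: le_fst_enorm.
have b2 x : O x -> `|(RTfun c x).2| <= C by move=> /HC; apply: le_trans; exact: le_snd_enorm.
have j1 := integrable_mul_bounded mO' i1 m1 b1.
have j2 := integrable_mul_bounded mO' i2 m2 b2.
exact: (integrableD mO' j1 j2).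
Qed.

Lemma integrable_enorm_RT : intO (fun x => enorm (RTfun c x)).
Proof.
have [m1 m2] := measurable_RT; have [C C0 HC] := RT_bounded bO hT c.
apply: (measurable_bounded_integrable mO' Ofin (measurable_enorm m1 m2)).
exists C; split; first exact: num_real.
by move=> r Cr x Ox; rewrite /= ger0_norm ?enorm_ge0//; apply: (le_trans (HC x Ox)); exact: ltW.
Qed.

Lemma int_du_RT : \int[leb2 R]_(x in O) dot (du x) (RTfun c x) =
  \sum_(i < ncell T) \int[leb2 R]_(x in cell i) dot (rtpoly (c i) x) (du x).
Proof.
have i1 := integrable_du1 oO bO p1 hu; have i2 := integrable_du2 oO bO p1 hu.
rewrite (Rint_cells oO lipO hT (integrable_dot_RT i1 i2)).
apply: eq_bigr => i _; apply: eq_Rintegral => x; rewrite inE => cx.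
by rewrite (RTfun_cell hT _ cx) /dot mulrC; congr (_ + _); rewrite mulrC.
Qed.

(** The integral of the divergence over a triangle K is 2 b |K| by [cell_div] with
    w = 1, and |K| times the value of Q_h u on K is the integral of u. *)
Lemma int_div_Qh : \int[leb2 R]_(x in O) (dc x * P0fun (Qh T u) x) =
  \sum_(i < ncell T) \int[leb2 R]_(x in cell i) (2 * (c i).2 * u x).
Proof.
have iu := integrable_u oO bO p1 hu.
rewrite (Rint_mul_P0 oO lipO hT (Qh T u) (integrable_dc oO bO hc)).
apply: eq_bigr => i _.
have := cell_div oO bO lipO hT hc i (smooth_cst 1).
under eq_Rintegral do rewrite mulr1.
under [in RHS]eq_Rintegral do rewrite mulr1.
move=> ->; rewrite Rintegral_cst; last exact: measurable_cell hT i.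
have iui := integrable_cell oO lipO hT i iu.
rewrite (RintegralZl _ (measurable_cell hT i) iui) -(Qh_mean oO bO lipO hT i iu).
by ring.
Qed.

Lemma green_RT : (\int[leb2 R]_(x in O) dot (du x) (RTfun c x)) +
  \int[leb2 R]_(x in O) (dc x * P0fun (Qh T u) x) = bdry_pairing O s c g.
Proof.
rewrite int_du_RT int_div_Qh -big_split /=.
exact: (green_trace oO bO lipO hT hc hs p1 hu htr hg).
Qed.

End test_field.

Variables (f1 : plane R -> R) (sigma : {ffun 'I_(ncell T) -> plane R * R}) (uh : {ffun 'I_(ncell T) -> R}).
Hypothesis hsol : mixed_solution O s x0 A f1 g sigma uh.

Definition flux_error (x : plane R) : plane R := flux x0 A du x - RTfun sigma x.

Lemma measurable_f2 : mfun (fun x => (f2 x0 x).1) /\ mfun (fun x => (f2 x0 x).2).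
Proof.
have c1 : continuous (fun x : plane R => x.1 - x0.1).
  by move=> x; apply: cvgB; [exact: cvg_fst|exact: cvg_cst].
have c2 : continuous (fun x : plane R => x.2 - x0.2).
  by move=> x; apply: cvgB; [exact: cvg_snd|exact: cvg_cst].
have m1 : mfun (fun x => x.1 - x0.1) :=
  measurable_funS measurableT (subsetT _) (plane_continuous_measurable c1).
have m2 : mfun (fun x => x.2 - x0.2) :=
  measurable_funS measurableT (subsetT _) (plane_continuous_measurable c2).
have mi : mfun (fun x => (2 * pi * enorm (x - x0) ^+ 2)^-1).
  apply: measurable_inv_fun; apply: measurable_funM => //.
  by apply: measurable_funX; exact: measurable_enorm.
by split; apply: measurable_funM.
Qed.

Lemma measurable_flux_error : mfun (fun x => (flux_error x).1) /\ mfun (fun x => (flux_error x).2).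
Proof.
have [_ [[m1 _] [m2 _]] _] := hu.
have [m3 m4] := measurable_mxv measurable_coef m1 m2.
have [ds [hsg _ _]] := hsol.
have [m5 m6] := measurable_RT hsg; have [m7 m8] := measurable_f2.
split.
  have : mfun (fun x => - (mxv (A x) (du x)).1 - (f2 x0 x).1 - (RTfun sigma x).1).
    by do 2! apply: measurable_funB => //; exact: measurable_funN.
  by [].
have : mfun (fun x => - (mxv (A x) (du x)).2 - (f2 x0 x).2 - (RTfun sigma x).2).
  by do 2! apply: measurable_funB => //; exact: measurable_funN.
by [].
Qed.

(** The definition of sigma, solved for the gradient of u. *)
Lemma Ainv_flux_error x : elliptic alpha (A x) ->
  Ainv flux_error x = - du x - Ainv (f2 x0) x - Ainv (RTfun sigma) x.
Proof.
move=> eA; have uA := elliptic_unit a0 eA.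
rewrite /Ainv /flux_error /flux !mxvD !mxvN -mxv_mul mulVmx// mxv1.
by [].
Qed.

Hypothesis errfin : (Lpnorm (leb2 R) O p%:E (fun x => enorm (flux_error x)) < +oo)%E.

Lemma integrable_enorm_flux_error : intO (fun x => enorm (flux_error x)).
Proof.
apply: (@Lp_integrable _ _ _ p) => //; first exact: ltW.
by split => //; have [m1 m2] := measurable_flux_error; exact: measurable_enorm.
Qed.

(** Integrating [Ainv_flux_error] against tau expresses the term with f2 of the
    discrete equation; Green's formula identifies its boundary term. *)
Lemma error_identity (tau : {ffun 'I_(ncell T) -> plane R * R}) dtau : inRT0 O tau dtau ->
  \int[leb2 R]_(x in O) (dtau x * P0fun (Qh T u - uh) x) =
  \int[leb2 R]_(x in O) dot (Ainv flux_error x) (RTfun tau x).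
Proof.
move=> ht; have [ds [hsg heq _]] := hsol.
have [me1 me2] := measurable_flux_error; have [ms1 ms2] := measurable_RT hsg.
have [mf1 mf2] := measurable_f2.
have [ie1 ie2] := integrable_Ainv me1 me2 integrable_enorm_flux_error.
have [is1 is2] := integrable_Ainv ms1 ms2 (integrable_enorm_RT hsg).
have id1 := integrable_du1 oO bO p1 hu; have id2 := integrable_du2 oO bO p1 hu.
have jd := integrable_dot_RT ht id1 id2.
have je := integrable_dot_RT ht ie1 ie2.
have js := integrable_dot_RT ht is1 is2.
have [mt1 mt2] := measurable_RT ht.
have F2 : \int[leb2 R]_(x in O) dot (Ainv (f2 x0) x) (RTfun tau x) =
  - (\int[leb2 R]_(x in O) dot (du x) (RTfun tau x))
  - (\int[leb2 R]_(x in O) dot (Ainv flux_error x) (RTfun tau x))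
  - \int[leb2 R]_(x in O) dot (Ainv (RTfun sigma) x) (RTfun tau x).
  have jd' : intO (fun x => (-1) * dot (du x) (RTfun tau x)) by exact: (integrableZl mO' _ jd).
  have jde : intO (fun x => (-1) * dot (du x) (RTfun tau x) - dot (Ainv flux_error x) (RTfun tau x)).
    exact: (integrableB mO' jd' je).
  have E1 : \int[leb2 R]_(x in O) ((-1) * dot (du x) (RTfun tau x)) =
    - \int[leb2 R]_(x in O) dot (du x) (RTfun tau x).
    by rewrite -[RHS]mulN1r; exact: (RintegralZl _ mO' jd).
  have E2 := RintegralB mO' jd' je; have E3 := RintegralB mO' jde js.
  rewrite -E1 -E2 -E3.
  rewrite /Rintegral; congr fine; apply: ae_eq_integral => //.
  - have [m1 m2] := measurable_Ainv mf1 mf2.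
    by apply/measurable_EFinP; apply: measurable_funD; apply: measurable_funM.
  - exact: measurable_int (integrableB mO' jde js).
  apply: ae_imp ae_elliptic => x eA Ox; congr EFin.
  by rewrite (Ainv_flux_error (eA Ox)) /dot /=; ring.
have iP v := integrable_mul_P0 oO hT v (integrable_dc oO bO ht).
transitivity (\int[leb2 R]_(x in O) (dtau x * P0fun (Qh T u) x - dtau x * P0fun uh x)).
  by apply: eq_Rintegral => x _; rewrite P0funB mulrBr.
rewrite (RintegralB mO' (iP _) (iP _)).
have G := green_RT ht; have := heq tau dtau ht.
rewrite -/(\int[leb2 R]_(x in O) dot (Ainv (RTfun sigma) x) (RTfun tau x)).
rewrite -/(\int[leb2 R]_(x in O) dot (Ainv (f2 x0) x) (RTfun tau x)).
rewrite F2 -G => H.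
lra.
Qed.

Lemma quotient_le (tau : {ffun 'I_(ncell T) -> plane R * R}) dtau : inRT0 O tau dtau ->
  inf_sup_quotient O p tau dtau (Qh T u - uh) <=
  alpha^-1 * fine (Lpnorm (leb2 R) O p%:E (fun x => enorm (flux_error x))).
Proof.
move=> ht; rewrite /inf_sup_quotient (error_identity ht) -/q.
set Nq := fine _; set N2 := fine _; set Np := fine _.
have Np0 : 0 <= Np by rewrite fine_ge0 ?Lnorm_ge0.
have Nq0 : 0 <= Nq by rewrite fine_ge0 ?Lnorm_ge0.
have N20 : 0 <= N2 by rewrite fine_ge0 ?Lnorm_ge0.
have [me1 me2] := measurable_flux_error.
have [ie1 ie2] := integrable_Ainv me1 me2 integrable_enorm_flux_error.
have je := integrable_dot_RT ht ie1 ie2.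
have [mt1 mt2] := measurable_RT ht.
have q0 : 0 < q by exact: conj_gt0.
have [C C0 HC] := RT_bounded bO hT tau.
have menT := measurable_enorm mt1 mt2.
have menE := measurable_enorm me1 me2.
have Nqfin : (Lpnorm (leb2 R) O q%:E (fun x => enorm (RTfun tau x)) < +oo)%E.
  apply: (Lpnorm_bounded_fin (C := C) q0 mO' Ofin menT) => x Ox.
  by rewrite ger0_norm ?enorm_ge0// HC.
have bd : \int[leb2 R]_(x in O) dot (Ainv flux_error x) (RTfun tau x) <= alpha^-1 * Np * Nq.
  rewrite (le_trans (ler_norm _))// -lee_fin EFin_normr_Rintegral//.
  apply: (le_trans (le_abse_integral _ mO' (measurable_int _ je))).
  apply: (@le_trans _ _ (\int[leb2 R]_(x in O)
    (alpha^-1%:E * (`|enorm (flux_error x) * enorm (RTfun tau x)|)%:E))%E).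
    apply: ae_ge0_le_integral => //.
    - by apply: measurableT_comp => //; exact: measurable_int je.
    - by move=> x _; rewrite mule_ge0// lee_fin ?invr_ge0 ?ltW.
    - apply: emeasurable_funM => //; apply/measurable_EFinP; apply: measurableT_comp => //.
      exact: measurable_funM.
    apply: ae_imp ae_elliptic => x eA Ox; rewrite -EFinM lee_fin.
    rewrite (ger0_norm (mulr_ge0 (enorm_ge0 (flux_error x)) (enorm_ge0 (RTfun tau x)))) mulrA.
    rewrite (le_trans (dot_le_enorm _ _))//.
    by rewrite ler_wpM2r ?enorm_ge0//; exact: elliptic_inv_le a0 (eA Ox).
  rewrite ge0_integralZl//; last 2 first.
  - by apply/measurable_EFinP; apply: measurableT_comp => //; exact: measurable_funM.
  - by rewrite lee_fin invr_ge0 ltW.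
  rewrite !EFinM -muleA; apply: lee_wpmul2l; first by rewrite lee_fin invr_ge0 ltW.
  rewrite /Np /Nq !fineK ?ge0_fin_numE ?Lnorm_ge0//.
  by apply: hoelder_set => //; exact: conj_exp.
have [d0|d0] := eqVneq (Nq + N2) 0.
  by rewrite d0 invr0 mulr0 mulr_ge0// invr_ge0 ltW.
rewrite ler_pdivrMr ?lt0r ?d0 ?addr_ge0//.
by rewrite (le_trans bd)// ler_wpM2l ?lerDl// mulr_ge0// invr_ge0 ltW.
Qed.

End error_identity.

(** * The error estimates *)

Lemma Lpnorm_triangle (R : realType) (m : {measure set (mplane R) -> \bar R})
    (D : set (plane R)) (p : R) (f g : plane R -> R) :
  measurable (D : set (mplane R)) -> 1 <= p ->
  measurable_fun D (f : mplane R -> R) -> measurable_fun D (g : mplane R -> R) ->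
  (Lpnorm m D p%:E (fun x => f x + g x)%R <= Lpnorm m D p%:E f + Lpnorm m D p%:E g)%E.
Proof.
move=> mD p1 mf mg.
have mf' : measurable_fun [set: mplane R] (f \_ D : mplane R -> R) by apply/(measurable_restrictT _ mD).
have mg' : measurable_fun [set: mplane R] (g \_ D : mplane R -> R) by apply/(measurable_restrictT _ mD).
apply: le_trans (minkowski_EFin m mf' mg' p1).
rewrite /Lpnorm (_ : (fun x => f x + g x) \_ D = (f \_ D) \+ (g \_ D))//.
by apply/funext => x; rewrite /patch /=; case: ifP => // _; rewrite addr0.
Qed.

Lemma le_of_inf_sup (R : realType) (O : set (plane R)) (T : mesh R) (p betap B : R)
    (v : {ffun 'I_(ncell T) -> R}) : 0 < betap -> inf_sup O T p betap ->
  (forall (tau : {ffun 'I_(ncell T) -> plane R * R}) dtau, inRT0 O tau dtau ->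
     inf_sup_quotient O p tau dtau v <= B) ->
  (Lpnorm (leb2 R) O 2%:E (P0fun v) <= (betap^-1 * B)%:E)%E.
Proof.
move=> b0 /(_ v) h hB.
have : (betap%:E * Lpnorm (leb2 R) O 2%:E (P0fun v) <= B%:E)%E.
  apply: (le_trans h); apply: ge_ereal_sup => _ [tau [dtau [ht _ ->]]].
  by rewrite lee_fin; exact: hB ht.
by move=> H; rewrite EFinM lee_pdivlMl.
Qed.

Unset Implicit Arguments.
Theorem theorem6p3 (R : realType)
  (O : set (plane R)) (hO : sc_lipschitz_domain O)
  (s : {measure set (mplane R) -> \bar R})
  (hs : is_arclength O s)
  (x0 : plane R) (hx0 : O x0)
  (p : R) (hp1 : 1 < p) (hp2 : p < 2)
  (alpha beta : R) (halpha : 0 < alpha) (hbeta : alpha <= beta)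
  (A : plane R -> 'M[R]_2) (hA : sym_elliptic O alpha beta A)
  (f1 : plane R -> R) (hf1 : inLp (leb2 R) O 2%:E f1)
  (g : plane R -> R) (hg : in_trace_space O s p g)
  (u : plane R -> R) (du : plane R -> plane R)
  (hu : dirac_solution O s p x0 A f1 g u du)
  (hu_unique : forall u' du', dirac_solution O s p x0 A f1 g u' du' ->
     {ae leb2 R, forall x, O x -> u' x = u x})
  (* the family of meshes, over which the constants are uniform *)
  (I : Type) (T : I -> mesh R)
  (hT : forall h, triangulation O (T h))
  (kappa : R) (hkappa : forall h, shape_regular kappa (T h))
  (sigmah : forall h, {ffun 'I_(ncell (T h)) -> plane R * R})
  (uh : forall h, {ffun 'I_(ncell (T h)) -> R})
  (hsol : forall h, mixed_solution O s x0 A f1 g (sigmah h) (uh h))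
  (hsol_unique : forall h sigma' u', @mixed_solution R O s x0 A f1 g (T h) sigma' u' ->
     sigma' = sigmah h /\ u' = uh h)
  (betap : R) (hbetap : 0 < betap)
  (hinfsup : forall h, inf_sup O (T h) p betap) :
  forall h,
    (Lpnorm (leb2 R) O 2%:E (fun x => (P0fun (Qh (T h) u) x - P0fun (uh h) x)%R) <=
     (1 / (alpha * betap))%:E *
       Lpnorm (leb2 R) O p%:E
         (fun x => enorm (flux x0 A du x - RTfun (sigmah h) x)%R))%E
    /\
    (Lpnorm (leb2 R) O 2%:E (fun x => (u x - P0fun (uh h) x)%R) <=
     ereal_inf [set Lpnorm (leb2 R) O 2%:E (fun x => (u x - P0fun v x)%R)
                 | v in [set: {ffun 'I_(ncell (T h)) -> R}]] +
     (1 / (alpha * betap))%:E *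
       Lpnorm (leb2 R) O p%:E
         (fun x => enorm (flux x0 A du x - RTfun (sigmah h) x)%R))%E.
Proof.
have [[oO _ bO _] [_ lipO]] := hO.
have [hu1 htr _] := hu; have [hg1 _] := hg.
have mO' := measurable_domain oO.
move=> h; set Np := Lpnorm (leb2 R) O p%:E _.
have part1 : (Lpnorm (leb2 R) O 2%:E (fun x => (P0fun (Qh (T h) u) x - P0fun (uh h) x)%R) <=
     (1 / (alpha * betap))%:E * Np)%E.
  have c0 : 0 < 1 / (alpha * betap) by rewrite divr_gt0 ?mulr_gt0.
  have [Ny|Nfin] := eqVneq Np +oo%E; first by rewrite Ny gt0_muley ?lte_fin ?leey.
  have errfin : (Np < +oo)%E by rewrite ltey.
  rewrite (@eq_Lpnorm _ _ _ _ _ (P0fun (Qh (T h) u - uh h))); last first.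
    by move=> x _; rewrite P0funB.
  have Nf : Np \is a fin_num by rewrite ge0_fin_numE ?Lnorm_ge0.
  rewrite -(fineK Nf) -EFinM div1r invfM mulrAC mulrC.
  apply: (le_of_inf_sup hbetap (hinfsup h)) => tau dtau ht.
  exact: (quotient_le oO bO lipO (hT h) hs halpha hA hp1 hu1 htr hg1 (hsol h) errfin ht).
split=> //.
have iu := integrable_u oO bO hp1 hu1.
have [[mu _] _ _] := hu1.
apply: (@le_trans _ _ (Lpnorm (leb2 R) O 2%:E (fun x => u x - P0fun (Qh (T h) u) x)%R +
  Lpnorm (leb2 R) O 2%:E (fun x => P0fun (Qh (T h) u) x - P0fun (uh h) x)%R)%E).
  rewrite (@eq_Lpnorm _ _ _ _ _ (fun x => (u x - P0fun (Qh (T h) u) x) +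
    (P0fun (Qh (T h) u) x - P0fun (uh h) x))); last by move=> x _; rewrite subrKA.
  apply: Lpnorm_triangle => //; first by rewrite ler1n.
  - by apply: measurable_funB => //; exact: (measurable_P0fun (hT h)).
  - by apply: measurable_funB; exact: (measurable_P0fun (hT h)).
apply: leeD => //; apply: le_ereal_inf_tmp => _ [v _ <-].
exact: (Qh_best oO bO lipO (hT h) v iu).
Qed.
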